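(* Let $\mathcal T$ be a reduced T-mesh, $\mathbf r$ a smoothness distribution on $\mathcal T$ that is constant along each maximal segment, $m,m'\ge0$ integers, and $\mathcal C:=\operatorname{CNDC}_{m,m'}^{\mathbf r}(\mathcal T)$. For every total order $\widehat\iota$ of $\operatorname{MIS}(\mathcal T)$ that follows the reversed deletion history, one has $$0\le\dim\mathcal H_{m,m'}^{\mathbf r}(\mathcal C;\mathcal T)\le\sum_{\rho\in\mathcal C\cap\operatorname{MIS}_h(\mathcal T)}\bigl(m+1-\omega_{\widehat\iota}(\rho)\bigr)_+\beta^{\mathbf r}(\rho)+\sum_{\rho\in\mathcal C\cap\operatorname{MIS}_v(\mathcal T)}\bigl(m'+1-\omega_{\widehat\iota}(\rho)\bigr)_+\beta^{\mathbf r}(\rho).$$ Consequently, $$\dim\mathcal S_{m,m'}^{\mathbf r}(\mathcal T)\le\chi\bigl(\mathcal Q_{m,m'}^{\mathbf r}(\mathcal T^\circ)\bigr)+\sum_{\rho\in\mathcal C\cap\operatorname{MIS}_h(\mathcal T)}\bigl(m+1-\omega_{\widehat\iota}(\rho)\bigr)_+\beta^{\mathbf r}(\rho)+\sum_{\rho\in\mathcal C\cap\operatorname{MIS}_v(\mathcal T)}\bigl(m'+1-\omega_{\widehat\iota}(\rho)\bigr)_+\beta^{\mathbf r}(\rho).$$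
   Context: **T-meshes.** Coordinates on $\mathbb R^2$ are $(s,t)$, with $s$ horizontal and $t$ vertical. Let $\Omega\subset\mathbb R^2$ be a finite union of closed axis-aligned rectangles with pairwise disjoint interiors, with $\Omega$ simply connected and $\Omega^\circ$ connected. A T-mesh on $\Omega$ is a triple $\mathcal T=(\mathcal T_2,\mathcal T_1,\mathcal T_0)$: $\mathcal T_2$ is the finite set of these closed rectangles (cells); $\mathcal T_1=\mathcal T_1^h\cup\mathcal T_1^v$ is a finite set of closed horizontal and vertical segments (edges) contained in $\bigcup_{\sigma\in\mathcal T_2}\partial\sigma$; $\mathcal T_0$ is the set of endpoints of edges (vertices); each $\partial\sigma$ is a finite union of edges; distinct cells $\sigma,\sigma'$ satisfy $\sigma\cap\sigma'=\partial\sigma\cap\partial\sigma'$, a finite union of edges and vertices; distinct edges meet only in vertices. Interior edges $\mathcal T_1^\circ$ are the edges meeting $\Omega^\circ$; the other edges are boundary edges. Interior vertices $\mathcal T_0^\circ$ are the vertices in $\Omega^\circ$. **Maximal segments.** A segment is a connected union of edges lying on one straight line. $\operatorname{MS}(\mathcal T)$ is the set of maximal segments consisting of interior edges. Such a segment is a cross-cut if both endpoints lie on $\partial\Omega$, a ray if exactly one does, and a maximal interior segment (MIS) if it does not meet $\partial\Omega$; $\operatorname{MIS}(\mathcal T)=\operatorname{MIS}_h(\mathcal T)\cup\operatorname{MIS}_v(\mathcal T)$ (horizontal/vertical). A boundary maximal segment is a maximal connected union of boundary edges on one line. $\widehat{\operatorname{MS}}(\mathcal T)$ is the set of all cross-cuts,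 rays, MISs and boundary maximal segments. $\mathcal T$ is reduced if no vertex is inserted merely to divide a straight edge into two collinear edges, every vertex lies on exactly one horizontal and exactly one vertical member of $\widehat{\operatorname{MS}}(\mathcal T)$, and the edges are exactly the closed subsegments between consecutive vertices on these members (so an interior and a boundary maximal segment of the same direction never meet collinearly at a common endpoint). **Smoothness.** A smoothness distribution is a map $\mathbf r:\mathcal T_1\to\{-1,0,1,\dots\}$ equal to $-1$ on boundary edges. It is constant along each maximal segment if for every $\rho\in\operatorname{MS}(\mathcal T)$ all edges $\tau\subset\rho$ have the same value $\mathbf r(\tau)=:r(\rho)$. For $\gamma\in\mathcal T_0^\circ$ with horizontal and vertical maximal segments $\rho_h(\gamma),\rho_v(\gamma)$ through it, $r_h(\gamma):=r(\rho_v(\gamma))$ and $r_v(\gamma):=r(\rho_h(\gamma))$. **Spline space and Euler characteristic.** $R_{a,b}=\operatorname{span}_{\mathbb R}\{s^it^j:0\le i\le a,\,0\le j\le b\}$, and $R_{a,b}=0$ if $a<0$ or $b<0$. $\mathcal S_{m,m'}^{\mathbf r}(\mathcal T)$ is the space of piecewise polynomial functions $f$ on $\Omega$ with $f|_\sigma\in R_{m,m'}$ for every cell $\sigma$ and $f$ of class $C^{\mathbf r(\tau)}$ across every interior edge $\tau$; $C^{-1}$ means no matching condition, so $f$ is regarded as a family of polynomials $(f_\sigma)_{\sigma\in\mathcal T_2}$. ($C^r$ across $\tau=$ common edge of $\sigma,\sigma'$ means $f_\sigma-f_{\sigma'}$ is divisible by $\ell_\tau^{r+1}$, where $\ell_\tau$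 is a nonzero affine linear polynomial vanishing on the line of $\tau$.) Put $I_\tau^{\mathbf r}=\langle\ell_\tau^{\mathbf r(\tau)+1}\rangle\cap R_{m,m'}$ for $\tau\in\mathcal T_1^\circ$ and $I_\gamma^{\mathbf r}=\sum_{\tau\ni\gamma,\tau\in\mathcal T_1^\circ}I_\tau^{\mathbf r}$ for $\gamma\in\mathcal T_0^\circ$. $\mathcal Q_{m,m'}^{\mathbf r}(\mathcal T^\circ)$ is the complex $0\to\bigoplus_{\sigma\in\mathcal T_2}[\sigma]R_{m,m'}\to\bigoplus_{\tau\in\mathcal T_1^\circ}[\tau]R_{m,m'}/I_\tau^{\mathbf r}\to\bigoplus_{\gamma\in\mathcal T_0^\circ}[\gamma]R_{m,m'}/I_\gamma^{\mathbf r}\to0$ with maps induced by the cellular boundary maps relative to $\partial\Omega$; its Euler characteristic is $\chi(\mathcal Q_{m,m'}^{\mathbf r}(\mathcal T^\circ))=\sum_{\sigma\in\mathcal T_2}\dim R_{m,m'}-\sum_{\tau\in\mathcal T_1^\circ}\dim(R_{m,m'}/I_\tau^{\mathbf r})+\sum_{\gamma\in\mathcal T_0^\circ}\dim(R_{m,m'}/I_\gamma^{\mathbf r})$. **Correction spaces.** For a maximal segment $\rho$, $\ell_\rho$ is a nonzero affine linear polynomial vanishing on the line of $\rho$ (normalised as $s-s_0$ for $s=s_0$, $t-t_0$ for $t=t_0$). For an MIS $\rho$, $\mathcal B_\rho=R_{m,m'-r(\rho)-1}$ if $\rho$ is horizontal and $\mathcal B_\rho=R_{m-r(\rho)-1,m'}$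 if $\rho$ is vertical. For $\mathcal A\subseteq\operatorname{MIS}(\mathcal T)$, $\mathcal M(\mathcal A)=\bigoplus_{\rho\in\mathcal A}[\rho]\mathcal B_\rho$ ($[\rho]$ a formal symbol). $\mathcal R(\mathcal T)\subseteq\mathcal M(\operatorname{MIS}(\mathcal T))$ is the subspace spanned by the vertex relations, for each interior vertex $\gamma=\rho_h\cap\rho_v$ ($\rho_h$ horizontal, $\rho_v$ vertical maximal segment) and each $q\in R_{m-r(\rho_v)-1,\,m'-r(\rho_h)-1}$: if both $\rho_h,\rho_v$ are MISs, $[\rho_v]\ell_{\rho_h}^{r(\rho_h)+1}q-[\rho_h]\ell_{\rho_v}^{r(\rho_v)+1}q$; if exactly one of them is an MIS, the same expression with the term of the non-MIS segment omitted. Put $\mathcal R_{\mathcal A}(\mathcal T):=\mathcal M(\mathcal A)\cap\mathcal R(\mathcal T)$ and $\mathcal H_{m,m'}^{\mathbf r}(\mathcal A;\mathcal T):=\mathcal M(\mathcal A)/\mathcal R_{\mathcal A}(\mathcal T)$. **Weights.** $(a)_+=\max\{a,0\}$, $\mu_h(\gamma)=(m-r_h(\gamma))_+$, $\mu_v(\gamma)=(m'-r_v(\gamma))_+$. For a total order $\iota:\rho_1\succ\cdots\succ\rho_t$ of $\operatorname{MIS}(\mathcal T)$, $\Gamma_\iota(\rho_i)$ is the set of vertices $\gamma$ on $\rho_i$ with $\gamma\notin\rho_j$ for all $j<i$; the relative weight $\omega_\iota(\rho_i)$ is $\sum_{\gamma\in\Gamma_\iota(\rho_i)}\mu_h(\gamma)$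 for $\rho_i$ horizontal, $\sum_{\gamma\in\Gamma_\iota(\rho_i)}\mu_v(\gamma)$ for $\rho_i$ vertical. A deletion state is a pair $(\mathcal A,\mathcal B)$ with $\mathcal A\cap\mathcal B=\varnothing$, $\mathcal A\cup\mathcal B=\operatorname{MIS}(\mathcal T)$. For $\rho\in\mathcal A$, $\operatorname{Mono}_{(\mathcal A,\mathcal B)}(\rho)$ is the set of vertices on $\rho$ lying on no MIS in $\mathcal A\setminus\{\rho\}$; the absolute weight $\Omega_{(\mathcal A,\mathcal B)}(\rho)$ is the sum over $\operatorname{Mono}_{(\mathcal A,\mathcal B)}(\rho)$ of $\mu_h(\gamma)$ for $\rho$ horizontal, of $\mu_v(\gamma)$ for $\rho$ vertical. The threshold is $\theta(\rho)=m+1$ for $\rho$ horizontal, $m'+1$ for $\rho$ vertical. $\rho\in\mathcal A$ is diagonalizable at $(\mathcal A,\mathcal B)$ if $\Omega_{(\mathcal A,\mathcal B)}(\rho)\ge\theta(\rho)$. Finally $\beta^{\mathbf r}(\rho)=(m'-r(\rho))_+$ for $\rho$ a horizontal MIS and $\beta^{\mathbf r}(\rho)=(m-r(\rho))_+$ for $\rho$ a vertical MIS. **Deletion algorithm, weighted CNDC, reversed deletion history.** Start with $\mathcal A=\operatorname{MIS}(\mathcal T)$, $\mathcal B=\varnothing$. In each pass let $\mathcal Z$ be the set of all $\rho\in\mathcal A$ diagonalizable at $(\mathcal A,\mathcal B)$, and replace $\mathcal A$ by $\mathcal A\setminus\mathcal Z$ and $\mathcal B$ by $\mathcal B\cup\mathcal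 Z$; repeat until a pass has $\mathcal Z=\varnothing$. The final $\mathcal A$ is the weighted CNDC $\operatorname{CNDC}_{m,m'}^{\mathbf r}(\mathcal T)$. Let $\mathcal Z_1,\dots,\mathcal Z_N$ be the nonempty sets removed in the successive passes. A total order $\widehat\iota$ (written from $\succ$-largest, listed first, to smallest) of $\operatorname{MIS}(\mathcal T)$ follows the reversed deletion history if it lists first the MISs in $\mathcal Z_N$, then those in $\mathcal Z_{N-1}$, and so on down to $\mathcal Z_1$, and finally those in $\operatorname{CNDC}_{m,m'}^{\mathbf r}(\mathcal T)$, with arbitrary order within each $\mathcal Z_k$ and within the CNDC. *)

(* Defs.v *)
From HB Require Import structures.
From mathcomp Require Import all_boot all_order all_algebra.
From mathcomp Require Import finmap.
From mathcomp Require Import all_classical all_reals all_analysis.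

Set Implicit Arguments.
Unset Strict Implicit.
Unset Printing Implicit Defensive.

Import Order.TTheory GRing.Theory Num.Theory.
Import numFieldNormedType.Exports.

Local Open Scope classical_set_scope.
Local Open Scope ring_scope.

(* Points of the plane are pairs (s, t), with s horizontal and t vertical. *)

Section Topology.
Context {T : topologicalType}.

Definition bdry (A : set T) : set T := closure A `\` A°.

Definition path_in (R : realType) (A : set T) (x y : T) (g : R -> T) : Prop :=
  [/\ {within `[0, 1], continuous g}, g @` `[0, 1] `<=` A, g 0 = x & g 1 = y].

(* Nonempty, path connected, and every loop contracts to its base point
   inside A, the base point staying fixed. *)
Definition simply_connected (R : realType) (A : set T) : Prop :=
  [/\ A !=set0,
      forall x y, A x -> A y -> exists g : R -> T, path_in A x y g
    & forall (x : T) (g : R -> T), path_in A x x g ->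
      exists H : R * R -> T,
        [/\ {within `[0, 1]%classic `*` `[0, 1]%classic, continuous H},
            H @` (`[0, 1]%classic `*` `[0, 1]%classic) `<=` A,
            forall u, 0 <= u <= 1 -> H (u, 0) = g u /\ H (u, 1) = x
          & forall v, 0 <= v <= 1 -> H (0, v) = x /\ H (1, v) = x]].

End Topology.

Section Span.
Context {K : fieldType} {V : vectType K}.

(* The default value is never used, see [span_ofP]. *)
Definition span_of (P : set V) : {vspace V} :=
  xget 0%VS [set U : {vspace V} | P `<=` [set` U] /\
    forall W : {vspace V}, P `<=` [set` W] -> (U <= W)%VS].

Lemma span_ofP (P : set V) : P `<=` [set` span_of P] /\
  forall W : {vspace V}, P `<=` [set` W] -> (span_of P <= W)%VS.
Proof.
suff : exists U : {vspace V}, P `<=` [set` U] /\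
    forall W : {vspace V}, P `<=` [set` W] -> (U <= W)%VS by exact: xgetPex.
pose Q n := `[< exists2 X : seq V, {in X, forall v, P v} & \dim <<X>> = n >].
have Q0 : exists n, Q n by exists 0%N; apply/asboolP; exists [::]; rewrite ?span_nil ?dimv0.
have Qle n : Q n -> (n <= \dim {:V})%N.
  by move=> /asboolP[X _ <-]; apply: dimvS; apply: subvf.
case: (ex_maxnP Q0 Qle) => n /asboolP[X XP dX] nmax; exists <<X>>%VS; split.
  move=> v Pv /=; apply: contrapT => /negP vX.
  have : Q (\dim <<v :: X>>).
    by apply/asboolP; exists (v :: X) => // w; rewrite inE => /orP[/eqP->//|/XP].
  move=> /nmax; rewrite leqNgt -dX => /negP; apply.
  rewrite ltn_neqAle dimvS ?andbT ?span_cons ?addvSr//.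
  apply: contra vX => /eqP e.
  have /eqP -> : <<X>>%VS == (<[v]> + <<X>>)%VS by rewrite eqEdim addvSr -e /=.
  by rewrite memvE addvSl.
by move=> W PW; apply/span_subvP => v /XP /PW.
Qed.

(* dim (U / W), for a subspace W of U. *)
Definition dim_quot (U W : {vspace V}) : int := (\dim U)%:Z - (\dim W)%:Z.

End Span.

Definition pospart (a : int) : int := Num.max a 0.

(* The rectangle [smin, smax] x [tmin, tmax]. *)
Record rect (R : Type) := Rect {smin : R; smax : R; tmin : R; tmax : R}.

(* The segment t = pos, lo <= s <= hi if horiz holds, and the segment s = pos,
   lo <= t <= hi otherwise. *)
Record seg (R : Type) := Seg {horiz : bool; pos : R; lo : R; hi : R}.

Definition rect_code (R : Type) (c : rect R) :=
  (smin c, smax c, tmin c, tmax c).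
Definition rect_decode (R : Type) (x : R * R * R * R) : rect R :=
  let: (a, b, c, d) := x in Rect a b c d.
Lemma rect_codeK (R : Type) : cancel (@rect_code R) (@rect_decode R).
Proof. by case. Qed.

Definition seg_code (R : Type) (e : seg R) := (horiz e, pos e, lo e, hi e).
Definition seg_decode (R : Type) (x : bool * R * R * R) : seg R :=
  let: (h, p, a, b) := x in Seg h p a b.
Lemma seg_codeK (R : Type) : cancel (@seg_code R) (@seg_decode R).
Proof. by case. Qed.

HB.instance Definition _ (R : choiceType) :=
  Choice.copy (rect R) (can_type (@rect_codeK R)).
HB.instance Definition _ (R : choiceType) :=
  Choice.copy (seg R) (can_type (@seg_codeK R)).

(* The vertices are determined by the edges, see [vertices]. *)
Record mesh (R : realType) := Mesh {cells : {fset rect R}; edges : {fset seg R}}.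

Section Geometry.
Context {R : realType}.
Implicit Types (c : rect R) (e : seg R) (p : R * R).

Definition rect_set c : set (R * R) :=
  [set p | (smin c <= p.1 <= smax c) && (tmin c <= p.2 <= tmax c)].

(* Coordinate of p along (resp. across) the horizontal or vertical direction. *)
Definition along (h : bool) p : R := if h then p.1 else p.2.
Definition across (h : bool) p : R := if h then p.2 else p.1.

Definition seg_set e : set (R * R) :=
  [set p | (across (horiz e) p == pos e) && (lo e <= along (horiz e) p <= hi e)].

Definition seg_lo e : R * R := if horiz e then (lo e, pos e) else (pos e, lo e).
Definition seg_hi e : R * R := if horiz e then (hi e, pos e) else (pos e, hi e).

End Geometry.

Section Mesh.
Context {R : realType}.
Variable T : mesh R.

Definition vertices : {fset R * R} :=
  ([fset seg_lo e | e in edges T] `|` [fset seg_hi e | e in edges T])%fset.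

Definition domain : set (R * R) := \bigcup_(c in [set` cells T]) rect_set c.

Definition carrier (A : {set edges T}) : set (R * R) :=
  \bigcup_(e in [set` A]) seg_set (val e).

Record is_tmesh : Prop := {
  cells_nondeg : forall c, c \in cells T -> smin c < smax c /\ tmin c < tmax c;
  cells_disjoint : forall c c', c \in cells T -> c' \in cells T -> c != c' ->
    (rect_set c)° `&` (rect_set c')° = set0;
  domain_simply_connected : simply_connected R domain;
  domain_interior_connected : connected domain°;
  edges_nondeg : forall e, e \in edges T -> lo e < hi e;
  edges_sub : forall e, e \in edges T ->
    seg_set e `<=` \bigcup_(c in [set` cells T]) bdry (rect_set c);
  cells_bdry : forall c, c \in cells T ->
    exists A : {set edges T}, bdry (rect_set c) = carrier A;
  cells_meet : forall c c', c \in cells T -> c' \in cells T -> c != c' ->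
    rect_set c `&` rect_set c' = bdry (rect_set c) `&` bdry (rect_set c') /\
    exists (A : {set edges T}) (B : {set vertices}),
      rect_set c `&` rect_set c' = carrier A `|` [set val g | g in [set` B]];
  edges_meet : forall e e', e \in edges T -> e' \in edges T -> e != e' ->
    seg_set e `&` seg_set e' `<=` [set` vertices]
}.

Definition interior_edge (e : edges T) : bool :=
  `[< seg_set (val e) `&` domain° !=set0 >].

Definition interior_vertex (g : vertices) : bool := `[< domain° (val g) >].

Definition segment (A : {set edges T}) : Prop :=
  [/\ A != finset.set0,
      forall e e', e \in A -> e' \in A ->
        horiz (val e) = horiz (val e') /\ pos (val e) = pos (val e')
    & connected (carrier A)].

Definition MS : {set {set edges T}} :=
  [set x | maxset (fun A => `[< segment A >] && [forall e in A, interior_edge e]) x].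

Definition boundary_MS : {set {set edges T}} :=
  [set x | maxset (fun A => `[< segment A >] && [forall e in A, ~~ interior_edge e]) x].

(* Direction and position of the line carrying a (nonempty) segment. *)
Definition line (x : {set edges T}) : bool * R :=
  if [pick e in x] is Some e then (horiz (val e), pos (val e)) else (true, 0).
Definition hor (x : {set edges T}) : bool := (line x).1.

Definition endpoint (x : {set edges T}) (p : R * R) : Prop :=
  carrier x p /\
  ((forall q, carrier x q -> along (hor x) p <= along (hor x) q) \/
   (forall q, carrier x q -> along (hor x) q <= along (hor x) p)).

Definition cross_cut (x : {set edges T}) : Prop :=
  x \in MS /\ forall p, endpoint x p -> bdry domain p.

Definition ray (x : {set edges T}) : Prop :=
  [/\ x \in MS, exists2 p, endpoint x p & bdry domain p
    & exists2 p, endpoint x p & ~ bdry domain p].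

Definition MIS : {set {set edges T}} :=
  [set x in MS | `[< carrier x `&` bdry domain = set0 >]].

Definition hatMS (x : {set edges T}) : Prop :=
  [\/ cross_cut x, ray x, x \in MIS | x \in boundary_MS].

Record reduced : Prop := {
  no_dividing_vertex : ~ exists g : vertices, exists e1 e2 : edges T,
    [/\ e1 != e2, horiz (val e1) = horiz (val e2), pos (val e1) = pos (val e2)
      & forall e : edges T, seg_set (val e) (val g) <-> e = e1 \/ e = e2];
  vertex_hatMS : forall (g : vertices) (h : bool),
    exists! x, [/\ hatMS x, hor x = h & carrier x (val g)];
  edges_consecutive : forall e : seg R, e \in edges T <->
    exists x, [/\ hatMS x, (horiz e, pos e) = line x, lo e < hi e,
      [/\ seg_lo e \in vertices, carrier x (seg_lo e),
          seg_hi e \in vertices & carrier x (seg_hi e)]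
    & forall p, p \in vertices -> carrier x p ->
        ~~ (lo e < along (horiz e) p < hi e)]
}.

(* The maximal segment of direction h through the vertex g, unique when g is
   interior and the mesh is reduced. *)
Definition MS_at (h : bool) (g : vertices) : {set edges T} :=
  odflt finset.set0 [pick x in MS | (hor x == h) && `[< carrier x (val g) >]].

Definition smoothness (r : edges T -> int) : Prop :=
  (forall e, -1 <= r e) /\ (forall e, ~~ interior_edge e -> r e = -1).

Definition constant_along_MS (r : edges T -> int) : Prop :=
  forall x, x \in MS -> forall e e', e \in x -> e' \in x -> r e = r e'.

End Mesh.

Section Polynomials.
Context {R : realType}.

(* Polynomials in s, t are elements of {poly {poly R}}: 'X is s and 'Y is t, so
   that p`_i`_j is the coefficient of s ^ i t ^ j. *)

(* The space R_{a,b}; it is zero as soon as a < 0 or b < 0. *)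
Definition bideg (a b : int) : set {poly {poly R}} :=
  [set p : {poly {poly R}} | forall i j : nat, p`_i`_j != 0 -> (i%:Z <= a) && (j%:Z <= b)].

(* 'M[R]_(m.+1, m'.+1) is the model of R_{m,m'} as a vector space over R. *)
Definition bipoly (m m' : nat) (A : 'M[R]_(m.+1, m'.+1)) : {poly {poly R}} :=
  \sum_(i < m.+1) \sum_(j < m'.+1) (A i j)%:P%:P * ('X ^+ i * 'Y ^+ j).

Definition ell (l : bool * R) : {poly {poly R}} :=
  if l.1 then 'Y - l.2%:P%:P else 'X - l.2%:P%:P.

(* ell_l ^ (k + 1), for k >= -1. *)
Definition ellX (l : bool * R) (k : int) : {poly {poly R}} := ell l ^+ absz (k + 1).

End Polynomials.

Section Splines.
Context {R : realType}.
Variables (T : mesh R) (r : edges T -> int) (m m' : nat).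

Local Notation V := 'M[R]_(m.+1, m'.+1).

Definition edge_ellX (e : edges T) : {poly {poly R}} :=
  ellX (horiz (val e), pos (val e)) (r e).

Definition spline (f : {ffun cells T -> V}) : Prop :=
  forall (e : edges T) (c c' : cells T), interior_edge e -> c != c' ->
    seg_set (val e) `<=` rect_set (val c) `&` rect_set (val c') ->
    exists g, bipoly (f c) - bipoly (f c') = edge_ellX e * g.

Definition spline_space : {vspace {ffun cells T -> V}} := span_of spline.

Definition dim_spline : int := (\dim spline_space)%:Z.

Definition edge_ideal (e : edges T) : {vspace V} :=
  span_of [set A | exists g, bipoly A = edge_ellX e * g].

Definition vertex_ideal (g : vertices T) : {vspace V} :=
  (\sum_(e : edges T | interior_edge e && `[< seg_set (val e) (val g) >])
     edge_ideal e)%VS.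

Definition chi : int :=
  \sum_(c : cells T) (\dim {:V})%:Z
  - \sum_(e : edges T | interior_edge e) dim_quot {:V} (edge_ideal e)
  + \sum_(g : vertices T | interior_vertex g) dim_quot {:V} (vertex_ideal g).

Definition smooth (x : {set edges T}) : int :=
  if [pick e in x] is Some e then r e else -1.

Definition msX (x : {set edges T}) : {poly {poly R}} := ellX (line x) (smooth x).

Definition corr_space (x : {set edges T}) : set {poly {poly R}} :=
  if hor x then bideg m%:Z (m'%:Z - smooth x - 1)
  else bideg (m%:Z - smooth x - 1) m'%:Z.

(* The component of u at x is the coefficient of the formal symbol [x]. *)
Definition corr_sum (A : {set {set edges T}}) :
    {vspace {ffun {set edges T} -> V}} :=
  span_of [set u : {ffun {set edges T} -> V} | forall x,
    if x \in A then corr_space x (bipoly (u x)) else u x = 0].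

(* When neither segment through g is an MIS this only gives u = 0. *)
Definition vertex_relation (u : {ffun {set edges T} -> V}) : Prop :=
  exists2 g : vertices T, interior_vertex g &
  let xh := MS_at true g in let xv := MS_at false g in
  exists2 q, bideg (m%:Z - smooth xv - 1) (m'%:Z - smooth xh - 1) q &
    forall x, bipoly (u x) =
      if x \notin MIS T then 0
      else if x == xv then msX xh * q
      else if x == xh then - (msX xv * q)
      else 0.

Definition relations : {vspace {ffun {set edges T} -> V}} :=
  span_of vertex_relation.

Definition dim_H (A : {set {set edges T}}) : int :=
  dim_quot (corr_sum A) (corr_sum A :&: relations)%VS.

(* mu true is mu_h and mu false is mu_v; note that r_h(g) is the smoothness
   across the vertical segment through g. *)
Definition mu (h : bool) (g : vertices T) : int :=
  if h then pospart (m%:Z - smooth (MS_at false g))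
  else pospart (m'%:Z - smooth (MS_at true g)).

Definition weight (A : {set {set edges T}}) (x : {set edges T}) : int :=
  \sum_(g : vertices T | `[< carrier x (val g) >] &&
      [forall y in A, ~~ `[< carrier y (val g) >]]) mu (hor x) g.

(* A total order is given by the list of all MISs from largest to smallest. *)
Definition total_order_MIS (iota : seq {set edges T}) : Prop :=
  uniq iota /\ iota =i MIS T.

Definition rel_weight (iota : seq {set edges T}) (x : {set edges T}) : int :=
  weight [set y in MIS T | (index y iota < index x iota)%N] x.

Definition threshold (x : {set edges T}) : int :=
  if hor x then m%:Z + 1 else m'%:Z + 1.

Definition abs_weight (A : {set {set edges T}}) (x : {set edges T}) : int :=
  weight (A :\ x)%SET x.

(* In a deletion state (A, B), B is the complement of A in MIS T and is left
   implicit. *)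
Definition diagonalizable_MIS (A : {set {set edges T}}) : {set {set edges T}} :=
  [set x in A | threshold x <= abs_weight A x].

Definition deletion_state (k : nat) : {set {set edges T}} :=
  iter k (fun A => A :\: diagonalizable_MIS A)%SET (MIS T).

(* The set removed in pass k + 1, empty after the algorithm has stopped. *)
Definition deleted (k : nat) : {set {set edges T}} :=
  diagonalizable_MIS (deletion_state k).

(* Every pass before the stopping one removes an MIS, so that #|MIS T| passes
   suffice. *)
Definition CNDC : {set {set edges T}} := deletion_state #|MIS T|.

Definition precedes (iota : seq {set edges T}) (x y : {set edges T}) : Prop :=
  (index x iota < index y iota)%N.

Definition follows_reversed_deletion (iota : seq {set edges T}) : Prop :=
  (forall (k l : nat) x y, (k < l)%N -> x \in deleted k -> y \in deleted l ->
     precedes iota y x) /\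
  (forall (k : nat) x y, x \in deleted k -> y \in CNDC -> precedes iota x y).

Definition beta (x : {set edges T}) : int :=
  if hor x then pospart (m'%:Z - smooth x) else pospart (m%:Z - smooth x).

Definition bound (iota : seq {set edges T}) : int :=
  \sum_(x in CNDC | hor x)
     pospart (m%:Z + 1 - rel_weight iota x) * beta x +
  \sum_(x in CNDC | ~~ hor x)
     pospart (m'%:Z + 1 - rel_weight iota x) * beta x.

End Splines.

(* Main.v *)
Require Import Defs.
From HB Require Import structures.
From mathcomp Require Import all_boot all_order all_algebra.
From mathcomp Require Import finmap.
From mathcomp Require Import all_classical all_reals all_analysis.
From mathcomp Require Import zify ring lra.

Set Implicit Arguments.
Unset Strict Implicit.
Unset Printing Implicit Defensive.

Import Order.TTheory GRing.Theory Num.Theory.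
Import numFieldNormedType.Exports.

Local Open Scope classical_set_scope.
Local Open Scope ring_scope.

(* The jumps of a family of polynomials (f_c) across the interior edges form a
   cochain whose circulation around every interior vertex vanishes. Conversely,
   every such cochain comes from a family (f_c): around each point of the domain
   it has a potential, and the potentials at nearby points differ by a constant,
   so they form a local system, which is trivial because the domain is simply
   connected. Counting dimensions, dim S - chi is therefore at most the dimension
   of the cokernel of the boundary map from the sum of the edge ideals I_e to
   the sum of the vertex ideals I_g. In this cokernel an element of the ideal of
   a maximal segment can be moved along the segment, and out of the domain if the
   segment is not an MIS; hence the cokernel is a quotient of M(MIS) / R.

   The sum of the spaces (X - a_i)^e_i P_(n - e_i), the a_i being distinct, is
   the space P_n of all polynomials of degree at most n as soon as the
   sum of the (n + 1 - e_i)_+ is at least n + 1. For the vertices a_i on a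
   diagonalizable MIS this shows, pass after pass, that the deleted MISs lie
   in R, so that M(C) already maps onto M(MIS) / R. For an MIS x in C, adding
   one fictitious point to the vertices counted in its relative weight shows that
   x contributes at most (threshold - weight)_+ * beta to dim H, modulo R and
   the MISs of C that come after x. *)

(** * Local systems on simply connected sets *)

(** Simple connectivity speaks of continuous loops, a cochain of finitely many edges. The bridge is
    a function [D] of two points, the difference of the potentials at [p] and [q] read on a cell
    through [q]: it can be integrated along arbitrary paths and over the square of a homotopy, where
    Cousin's lemma does the work of a subdivision. The reversed deletion history serves to keep
    relations inside M(C). A vertex counted in the relative weight of x in C lies on no MIS before
    x, so an MIS crossing x there comes after x. Every deleted MIS comes before x; hence the
    crossing MIS belongs to C, and the vertex relation lies in M(C) as well as in R. The product in
    the bound is a count of coefficients: the fictitious point supplies exactly the missing weight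
    d, and its share consists of multiples of one power, with d coefficients along x and beta across
    it. *)

Section RealInduction.
Variable R : realType.

(** At the supremum of the [t] with [P a t], the local hypothesis carries [P a] further unless the
    supremum is [b]. This stands in for compactness: local sections are glued one small interval
    after the other. *)
Lemma cousin (P : R -> R -> Prop) (a b : R) : a <= b ->
  (forall x y z, a <= x -> x <= y -> y <= z -> z <= b ->
     P x y -> P y z -> P x z) ->
  (forall x, a <= x -> x <= b -> exists2 e, 0 < e & forall y z,
     a <= y -> y <= x -> x <= z -> z <= b -> x - e < y -> z < x + e -> P y z) ->
  P a b.
Proof.
move=> ab Padd Ploc.
pose S := [set t | [/\ a <= t, t <= b & P a t]].
have Sa : S a.
  have [e e0 /(_ a a)] := Ploc a (lexx a) ab.
  by move=> /(_ (lexx a) (lexx a) (lexx a) ab) H; split=> //; apply: H; lra.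
have Sub : has_sup S by split; [exists a | exists b => t []].
have las : a <= sup S by apply: ub_le_sup => //; case: Sub.
have lsb : sup S <= b by apply: ge_sup; [exists a | move=> t []].
have [e e0 He] := Ploc _ las lsb.
have [t St lt] := sup_adherent e0 Sub.
have ts : t <= sup S by apply: ub_le_sup => //; case: Sub.
case: (St) => at_ tb Pat.
pose z := Num.min (sup S + e / 2) b.
have sz : sup S <= z by rewrite /z le_min lsb andbT; lra.
have zb : z <= b by rewrite /z ge_min lexx orbT.
have ze : z < sup S + e by rewrite /z gt_min; apply/orP; left; lra.
have Saz : P a z by apply: (Padd a t z) => //; [lra | apply: He].
have : z <= sup S by apply: ub_le_sup; [case: Sub | split=> //; lra].
rewrite /z ge_min => /orP[|bs]; first by lra.
by have <- : z = b by apply/eqP; rewrite eq_le zb /=; lra.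
Qed.

Lemma locally_constant_itv (Z : Type) (f : R -> Z) (a b : R) : a <= b ->
  (forall t, a <= t <= b -> \forall s \near t, a <= s <= b -> f s = f t) ->
  f a = f b.
Proof.
move=> ab floc; apply: (@cousin (fun x y => f x = f y) a b) => //.
  by move=> x y z _ _ _ _ -> ->.
move=> x ax xb.
have /floc/nbhs_ballP[e /= e0 He] : a <= x <= b by rewrite ax xb.
exists e => // y z ay yx xz zb ye ze.
rewrite (He y) ?(He z) //; rewrite /ball /= ?ltr_norml; lra.
Qed.

End RealInduction.

Lemma subr_exchange (Z : zmodType) (a b c d : Z) : a - b = c - d -> b - d = a - c.
Proof. by move=> E; rewrite -(subrK b a) E addrAC [c - d - c]addrAC subrr add0r addrC. Qed.

(* A cocycle D assigns to nearby points of Om a transport between the local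
   sections of a locally constant sheaf; locsol K h G says that G is a section
   over K of its pullback along h. *)
Section Cocycle.
Variables (R : realType) (Z : zmodType) (X : topologicalType).
Variables (Om : set X) (D : X -> X -> Z).

(** The neighbourhood for [z] may depend on [y]: on a mesh, a comparison starting at [y] is valid
    only at the scale of the mesh around [y]. *)
Definition cocycle := forall x, Om x -> \forall y \near x, Om y ->
  \forall z \near y, Om z -> D x z = D x y + D y z.

Definition locsol (U : topologicalType) (K : set U) (h : U -> X) (G : U -> Z) :=
  forall p, K p -> \forall q \near p, K q -> G q - G p = D (h p) (h q).

Definition cont_in (U : topologicalType) (K : set U) (h : U -> X) :=
  (forall p, K p -> Om (h p)) /\
  forall p, K p -> forall W, nbhs (h p) W -> \forall q \near p, K q -> W (h q).

Hypothesis Dcoc : cocycle.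

Lemma cocycle_id x : Om x -> D x x = 0.
Proof.
move=> Ox; have /nbhs_singleton/(_ Ox)/nbhs_singleton/(_ Ox)/eqP := Dcoc Ox.
by rewrite -[X in X == _]addr0 (inj_eq (addrI _)) eq_sym => /eqP.
Qed.

(** After [G2] is shifted by [k], the two sections agree on the overlap; a point of only one piece
    has a neighbourhood that misses the other, because the pieces are closed. *)
Lemma locsol_glue (U : topologicalType) (K1 K2 : set U) h G1 G2 :
  closed K1 -> closed K2 ->
  (exists k, forall p, K1 p -> K2 p -> G1 p = G2 p + k) ->
  locsol K1 h G1 -> locsol K2 h G2 -> exists G, locsol (K1 `|` K2) h G.
Proof.
move=> cK1 cK2 [k Hk] s1 s2.
exists (fun p => if `[< K1 p >] then G1 p else G2 p + k) => p Kp.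
have out K : closed K -> ~ K p -> \forall q \near p, ~ K q.
  by move=> cK nK; apply: (open_nbhs_nbhs (conj (closed_openC cK) nK)).
case: (pselect (K1 p)) => [K1p|nK1].
  case: (pselect (K2 p)) => [K2p|nK2].
    have := s1 p K1p; have := s2 p K2p; apply: filterS2 => q H2 H1 Kq.
    rewrite (asboolT K1p); case: asboolP => [K1q|nK1q]; first exact: H1.
    have K2q : K2 q by case: Kq.
    by rewrite (Hk p) // opprD addrACA subrr addr0 H2.
  have := s1 p K1p; have := out _ cK2 nK2; apply: filterS2 => q nq H1 [K1q|//].
  by rewrite (asboolT K1p) (asboolT K1q) H1.
have K2p : K2 p by case: Kp.
have := s2 p K2p; have := out _ cK1 nK1; apply: filterS2 => q nq H2 [//|K2q].
by rewrite (asboolF nK1) (asboolF nq) opprD addrACA subrr addr0 H2.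
Qed.

Lemma locsol_diff (U : topologicalType) (K : set U) h G1 G2 (g : R -> U) :
  locsol K h G1 -> locsol K h G2 -> 
  (forall t, 0 <= t <= 1 -> {for t, continuous g}) ->
  (forall t, 0 <= t <= 1 -> K (g t)) ->
  G1 (g 1) - G1 (g 0) = G2 (g 1) - G2 (g 0).
Proof.
move=> s1 s2 cg Kg.
have : G1 (g 0) - G2 (g 0) = G1 (g 1) - G2 (g 1).
  apply: (@locally_constant_itv R Z (fun t => G1 (g t) - G2 (g t))) => // t t01.
  have N1 := cg t t01 _ (s1 _ (Kg t t01)); have N2 := cg t t01 _ (s2 _ (Kg t t01)).
  near=> s => s01.
  have H1 : K (g s) -> G1 (g s) - G1 (g t) = D (h (g t)) (h (g s)) by near: s.
  have H2 : K (g s) -> G2 (g s) - G2 (g t) = D (h (g t)) (h (g s)) by near: s.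
  by symmetry; apply: subr_exchange; rewrite H1 ?H2 //; exact: Kg.
by move/esym/subr_exchange.
Unshelve. all: by end_near. Qed.

Lemma locsol_const (U : topologicalType) (K : set U) h G x (g : R -> U) :
  Om x -> locsol K h G ->
  (forall t, 0 <= t <= 1 -> {for t, continuous g}) ->
  (forall t, 0 <= t <= 1 -> K (g t)) -> (forall t, 0 <= t <= 1 -> h (g t) = x) ->
  G (g 1) = G (g 0).
Proof.
move=> Ox s1 cg Kg hg.
symmetry; apply: (@locally_constant_itv R Z (fun t => G (g t))) => // t t01.
have N1 := cg t t01 _ (s1 _ (Kg t t01)).
near=> s => s01.
have H : K (g s) -> G (g s) - G (g t) = D (h (g t)) (h (g s)) by near: s.
by have /eqP := H (Kg s s01); rewrite !hg // cocycle_id // subr_eq0 => /eqP.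
Unshelve. all: by end_near. Qed.

End Cocycle.

(** * Local sections over intervals and squares *)

Section Boxes.
Variable R : realType.

Definition segt (p q : R * R) (t : R) : R * R :=
  (p.1 + t * (q.1 - p.1), p.2 + t * (q.2 - p.2)).

Lemma segt_continuous p q : continuous (segt p q).
Proof.
move=> t; rewrite /segt.
apply: (@cvg_pair _ _ _ (nbhs t) (nbhs (p.1 + t * (q.1 - p.1)))
                                 (nbhs (p.2 + t * (q.2 - p.2))));
  by apply: cvgD; [exact: cvg_cst | apply: cvgM; [exact: cvg_id | exact: cvg_cst]].
Qed.

Lemma segt0 p q : segt p q 0 = p.
Proof. by rewrite /segt !mul0r !addr0; case: p. Qed.

Lemma segt1 p q : segt p q 1 = q.
Proof. by rewrite /segt !mul1r ![_ + (_ - _)]addrC !subrK; case: q. Qed.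

Definition box (a b c d : R) : set (R * R) :=
  [set p | (a <= p.1 <= b) && (c <= p.2 <= d)].

Lemma closed_box a b c d : closed (box a b c d).
Proof.
have -> : box a b c d = fst @^-1` `[a, b]%classic `&` snd @^-1` `[c, d]%classic.
  apply/seteqP; split=> p; rewrite /box /= !in_itv /=; first by case/andP.
  by case=> -> ->.
by apply: closedI; apply: closed_comp; [move=> x _; exact: cvg_fst | exact: itv_closed
  |move=> x _; exact: cvg_snd | exact: itv_closed].
Qed.

Lemma itv_convex (a b x y t : R) : a <= x <= b -> a <= y <= b -> 0 <= t <= 1 ->
  a <= x + t * (y - x) <= b.
Proof. by move=> /andP[? ?] /andP[? ?] /andP[? ?]; apply/andP; split; nra. Qed.

Lemma box_segt a b c d p q t : box a b c d p -> box a b c d q -> 0 <= t <= 1 ->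
  box a b c d (segt p q t).
Proof. by move=> /andP[p1 p2] /andP[q1 q2] t01; apply/andP; split; exact: itv_convex. Qed.

End Boxes.

Section Transport.
Variables (R : realType) (Z : zmodType) (X : topologicalType).
Variables (Om : set X) (D : X -> X -> Z).
Hypothesis Dcoc : cocycle Om D.

Lemma locsol_sub (U : topologicalType) (K K' : set U) (h : U -> X) (G : U -> Z) :
  K' `<=` K -> locsol D K h G -> locsol D K' h G.
Proof. by move=> sK s p /sK /s; apply: filterS => q H /sK. Qed.

(** The function [D (h p)] is itself a section near [p]; this is the local existence that Cousin's
    lemma globalises. *)
Lemma locsol_near (U : topologicalType) (K : set U) (h : U -> X) p :
  cont_in Om K h -> K p -> \forall q \near p, K q ->
  \forall q' \near q, K q' -> D (h q) (h q') = D (h p) (h q') - D (h p) (h q).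
Proof.
move=> [hO hc] Kp; have := hc p Kp _ (Dcoc (hO p Kp)).
apply: filterS => q Hq Kq; have := hc q Kq _ (Hq Kq (hO q Kq)).
apply: filterS => q' Hq' Kq'; rewrite (Hq' Kq' (hO q' Kq')) addrC addKr //.
Qed.

Lemma locsol_itv (h : R -> X) (a b : R) : a <= b ->
  cont_in Om `[a, b]%classic h -> exists G, locsol D `[a, b]%classic h G.
Proof.
move=> ab hc.
apply: (@cousin R (fun x y => exists G, locsol D `[x, y]%classic h G)) => //.
  move=> x y z ax xy yz zb [G1 s1] [G2 s2].
  have [] := @locsol_glue _ _ D _ `[x, y]%classic `[y, z]%classic h G1 G2 _ _ _ s1 s2.
  - exact: itv_closed.
  - exact: itv_closed.
  - exists (G1 y - G2 y) => p /=; rewrite !in_itv /= => /andP[_ py] /andP[yp _].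
    by have -> : p = y; [apply/eqP; rewrite eq_le py | rewrite addrC subrK].
  - move=> G s; exists G; apply: locsol_sub s => p /=; rewrite !in_itv /=.
    by move=> /andP[xp pz]; case: (leP p y) => py; [left; apply/andP | right; rewrite (ltW py)].
move=> x ax xb.
have Kx : `[a, b]%classic x by rewrite /= in_itv /= ax.
have /nbhs_ballP[e /= e0 He] := locsol_near hc Kx.
exists e => // y z ay yx xz zb ye ze.
exists (fun q => D (h x) (h q)) => q /=; rewrite in_itv /= => /andP[yq qz].
have Kq : `[a, b]%classic q by rewrite /= in_itv /=; apply/andP; split; lra.
have qB : ball x e q by rewrite /ball /= ltr_norml; apply/andP; split; lra.
have := He q qB Kq; apply: filterS => q' Hq'; rewrite in_itv /= => /andP[yq' q'z].
by rewrite Hq' //= in_itv /=; apply/andP; split; lra.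
Qed.

(** The intersection of two boxes is convex, so the two sections differ there by a constant, as
    comparing them along segments from [p] shows. *)
Lemma locsol_box_glue (h : R * R -> X) G1 G2 a b c d a' b' c' d' p :
  (box a b c d `&` box a' b' c' d') p ->
  locsol D (box a b c d) h G1 -> locsol D (box a' b' c' d') h G2 ->
  exists G, locsol D (box a b c d `|` box a' b' c' d') h G.
Proof.
move=> [p1 p2] s1 s2.
apply: (locsol_glue _ _ _ s1 s2); try exact: closed_box.
exists (G1 p - G2 p) => q q1 q2.
have s1' := @locsol_sub _ _ (box a b c d `&` box a' b' c' d') _ _ (@subIsetl _ _ _) s1.
have s2' := @locsol_sub _ _ (box a b c d `&` box a' b' c' d') _ _ (@subIsetr _ _ _) s2.
have H : G1 q - G1 p = G2 q - G2 p.
  have := locsol_diff s1' s2' (g := segt p q); rewrite !segt0 !segt1; apply.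
    by move=> t _; exact: segt_continuous.
  by move=> t t01; split; apply: box_segt.
by rewrite (subr_exchange H) addrC subrK.
Qed.

Lemma locsol_square (h : R * R -> X) :
  cont_in Om (box 0 1 0 1) h -> exists G, locsol D (box 0 1 0 1) h G.
Proof.
move=> hc.
apply: (@cousin R (fun a b => exists G, locsol D (box a b 0 1) h G)) => //.
  move=> x y z ax xy yz zb [G1 s1] [G2 s2].
  have [] := locsol_box_glue (p := (y, 0)) _ s1 s2.
    by split; rewrite /box /= ?lexx ?xy ?yz ?ler01.
  move=> G s; exists G; apply: locsol_sub s => -[p1 p2]; rewrite /box /=.
  move=> /andP[/andP[xp pz] ->]; rewrite !andbT.
  by case: (leP p1 y) => py; [left; rewrite xp | right; rewrite (ltW py)].
move=> u u0 u1.
(* Second use of Cousin's lemma, now in the ordinate near the fixed abscissa [u]. The property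
   carries a width [e] of the strip, so that stacking two boxes only takes the smaller of two
   widths. *)
apply: (@cousin R (fun c d => exists2 e, 0 < e & forall a b, 0 <= a -> a <= u ->
   u <= b -> b <= 1 -> u - e < a -> b < u + e -> exists G, locsol D (box a b c d) h G)) => //.
  move=> x y z ax xy yz zb [e1 e10 H1] [e2 e20 H2].
  exists (Num.min e1 e2); first by rewrite lt_min e10.
  move=> a b a0 au ub b1 ea eb.
  have [l1 l2] : Num.min e1 e2 <= e1 /\ Num.min e1 e2 <= e2.
    by split; rewrite ge_min lexx ?orbT.
  have [||G1 s1] := H1 a b a0 au ub b1; [lra..|].
  have [||G2 s2] := H2 a b a0 au ub b1; [lra..|].
  have [] := locsol_box_glue (p := (u, y)) _ s1 s2.
    by split; rewrite /box /= ?lexx ?xy ?yz ?au ?ub.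
  move=> G s; exists G; apply: locsol_sub s => -[p1 p2]; rewrite /box /=.
  move=> /andP[-> /andP[xp pz]] /=.
  by case: (leP p2 y) => py; [left; rewrite xp | right; rewrite (ltW py)].
move=> v v0 v1.
have Kp : box 0 1 0 1 (u, v) by rewrite /box /= u0 u1 v0.
have /nbhs_ballP[e /= e0 He] := locsol_near hc Kp.
exists e => // c d c0 cv vd d1 ce de; exists e => // a b a0 au ub b1 ea eb.
have sub q : box a b c d q -> box 0 1 0 1 q.
  by rewrite /box /= => /andP[/andP[? ?] /andP[? ?]]; apply/andP; split; apply/andP; split; lra.
exists (fun q => D (h (u, v)) (h q)) => q Kq.
have qB : ball (u, v) e q.
  move: Kq; rewrite /box /= => /andP[/andP[? ?] /andP[? ?]].
  by split; rewrite /ball /= ltr_norml; apply/andP; split; lra.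
have := He q qB (sub _ Kq); apply: filterS => q' Hq' Kq'.
by rewrite Hq' //; exact: sub.
Qed.

End Transport.

(** * Monodromy along paths *)

Section TransportCat.
Variables (R : realType) (Z : zmodType) (X : topologicalType).
Variables (Om : set X) (D : X -> X -> Z).

(** Monodromy as a relation: [v] is the increment of a local section along some path. It is
    single-valued only once loops are known to act trivially. *)
Definition transport (x y : X) (v : Z) := exists (g : R -> X) (f : R -> Z),
  [/\ cont_in Om (`[0, 1]%classic : set R) g,
      locsol D (`[0, 1]%classic : set R) g f,
      g 0 = x, g 1 = y & f 1 - f 0 = v].

Lemma transport_cat x y z v w :
  transport x y v -> transport y z w -> transport x z (v + w).
Proof.
move=> [g1 [f1 [[w1 c1] s1 g10 g11 e1]]] [g2 [f2 [[w2 c2] s2 g20 g21 e2]]].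
pose g t := if t <= 2^-1 then g1 (2 * t) else g2 (2 * t - 1).
pose f t := if t <= 2^-1 then f1 (2 * t) else f2 (2 * t - 1) + (f1 1 - f2 0).
(* Continuity and the section property are proved together, so that the one-sided arguments at 1/2
   are made once. The shift in [f] makes its two formulas agree there. *)
have key (t : R) : 0 <= t <= 1 -> forall W, nbhs (g t) W ->
    \forall s \near t, 0 <= s <= 1 -> W (g s) /\ f s - f t = D (g t) (g s).
  move=> /andP[t0 t1] W.
  have K1 : t <= 2^-1 -> `[0, 1]%classic (2 * t).
    by move=> ?; rewrite /= in_itv /=; apply/andP; split; lra.
  have K2 : 2^-1 <= t -> `[0, 1]%classic (2 * t - 1).
    by move=> ?; rewrite /= in_itv /=; apply/andP; split; lra.
  have L : t <= 2^-1 -> nbhs (g t) W -> \forall s \near t, 0 <= s <= 2^-1 ->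
      W (g s) /\ f s - f t = D (g t) (g s).
    move=> th; rewrite /g /f th => NW.
    have N : \forall q \near 2 * t, (`[0, 1]%classic q -> W (g1 q)) /\
        (`[0, 1]%classic q -> f1 q - f1 (2 * t) = D (g1 (2 * t)) (g1 q)).
      by apply: filterI; [exact: c1 _ (K1 th) _ NW | exact: s1 _ (K1 th)].
    have /nbhs_ballP[e /= e0 He] := N.
    apply/nbhs_ballP; exists (e / 2) => /=; first by lra.
    move=> s; rewrite /ball /= ltr_norml => /andP[? ?] /andP[s0 s1']; rewrite s1'.
    have Bs : ball (2 * t) e (2 * s) by rewrite /ball /= ltr_norml; apply/andP; split; lra.
    have Is : `[0, 1]%classic (2 * s) by rewrite /= in_itv /=; apply/andP; split; lra.
    by have [/(_ Is) ? /(_ Is) ?] := He _ Bs.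
  have Rt : 2^-1 <= t -> nbhs (g t) W -> \forall s \near t, 2^-1 < s <= 1 ->
      W (g s) /\ f s - f t = D (g t) (g s).
    move=> th.
    have [-> ->] : g t = g2 (2 * t - 1) /\ f t = f2 (2 * t - 1) + (f1 1 - f2 0).
      rewrite /g /f; case: ifP => // th'; have -> : t = 2^-1 by lra.
      by rewrite mulfV ?pnatr_eq0 // subrr g11 g20 addrC subrK.
    move=> NW.
    have N : \forall q \near 2 * t - 1, (`[0, 1]%classic q -> W (g2 q)) /\
        (`[0, 1]%classic q -> f2 q - f2 (2 * t - 1) = D (g2 (2 * t - 1)) (g2 q)).
      by apply: filterI; [exact: c2 _ (K2 th) _ NW | exact: s2 _ (K2 th)].
    have /nbhs_ballP[e /= e0 He] := N.
    apply/nbhs_ballP; exists (e / 2) => /=; first by lra.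
    move=> s; rewrite /ball /= ltr_norml => /andP[? ?] /andP[s0 s1'].
    have Bs : ball (2 * t - 1) e (2 * s - 1) by rewrite /ball /= ltr_norml; apply/andP; split; lra.
    have Is : `[0, 1]%classic (2 * s - 1) by rewrite /= in_itv /=; apply/andP; split; lra.
    rewrite /g /f leNgt s0 /= opprD addrACA subrr addr0.
    by have [/(_ Is) ? /(_ Is) ?] := He _ Bs.
  move=> NW; case: (ltgtP t 2^-1) => th.
  - have := L (ltW th) NW; have := lt_nbhsl th; apply: filterS2 => s sh H /andP[s0 _].
    by apply: H; rewrite s0 (ltW sh).
  - have := Rt (ltW th) NW; have := lt_nbhsr th; apply: filterS2 => s sh H /andP[_ s1'].
    by apply: H; rewrite sh.
  - have th1 : t <= 2^-1 by rewrite th. have th2 : 2^-1 <= t by rewrite th.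
    have := Rt th2 NW; have := L th1 NW; apply: filterS2 => s H1 H2 /andP[s0 s1'].
    by case: (leP s 2^-1) => sh; [apply: H1; rewrite s0 | apply: H2; rewrite sh].
exists g, f; split.
- split=> [p|p Kp W NW].
    rewrite /= in_itv /= => /andP[p0 p1]; rewrite /g; case: ifP => ph.
      by apply: w1; rewrite /= in_itv /=; apply/andP; split; lra.
    by apply: w2; rewrite /= in_itv /=; apply/andP; split; lra.
  have := key p _ W NW; rewrite /= in_itv /= in Kp => /(_ Kp); apply: filterS => q H.
  by rewrite /= in_itv /= => /H[].
- move=> p Kp; have Kp' : 0 <= p <= 1 by move: Kp; rewrite /= in_itv.
  have N := key p Kp' setT (@filterT _ _ (nbhs_filter (g p))).
  by apply: filterS N => q H; rewrite /= in_itv /= => /H[].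
- by rewrite /g mulr0 ifT // invr_ge0 ler0n.
- rewrite /g mulr1 ifF; last by apply/negbTE; rewrite -ltNge; lra.
  by rewrite -[RHS]g21; congr g2; lra.
- rewrite /f mulr0 mulr1 ifF; last by apply/negbTE; rewrite -ltNge; lra.
  rewrite ifT ?invr_ge0 ?ler0n // -e1 -e2.
  have -> : 2 - 1 = 1 :> R by lra.
  by rewrite addrCA addrAC.
Qed.

Lemma transport_rev x y v : transport x y v -> transport y x (- v).
Proof.
move=> [g [f [[w1 c1] s1 g0 g1 <-]]].
have I (t : R) : `[0, 1]%classic t -> `[0, 1]%classic (1 - t).
  by rewrite /= !in_itv /= => /andP[? ?]; apply/andP; split; lra.
have N (t : R) (P : R -> Prop) : (\forall s \near (1 - t), P s) -> \forall s \near t, P (1 - s).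
  have C : continuous (fun s : R => 1 - s).
    by move=> s; apply: cvgB; [exact: cvg_cst | exact: cvg_id].
  by move=> H; have := C t _ H.
exists (fun t => g (1 - t)), (fun t => f (1 - t)); split; rewrite ?subr0 ?subrr ?opprB //.
  split=> [p /I|p /I Kp W NW]; first exact: w1.
  by apply: filterS (N _ _ (c1 _ Kp W NW)) => q H /I.
by move=> p /I Kp; apply: filterS (N _ _ (s1 _ Kp)) => q H /I.
Qed.

End TransportCat.

Section SimplyConnected.
Variables (R : realType) (Z : zmodType).
Variables (Om : set (R * R)) (D : R * R -> R * R -> Z).
Hypothesis Dcoc : cocycle Om D.

Lemma cont_inP (U X : topologicalType) (W : set X) (K : set U) (h : U -> X) :
  cont_in W K h <-> (h @` K `<=` W /\ {within K, continuous h}).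
Proof.
split=> -[hW hc]; split.
- by move=> _ [p Kp <-]; exact: hW.
- by apply/subspace_continuousP => p Kp V; exact: hc.
- by move=> p Kp; apply: hW; exists p.
- by move=> p Kp V NV; move/subspace_continuousP: hc => /(_ p Kp V NV).
Qed.

(** A section over the square of a contracting homotopy is constant on the three sides sent to [x],
    hence takes the same value at both ends of the fourth side, which is [g]. *)
Lemma transport_loop x v : simply_connected R Om -> transport R Om D x x v -> v = 0.
Proof.
move=> [_ _ loop] [g [f [gc gs g0 g1 <-]]].
have gp : path_in Om x x g by move/cont_inP: (gc) => [gi gk]; split.
have [H [Hc Hi Hg Hx]] := loop x g gp.
have bE : `[0, 1]%classic `*` `[0, 1]%classic = box 0 1 0 1 :> set (R * R).
  by apply/seteqP; split=> p; rewrite /box /= !in_itv /=; [case=> -> -> | case/andP].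
rewrite bE in Hc Hi.
have Hc' : cont_in Om (box 0 1 0 1) H by apply/cont_inP.
have [G sG] := locsol_square Dcoc Hc'.
have cc (T : topologicalType) (a : T) : continuous (fun _ : R => a).
  by move=> t; exact: cvg_cst.
have cpair (p q : R -> R) : continuous p -> continuous q -> continuous (fun t => (p t, q t)).
  by move=> cp cq t; apply: (@cvg_pair _ _ _ (nbhs t) (nbhs (p t)) (nbhs (q t)));
    [exact: cp | exact: cq].
have c1 (a : R) : continuous (fun t : R => (t, a)).
  by apply: (cpair id (fun=> a)); [move=> t; exact: cvg_id | exact: cc].
have c2 (a : R) : continuous (fun t : R => (a, t)).
  by apply: (cpair (fun=> a) id); [exact: cc | move=> t; exact: cvg_id].
have Ox : Om x by rewrite -g0; apply: gc.1; rewrite /= in_itv /= lexx ler01.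
have B (a b : R) : 0 <= a <= 1 -> 0 <= b <= 1 -> box 0 1 0 1 (a, b).
  by rewrite /box /= => -> ->.
have b0 : 0 <= (0 : R) <= 1 by rewrite lexx ler01.
have b1 : 0 <= (1 : R) <= 1 by rewrite lexx ler01.
have E1 : G (1, 1) = G (0, 1).
  apply: (@locsol_const _ _ _ _ _ Dcoc _ (box 0 1 0 1) H G x (fun t => (t, 1))) => //.
  - by move=> t _; exact: c1.
  - by move=> t t01; exact: B.
  - by move=> t /Hg[].
have E2 : G (0, 1) = G (0, 0).
  apply: (@locsol_const _ _ _ _ _ Dcoc _ (box 0 1 0 1) H G x (fun t => (0, t))) => //.
  - by move=> t _; exact: c2.
  - by move=> t t01; exact: B.
  - by move=> t /Hx[].
have E3 : G (1, 1) = G (1, 0).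
  apply: (@locsol_const _ _ _ _ _ Dcoc _ (box 0 1 0 1) H G x (fun t => (1, t))) => //.
  - by move=> t _; exact: c2.
  - by move=> t t01; exact: B.
  - by move=> t /Hx[].
have sG' : locsol D (`[0, 1]%classic : set R) g (fun t => G (t, 0)).
  move=> p Kp; have Kp' : 0 <= p <= 1 by move: Kp; rewrite /= in_itv.
  have N : \forall q \near p, box 0 1 0 1 (q, 0) -> G (q, 0) - G (p, 0) = D (H (p, 0)) (H (q, 0)).
    exact: (c1 0 p _ (sG (p, 0) (B _ _ Kp' b0))).
  apply: filterS N => q Hq; rewrite /= in_itv /= => Kq.
  by rewrite Hq; [rewrite (Hg _ Kp').1 (Hg _ Kq).1 | exact: B].
have := locsol_diff gs sG' (g := id); rewrite -E3 E1 E2 subrr; apply.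
  by move=> t _; exact: cvg_id.
by move=> t t01; rewrite /= in_itv.
Qed.

(** [F y] is the monodromy from a base point to [y]. The second hypothesis joins [x] to a nearby [y]
    by a straight segment inside [Om], along which [D x] is a section. *)
Lemma cocycle_exact : simply_connected R Om ->
  (forall x, Om x -> \forall y \near x, Om y ->
     forall t, 0 <= t <= 1 -> Om (segt x y t)) ->
  exists F : R * R -> Z, forall x, Om x -> \forall y \near x, Om y -> F y - F x = D x y.
Proof.
move=> sc star; have [[x0 Ox0] conn _] := sc.
have tr y : Om y -> exists v, transport R Om D x0 y v.
  move=> Oy; have [g [gk gi g0 g1]] := conn x0 y Ox0 Oy.
  have gc : cont_in Om (`[0, 1]%classic : set R) g by apply/cont_inP.
  have [f fs] := locsol_itv Dcoc ler01 gc.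
  by exists (f 1 - f 0), g, f; split.
have uniq y v w : transport R Om D x0 y v -> transport R Om D x0 y w -> v = w.
  move=> tv /transport_rev tw; apply/eqP; rewrite -subr_eq0; apply/eqP.
  exact: transport_loop sc (transport_cat tv tw).
pose F y := xget 0 [set v | transport R Om D x0 y v].
have FP y : Om y -> transport R Om D x0 y (F y).
  by move=> /tr ex; rewrite /F; case: xgetP => [v -> //|nex]; case: ex => v /nex.
exists F => x Ox.
have /nbhs_ballP[e1 /= e10 He1] := Dcoc Ox.
have /nbhs_ballP[e2 /= e20 He2] := star x Ox.
pose e := Num.min e1 e2.
have e0 : 0 < e by rewrite lt_min e10.
have He y : ball x e y -> ball x e1 y /\ ball x e2 y.
  by move=> B; split; apply: le_ball B; rewrite /e ge_min lexx ?orbT.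
apply/nbhs_ballP; exists e => // y Bxy Oy.
have sxy := He2 y (He y Bxy).2 Oy.
suff t : transport R Om D x y (D x y).
  by rewrite (uniq _ _ _ (FP y Oy) (transport_cat (FP x Ox) t)) addrC addKr.
have Bt t : 0 <= t <= 1 -> ball x e (segt x y t).
  case/andP=> t0 t1; case: Bxy => B1 B2; split;
    rewrite /segt /ball /= opprD addrA subrr add0r normrN normrM (ger0_norm t0).
    by apply: le_lt_trans B1; rewrite distrC; apply: ler_piMl.
  by apply: le_lt_trans B2; rewrite distrC; apply: ler_piMl.
exists (segt x y), (fun t => D x (segt x y t)); split.
- split=> [t|t Kt V NV]; first by rewrite /= in_itv /=; exact: sxy.
  by have N : \forall q \near t, V (segt x y q) := segt_continuous NV;
    apply: filterS N.
- move=> t Kt; have Kt' : 0 <= t <= 1 by move: Kt; rewrite /= in_itv.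
  have N := He1 _ (He _ (Bt _ Kt')).1 (sxy _ Kt').
  have N' : \forall q \near t, Om (segt x y q) ->
    D x (segt x y q) = D x (segt x y t) + D (segt x y t) (segt x y q).
    exact: (segt_continuous N).
  apply: filterS N' => q Hq; rewrite /= in_itv /= => Kq.
  by rewrite Hq ?addrK //; [rewrite addrC addKr | exact: sxy].
- exact: segt0.
- exact: segt1.
- by rewrite segt0 segt1 (cocycle_id Dcoc Ox) subr0.
Qed.

End SimplyConnected.

(** * Local structure of a T-mesh *)

Section Coordinates.
Variable R : realType.
Implicit Types (p q : R * R) (c : rect R) (e : seg R) (h s : bool).

(** Directions are booleans, [true] being horizontal, and coordinates are read along or across them,
    so that horizontal and vertical cases share one proof. *)
Definition cmin h c : R := if h then smin c else tmin c.
Definition cmax h c : R := if h then smax c else tmax c.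
Definition pt h (a b : R) : R * R := if h then (a, b) else (b, a).

Lemma along_pt h a b : along h (pt h a b) = a. Proof. by case: h. Qed.
Lemma across_pt h a b : across h (pt h a b) = b. Proof. by case: h. Qed.
Lemma acrossE h p : across h p = along (~~ h) p. Proof. by case: h. Qed.
Lemma pt_coord h p : pt h (along h p) (across h p) = p. Proof. by case: h; case: p. Qed.

Lemma coord_inj h p q : along h p = along h q -> across h p = across h q -> p = q.
Proof. by move=> e1 e2; rewrite -(pt_coord h p) e1 e2 pt_coord. Qed.

Lemma rect_setP c p : rect_set c p <-> forall h, cmin h c <= along h p <= cmax h c.
Proof.
split=> [/andP[? ?] []//|H]; apply/andP; split; [exact: (H true) | exact: (H false)].
Qed.

Lemma rect_set_dir h c p :
  rect_set c p <-> (cmin h c <= along h p <= cmax h c) /\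
                   (cmin (~~ h) c <= across h p <= cmax (~~ h) c).
Proof.
split; first by move/rect_setP=> H; split; [exact: H | rewrite acrossE; exact: H].
by case: h => -[? ?]; apply/andP.
Qed.

Definition open_rect c : set (R * R) :=
  [set p | forall h, cmin h c < along h p < cmax h c].

Lemma ball_along p q (d : R) : ball p d q <-> forall h, `|along h p - along h q| < d.
Proof.
by split=> [[B1 B2] []//|H]; split; [exact: (H true) | exact: (H false)].
Qed.

Lemma interior_ball (A : set (R * R)) p :
  A° p <-> exists2 d, 0 < d & forall q, (forall h, `|along h p - along h q| < d) -> A q.
Proof.
split=> [/nbhs_ballP[d d0 H]|[d d0 H]].
  by exists d => // q /ball_along; exact: H.
by apply/nbhs_ballP; exists d => // q /ball_along; exact: H.
Qed.

Lemma closed_rect c : closed (rect_set c).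
Proof. exact: closed_box. Qed.

Lemma open_rect_interior c : open_rect c `<=` (rect_set c)°.
Proof.
move=> p Op; apply/interior_ball.
have /andP[t1 t2] := Op true; have /andP[f1 f2] := Op false.
exists (Num.min (Num.min (along true p - cmin true c) (cmax true c - along true p))
   (Num.min (along false p - cmin false c) (cmax false c - along false p))).
  by rewrite !lt_min !subr_gt0 t1 t2 f1 f2.
move=> q H; apply/rect_setP => h; have := H h; rewrite !lt_min !ltr_norml.
by case: h => /= /andP[/andP[/andP[? ?] /andP[? ?]] /andP[/andP[? ?] /andP[? ?]]];
  apply/andP; split; lra.
Qed.

Lemma bdry_rect c p : bdry (rect_set c) p <-> rect_set c p /\ ~ open_rect c p.
Proof.
rewrite /bdry (_ : closure _ = rect_set c); last exact/esym/closure_id/closed_rect.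
split=> [[rp ni]|[rp no]]; split=> //; first by move/open_rect_interior.
move=> /interior_ball[d d0 H]; apply: no => h.
have /rect_setP/(_ h) := rp; rewrite !le_eqVlt => /andP[].
have bd (s : R) : `|s| < d -> rect_set c (pt h (along h p + s) (across h p)).
  move=> sd; apply: H => h'; case: h h' => -[] /=; rewrite ?subrr ?normr0 //;
  by rewrite opprD addrA subrr add0r normrN.
have d2 : `|d / 2| < d by rewrite ger0_norm; lra.
have d2' : `|- (d / 2)| < d by rewrite normrN.
move=> /orP[/eqP e1|->] /orP[/eqP e2|->] //; exfalso.
- have /rect_setP/(_ h) := bd _ d2; rewrite along_pt; lra.
- have /rect_setP/(_ h) := bd _ d2'; rewrite along_pt; lra.
- have /rect_setP/(_ h) := bd _ d2; rewrite along_pt; lra.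
Qed.

Lemma seg_setP e p : seg_set e p <->
  across (horiz e) p = pos e /\ lo e <= along (horiz e) p <= hi e.
Proof. by split=> [/andP[/eqP]|[/eqP ? ?]]//; apply/andP. Qed.

Lemma seg_loE e : seg_lo e = pt (horiz e) (lo e) (pos e). Proof. by []. Qed.
Lemma seg_hiE e : seg_hi e = pt (horiz e) (hi e) (pos e). Proof. by []. Qed.

Lemma closed_seg e : closed (seg_set e).
Proof.
have -> : seg_set e = rect_set (if horiz e then Rect (lo e) (hi e) (pos e) (pos e)
                                else Rect (pos e) (pos e) (lo e) (hi e)).
  apply/seteqP; split=> p /=; rewrite /seg_set /rect_set /along /across /=.
    by case: (horiz e) => /= /andP[/eqP -> ->]; rewrite lexx ?andbT.
  case: (horiz e) => /= /andP[]; last by move=> h1 ->; rewrite andbT eq_le andbC.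
  by move=> -> h1; rewrite andbT eq_le andbC.
exact: closed_rect.
Qed.

(** Holds when [[a, b]] contains a small interval issued from [u] in the direction [s]; the
    half-open bounds are what makes a quadrant belong to at most one cell. *)
Definition inq s (a b u : R) := if s then a <= u < b else a < u <= b.

(* c contains the intersection of the open quadrant (s1, s2) at p with a
   neighbourhood of p; true is the positive direction. *)
Definition quad c p s1 s2 :=
  inq s1 (smin c) (smax c) p.1 && inq s2 (tmin c) (tmax c) p.2.

(* The same, the signs being given along and across the direction h. *)
Definition hquad h c p s1 s2 := if h then quad c p s1 s2 else quad c p s2 s1.

Lemma hquadE h c p s1 s2 : hquad h c p s1 s2 =
  inq s1 (cmin h c) (cmax h c) (along h p) &&
  inq s2 (cmin (~~ h) c) (cmax (~~ h) c) (across h p).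
Proof. by case: h => //; rewrite /hquad /quad andbC. Qed.

Lemma gap (L : seq R) (u : R) : exists2 d, 0 < d & {in L, forall k, k != u -> d <= `|k - u|}.
Proof.
elim: L => [|k L [d d0 H]]; first by exists 1.
exists (if k == u then d else Num.min d `|k - u|).
  by case: ifPn => // ku; rewrite lt_min d0 normr_gt0 subr_eq0.
move=> k'; rewrite inE => /orP[/eqP ->|k'L] ku.
  by rewrite (negbTE ku) ge_min lexx orbT.
by case: ifP => _; [exact: H | rewrite ge_min H].
Qed.

Definition strict_side s (u v : R) := if s then u < v else v < u.
Definition weak_side s (u v : R) := if s then u <= v else v <= u.

End Coordinates.

Section LocalStructure.
Variables (R : realType) (T : mesh R).
Hypothesis HT : is_tmesh T.
Implicit Types (p q : R * R) (c : rect R) (e : seg R) (h s : bool).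

Definition critical_values : seq R :=
  flatten [seq [:: smin c; smax c; tmin c; tmax c] | c <- enum_fset (cells T)] ++
  flatten [seq [:: pos e; lo e; hi e] | e <- enum_fset (edges T)].

Lemma critical_cell c h : c \in cells T ->
  cmin h c \in critical_values /\ cmax h c \in critical_values.
Proof.
by move=> cT; split; rewrite mem_cat; apply/orP; left; apply/flatten_mapP; exists c => //;
  case: h; rewrite !inE /cmin /cmax eqxx ?orbT.
Qed.

Lemma critical_edge e : e \in edges T ->
  [/\ pos e \in critical_values, lo e \in critical_values & hi e \in critical_values].
Proof.
by move=> eT; split; rewrite mem_cat; apply/orP; right; apply/flatten_mapP; exists e => //;
  rewrite !inE eqxx ?orbT.
Qed.

Lemma vertexP p : p \in vertices T <->
  exists2 e, e \in edges T & p = seg_lo e \/ p = seg_hi e.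
Proof.
rewrite inE; split=> [/orP[]/imfsetP[e /= eT ->]|[e eT [] ->]].
- by exists e => //; left.
- by exists e => //; right.
- by apply/orP; left; apply: in_imfset.
- by apply/orP; right; apply: in_imfset.
Qed.

Lemma critical_vertex p h : p \in vertices T -> along h p \in critical_values.
Proof.
move=> /vertexP[e /critical_edge[? ? ?] H]; case: H => ->;
by rewrite ?seg_loE ?seg_hiE /pt; case: (horiz e); case: h.
Qed.

(** A scale below which [p] sees no coordinate of the mesh other than its own: a cell or an edge
    that meets the [d]-neighbourhood of [p] contains [p]. *)
Definition small_at p (d : R) := forall q h k, `|along h p - along h q| < d ->
  k \in critical_values ->
  (k < along h p -> k < along h q) /\ (along h p < k -> along h q < k).

Lemma small_atP p : exists2 d, 0 < d & small_at p d.
Proof.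
have [d1 d10 H1] := gap critical_values (along true p).
have [d2 d20 H2] := gap critical_values (along false p).
exists (Num.min d1 d2); first by rewrite lt_min d10.
move=> q h k; rewrite lt_min => /andP[l1 l2] kL.
have H : k != along h p -> `|along h p - along h q| < `|k - along h p|.
  case: h l1 l2 => l1 l2 ku; first exact: lt_le_trans l1 (H1 _ kL ku).
  exact: lt_le_trans l2 (H2 _ kL ku).
split=> lt.
  have := H (negbT (lt_eqF lt)); rewrite [X in _ < X]ltr0_norm ?subr_lt0 // ltr_norml.
  by move=> /andP[]; lra.
have := H (negbT (gt_eqF lt)); rewrite [X in _ < X]gtr0_norm ?subr_gt0 // ltr_norml.
by move=> /andP[]; lra.
Qed.

Lemma small_rect p d q c : small_at p d -> c \in cells T ->
  (forall h, `|along h p - along h q| < d) -> rect_set c q -> rect_set c p.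
Proof.
move=> sm cT near_ /rect_setP Hq; apply/rect_setP => h.
have [k1 k2] := critical_cell h cT; have /andP[q1 q2] := Hq h.
have [_ n1] := sm q h _ (near_ h) k1; have [n2 _] := sm q h _ (near_ h) k2.
by apply/andP; split; rewrite leNgt; apply/negP => lt; [have := n1 lt | have := n2 lt]; lra.
Qed.

Lemma small_seg p d q e : small_at p d -> e \in edges T ->
  (forall h, `|along h p - along h q| < d) -> seg_set e q -> seg_set e p.
Proof.
move=> sm eT near_ /seg_setP[q1 /andP[q2 q3]]; have [k1 k2 k3] := critical_edge eT.
have n := near_ (horiz e); have n' := near_ (~~ horiz e).
apply/seg_setP; split.
  have [a1 a2] := sm q _ _ n' k1; move: a1 a2; rewrite -!acrossE q1 ltxx => a1 a2.
  by case: (ltgtP (across (horiz e) p) (pos e)) => // [/a2|/a1].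
have [_ a2] := sm q _ _ n k2; have [a3 _] := sm q _ _ n k3.
by apply/andP; split; rewrite leNgt; apply/negP => lt; [have := a2 lt | have := a3 lt]; lra.
Qed.

Lemma small_vertex p d q : small_at p d -> q \in vertices T ->
  (forall h, `|along h p - along h q| < d) -> q = p.
Proof.
move=> sm qv near_.
have H h : along h q = along h p.
  have [a1 a2] := sm q h _ (near_ h) (critical_vertex h qv); move: a1 a2.
  by rewrite ltxx; case: (ltgtP (along h q) (along h p)) => // _ a1 a2;
    [have := a1 isT | have := a2 isT].
by apply: (@coord_inj R true); [exact: (H true) | exact: (H false)].
Qed.

Lemma small_hquad p d q c h s1 s2 : small_at p d -> c \in cells T ->
  (forall h, `|along h p - along h q| < d) -> rect_set c q ->
  strict_side s1 (along h p) (along h q) -> strict_side s2 (across h p) (across h q) ->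
  hquad h c p s1 s2.
Proof.
move=> sm cT near_ /rect_setP Hq t1 t2; rewrite hquadE.
have K h' s : strict_side s (along h' p) (along h' q) ->
  inq s (cmin h' c) (cmax h' c) (along h' p).
  have [k1 k2] := critical_cell h' cT; have /andP[q1 q2] := Hq h'.
  have [_ n1] := sm q h' _ (near_ h') k1; have [n2 _] := sm q h' _ (near_ h') k2.
  by case: s; rewrite /strict_side /inq => lt; apply/andP; split; lra.
by rewrite K // acrossE K // -!acrossE.
Qed.

Lemma hquad_open p d q c h s1 s2 : small_at p d -> c \in cells T ->
  (forall h, `|along h p - along h q| < d) -> hquad h c p s1 s2 ->
  strict_side s1 (along h p) (along h q) -> strict_side s2 (across h p) (across h q) ->
  open_rect c q.
Proof.
move=> sm cT near_; rewrite hquadE => /andP[i1 i2] t1 t2.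
have K h' s : inq s (cmin h' c) (cmax h' c) (along h' p) ->
  strict_side s (along h' p) (along h' q) -> cmin h' c < along h' q < cmax h' c.
  have [k1 k2] := critical_cell h' cT.
  have [n1 _] := sm q h' _ (near_ h') k1; have [_ n2] := sm q h' _ (near_ h') k2.
  case: s; rewrite /strict_side /weak_side /inq => /andP[a1 a2] lt; apply/andP; split; lra.
move=> h'; case: (eqVneq h' h) => [->|hh]; first exact: K t1.
have -> : h' = ~~ h by move: hh; case: (h'); case: (h).
by apply: (K _ s2); rewrite -?acrossE.
Qed.

Lemma hquad_rect p d q c h s1 s2 : small_at p d -> c \in cells T ->
  (forall h, `|along h p - along h q| < d) -> hquad h c p s1 s2 ->
  weak_side s1 (along h p) (along h q) -> weak_side s2 (across h p) (across h q) ->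
  rect_set c q.
Proof.
move=> sm cT near_; rewrite hquadE => /andP[i1 i2] t1 t2.
have K h' s : inq s (cmin h' c) (cmax h' c) (along h' p) ->
  weak_side s (along h' p) (along h' q) -> cmin h' c <= along h' q <= cmax h' c.
  have [k1 k2] := critical_cell h' cT.
  have [n1 _] := sm q h' _ (near_ h') k1; have [_ n2] := sm q h' _ (near_ h') k2.
  case: s; rewrite /strict_side /weak_side /inq => /andP[a1 a2] lt; apply/andP; split; lra.
rewrite !acrossE in i2 t2.
by apply/(rect_set_dir h); split; [exact: K t1 | rewrite acrossE; exact: K t2].
Qed.

Definition qpoint h p s1 s2 (d : R) :=
  pt h (along h p + (if s1 then d else - d)) (across h p + (if s2 then d else - d)).

Lemma qpoint_near h p s1 s2 (d d' : R) : 0 < d' -> d' < d ->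
  forall h', `|along h' p - along h' (qpoint h p s1 s2 d')| < d.
Proof.
move=> d0 dd h'; have N (s : bool) (a : R) : `|a - (a + (if s then d' else - d'))| < d.
  by rewrite ltr_norml; case: s; apply/andP; split; lra.
case: (eqVneq h' h) => [->|hh]; first by rewrite along_pt.
have -> : h' = ~~ h by move: hh; case: (h'); case: (h).
by rewrite -!acrossE across_pt.
Qed.

Lemma qpoint_side h p s1 s2 (d : R) : 0 < d ->
  strict_side s1 (along h p) (along h (qpoint h p s1 s2 d)) /\
  strict_side s2 (across h p) (across h (qpoint h p s1 s2 d)).
Proof.
by move=> d0; rewrite /qpoint along_pt across_pt; case: s1; case: s2; rewrite /strict_side; split; lra.
Qed.

Lemma hquad_uniq h p c c' s1 s2 : c \in cells T -> c' \in cells T ->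
  hquad h c p s1 s2 -> hquad h c' p s1 s2 -> c = c'.
Proof.
move=> cT cT' q1 q2; apply/eqP/negP => /negP ne.
have [d d0 sm] := small_atP p.
have d20 : 0 < d / 2 by lra.
have dd : d / 2 < d by lra.
have nr := qpoint_near h p s1 s2 d20 dd; have [t1 t2] := qpoint_side h p s1 s2 d20.
have := cells_disjoint HT cT cT' ne; rewrite -subset0 => /(_ (qpoint h p s1 s2 (d / 2))); apply.
split; apply: open_rect_interior.
  exact: (hquad_open sm cT nr q1 t1 t2).
exact: (hquad_open sm cT' nr q2 t1 t2).
Qed.

Lemma hquad_exists h p s1 s2 : (domain T)° p -> exists2 c, c \in cells T & hquad h c p s1 s2.
Proof.
move=> /interior_ball[e e0 He]; have [d d0 sm] := small_atP p.
pose x := Num.min d e / 2.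
have m0 : 0 < Num.min d e by rewrite lt_min d0.
have x0 : 0 < x by rewrite /x; lra.
have md : Num.min d e <= d by rewrite ge_min lexx.
have me : Num.min d e <= e by rewrite ge_min lexx orbT.
have [xd xe] : x < d /\ x < e by rewrite /x; split; lra.
have [c cT cq] := He _ (qpoint_near h p s1 s2 x0 xe).
have [t1 t2] := qpoint_side h p s1 s2 x0.
exists c => //.
exact: (small_hquad sm cT (qpoint_near h p s1 s2 x0 xd) cq t1 t2).
Qed.

Lemma hquad_interior h p :
  (forall s1 s2, exists2 c, c \in cells T & hquad h c p s1 s2) -> (domain T)° p.
Proof.
move=> H; apply/interior_ball; have [d d0 sm] := small_atP p; exists d => // q near_.
have W (u v : R) : exists s, weak_side s u v.
  by case: (leP u v) => [?|/ltW ?]; [exists true | exists false].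
have [s1 t1] := W (along h p) (along h q); have [s2 t2] := W (across h p) (across h q).
have [c cT qc] := H s1 s2; exists c => //.
exact: (hquad_rect sm cT near_ qc t1 t2).
Qed.

Lemma closed_domain : closed (domain T).
Proof.
rewrite /domain; apply: closed_bigcup => [|c _]; last exact: closed_rect.
exact: finite_fset.
Qed.

Lemma bdry_domain p : bdry (domain T) p <-> domain T p /\ ~ (domain T)° p.
Proof. by rewrite /bdry (_ : closure _ = domain T) //; exact/esym/closure_id/closed_domain. Qed.


End LocalStructure.

(** * Edges, vertices and maximal segments *)

Section Segments.
Variables (R : realType) (T : mesh R).
Hypotheses (HT : is_tmesh T) (Hred : reduced T).
Implicit Types (p q : R * R) (e : edges T) (x y : {set edges T}) (g : vertices T).

Lemma carrierP x p : carrier x p <-> exists2 e, e \in x & seg_set (val e) p.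
Proof. by split=> [[e ex ep]|[e ex ep]]; exists e. Qed.

Lemma seg_lo_set (e : seg R) : lo e <= hi e -> seg_set e (seg_lo e).
Proof. by move=> le; apply/seg_setP; rewrite seg_loE across_pt along_pt lexx le. Qed.

Lemma seg_hi_set (e : seg R) : lo e <= hi e -> seg_set e (seg_hi e).
Proof. by move=> le; apply/seg_setP; rewrite seg_hiE across_pt along_pt lexx le. Qed.

Lemma connected_seg (e : seg R) : lo e <= hi e -> connected (seg_set e).
Proof.
move=> le.
have -> : seg_set e = segt (seg_lo e) (seg_hi e) @` `[0, 1]%classic.
  apply/seteqP; split=> p /=.
    move=> /seg_setP[p1 /andP[p2 p3]].
    case: (ltP (lo e) (hi e)) => lt.
      exists ((along (horiz e) p - lo e) / (hi e - lo e)).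
        rewrite in_itv /= divr_ge0 ?ler_pdivrMr ?mul1r; lra.
      apply: (@coord_inj R (horiz e)); rewrite -?p1.
        rewrite /segt seg_loE seg_hiE -p1 /pt; case: (horiz e) p2 p3 => /= p2 p3; field; lra.
      by rewrite /segt seg_loE seg_hiE -p1 /pt; case: (horiz e) => /=; rewrite subrr mulr0 addr0.
    have E : along (horiz e) p = lo e by lra.
    exists 0; first by rewrite /= in_itv /= lexx ler01.
    by rewrite segt0 seg_loE -E -p1 pt_coord.
  move=> [t]; rewrite in_itv /= => t01 <-; apply/seg_setP.
  rewrite /segt seg_loE seg_hiE /pt; case: (horiz e) => /=;
  rewrite /across /along /= subrr mulr0 addr0; split=> //; case/andP: t01 => *; apply/andP; split; nra.
apply: connected_continuous_connected; first exact: segment_connected.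
by apply: continuous_subspaceT; exact: segt_continuous.
Qed.

Lemma segment_line x e : segment x -> e \in x -> line x = (horiz (val e), pos (val e)).
Proof.
move=> [_ H _] ex; rewrite /line; case: pickP => [e' e'x|/(_ e)]; last by rewrite ex.
by have [h1 h2] := H e' e e'x ex; congr pair.
Qed.

Lemma segment_hor x e : segment x -> e \in x -> hor x = horiz (val e).
Proof. by move=> sx ex; rewrite /hor (segment_line sx ex). Qed.

Lemma carrier_line x p : segment x -> carrier x p -> across (hor x) p = (line x).2.
Proof.
move=> sx /carrierP[e ex /seg_setP[E _]].
by rewrite (segment_hor sx ex) (segment_line sx ex) E.
Qed.

Lemma along_continuous h : continuous (along h : R * R -> R).
Proof. by case: h => p; [exact: cvg_fst | exact: cvg_snd]. Qed.

(** The projection of a connected carrier to its line is an interval. *)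
Lemma carrier_convex x p q r : segment x -> carrier x p -> carrier x q ->
  across (hor x) r = (line x).2 ->
  along (hor x) p <= along (hor x) r <= along (hor x) q -> carrier x r.
Proof.
move=> sx xp xq rl pq; have [_ _ cx] := sx.
have : connected (along (hor x) @` carrier x).
  apply: connected_continuous_connected => //.
  by apply: continuous_subspaceT; exact: along_continuous.
move=> /connected_intervalP I.
have [r' xr' e'] := I _ _ (ex_intro2 _ _ p xp erefl) (ex_intro2 _ _ q xq erefl) _ pq.
by rewrite -(coord_inj e') // rl (carrier_line sx xr').
Qed.

Lemma hatMS_segment x : hatMS x -> segment x.
Proof.
have K (P : pred {set edges T}) : maxset (fun A => `[< segment A >] && P A) x -> segment x.
  by move=> /maxsetP[/andP[/asboolP]].
have M : x \in MS T -> segment x by rewrite inE; exact: K.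
by case=> [[/M]|[/M]||] //; rewrite inE; [case/andP=> /M | exact: K].
Qed.

Lemma MS_segment x : x \in MS T -> segment x.
Proof. by rewrite inE => /maxsetP[/andP[/asboolP]]. Qed.

Lemma MS_interior x e : x \in MS T -> e \in x -> interior_edge e.
Proof. by rewrite inE => /maxsetP[/andP[_ /forall_inP H] _] /H. Qed.

(** The edge joins two consecutive vertices of a segment in [hatMS]; this segment is convex, so [p]
    is on it and cannot lie strictly between them. *)
Lemma edge_no_vertex (e : seg R) p : e \in edges T -> p \in vertices T -> seg_set e p ->
  p = seg_lo e \/ p = seg_hi e.
Proof.
move=> eT pv /seg_setP[p1 p2].
have /(edges_consecutive Hred)[x [hx ln lh [_ xlo _ xhi] H]] := eT.
have sx := hatMS_segment hx; have hE : hor x = horiz e by rewrite /hor -ln.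
have xp : carrier x p.
  apply: (carrier_convex sx xlo xhi); rewrite hE; first by rewrite p1 -ln.
  by rewrite seg_loE seg_hiE !along_pt.
have /negP := H p pv xp; move: p2; rewrite !le_eqVlt => /andP[/orP[/eqP l|l] b] n.
  by left; rewrite seg_loE l -p1 pt_coord.
case/orP: b => [/eqP l'|l']; last by rewrite l l' in n.
by right; rewrite seg_hiE -l' -p1 pt_coord.
Qed.

Lemma seg_lo_vertex e : seg_lo (val e) \in vertices T.
Proof. by apply/vertexP; exists (val e); [exact: valP | left]. Qed.

Lemma seg_hi_vertex e : seg_hi (val e) \in vertices T.
Proof. by apply/vertexP; exists (val e); [exact: valP | right]. Qed.

Lemma edge_lt e : lo (val e) < hi (val e).
Proof. exact: edges_nondeg HT _ (valP e). Qed.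

(** Connectedness made combinatorial: the edges with [P] and those without form two closed sets,
    which are disjoint because edges meet only at common endpoints and [P] passes through these. *)
Lemma carrier_chain x (P : edges T -> Prop) : connected (carrier x) ->
  (forall e e' p, e \in x -> e' \in x -> P e ->
     (p = seg_lo (val e) \/ p = seg_hi (val e)) ->
     (p = seg_lo (val e') \/ p = seg_hi (val e')) -> P e') ->
  forall e e', e \in x -> e' \in x -> P e -> P e'.
Proof.
move=> cx step e e' ex e'x Pe; apply: contrapT => nPe'.
pose A := \bigcup_(e in [set e | e \in x /\ P e]) seg_set (val e).
pose B := \bigcup_(e in [set e | e \in x /\ ~ P e]) seg_set (val e).
have clA : closed A.
  by apply: closed_bigcup => [|i _]; [exact: finite_finset | exact: closed_seg].
have clB : closed B.
  by apply: closed_bigcup => [|i _]; [exact: finite_finset | exact: closed_seg].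
have dis p : A p -> B p -> False.
  move=> [e1 [e1x P1] e1p] [e2 [e2x P2] e2p].
  have ne : val e1 != val e2.
    by apply/eqP => /val_inj E; apply: P2; rewrite -E.
  have pv : p \in vertices T by have := edges_meet HT (valP e1) (valP e2) ne; apply; split.
  have v1 := edge_no_vertex (valP e1) pv e1p; have v2 := edge_no_vertex (valP e2) pv e2p.
  exact: P2 (step e1 e2 p e1x e2x P1 v1 v2).
have AU p : carrier x p -> A p \/ B p.
  move=> /carrierP[e1 e1x e1p]; case: (pselect (P e1)) => P1.
    by left; exists e1.
  by right; exists e1.
have Ax : A `<=` carrier x by move=> p [e1 [e1x _] e1p]; apply/carrierP; exists e1.
have E : A = carrier x.
  apply: cx.
  - exists (seg_lo (val e)); exists e => //; apply: seg_lo_set; exact/ltW/edge_lt.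
  - exists (~` B); first exact: closed_openC.
    apply/seteqP; split=> p; first by move=> Ap; split; [exact: Ax | exact: dis].
    by move=> [/AU[]].
  - exists A => //; apply/seteqP; split=> p; first by move=> Ap; split; [exact: Ax |].
    by case.
have xp : carrier x (seg_lo (val e')).
  by apply/carrierP; exists e' => //; apply: seg_lo_set; exact/ltW/edge_lt.
apply: (dis (seg_lo (val e'))); first by rewrite E.
by exists e' => //; apply: seg_lo_set; exact/ltW/edge_lt.
Qed.

Lemma interior_edge_MS e : interior_edge e -> exists2 x, x \in MS T & e \in x.
Proof.
move=> ie; pose P := (fun A : {set edges T} => `[< segment A >] && [forall e in A, interior_edge e]).
have P1 : P [set e]%SET.
  apply/andP; split; last by apply/forall_inP => e'; rewrite inE => /eqP ->.
  apply/asboolP; split.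
  - by apply/finset.set0Pn; exists e; rewrite inE.
  - by move=> e1 e2; rewrite !inE => /eqP -> /eqP ->.
  - have -> : carrier [set e]%SET = seg_set (val e).
      apply/seteqP; split=> p; first by move=> /carrierP[e']; rewrite inE => /eqP ->.
      by move=> ep; apply/carrierP; exists e => //; rewrite inE.
    exact/connected_seg/ltW/edge_lt.
have [x mx /fintype.subsetP ex] := maxset_exists P1.
by exists x; [rewrite inE | apply: ex; rewrite inE].
Qed.

(** The union of two parallel segments through [p] is again a segment of interior edges, so
    maximality identifies both with it. *)
Lemma MS_uniq x y p : x \in MS T -> y \in MS T -> hor x = hor y ->
  carrier x p -> carrier y p -> x = y.
Proof.
move=> xM yM hxy xp yp; have sx := MS_segment xM; have sy := MS_segment yM.
have lxy : line x = line y.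
  by rewrite [line x]surjective_pairing [line y]surjective_pairing
     -(carrier_line sx xp) -(carrier_line sy yp) hxy -/(hor x) hxy.
pose P := (fun A : {set edges T} => `[< segment A >] && [forall e in A, interior_edge e]).
have PU : P (x :|: y)%SET.
  apply/andP; split; last first.
    by apply/forall_inP => e; rewrite inE => /orP[/(MS_interior xM)|/(MS_interior yM)].
  have L e : e \in (x :|: y)%SET -> line x = (horiz (val e), pos (val e)).
    by rewrite inE => /orP[/(segment_line sx)//|/(segment_line sy) <-].
  apply/asboolP; split.
  - have /carrierP[e ex _] := xp.
    by apply/finset.set0Pn; exists e; rewrite inE ex.
  - by move=> e e' /L E /L; rewrite E => -[-> ->].
  - have -> : carrier (x :|: y)%SET = carrier x `|` carrier y.
      apply/seteqP; split=> q.
        move=> /carrierP[e]; rewrite inE => /orP[ex|ey] eq.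
          by left; apply/carrierP; exists e.
        by right; apply/carrierP; exists e.
      by case=> /carrierP[e ex eq]; apply/carrierP; exists e => //; rewrite inE ex ?orbT.
    have [_ _ cx] := sx; have [_ _ cy] := sy.
    by apply: connectedU => //; exists p.
have := xM; rewrite inE => /maxsetP[_ /(_ _ PU (finset.subsetUl _ _)) Ex].
have := yM; rewrite inE => /maxsetP[_ /(_ _ PU (finset.subsetUr _ _)) Ey].
by rewrite -Ex.
Qed.

Lemma MS_at_eq x g h : x \in MS T -> hor x = h -> carrier x (val g) -> MS_at h g = x.
Proof.
move=> xM hx xg; rewrite /MS_at; case: pickP => [y /and3P[yM /eqP hy /asboolP yg]|/(_ x)].
  by apply: (MS_uniq yM xM _ yg xg); rewrite hy hx.
by rewrite xM hx eqxx asboolT.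
Qed.

(** An edge through an interior point is interior, which rules out boundary segments among those
    that [vertex_hatMS] provides. *)
Lemma MS_atP g h : interior_vertex g ->
  [/\ MS_at h g \in MS T, hor (MS_at h g) = h & carrier (MS_at h g) (val g)].
Proof.
move=> /asboolP ig; have [x [[hx hh xg] _]] := vertex_hatMS Hred g h.
suff xM : x \in MS T by rewrite (MS_at_eq xM hh xg).
case: hx => [[]|[]||] //; first by rewrite inE => /andP[].
rewrite inE => /maxsetP[/andP[_ /forall_inP H] _].
have /carrierP[e /H ne eg] := xg; case/negP: ne; apply/asboolP.
by exists (val g).
Qed.

End Segments.

(** * The two cells along an interior edge *)

Section Sides.
Variables (R : realType) (T : mesh R).
Hypotheses (HT : is_tmesh T) (Hred : reduced T).
Implicit Types (p q : R * R) (e : edges T) (x y : {set edges T}) (g : vertices T).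
Implicit Types (h s : bool).

Lemma edge_avoid e c p : c \in cells T -> seg_set (val e) p -> ~ open_rect c p.
Proof.
move=> cT /(edges_sub HT (valP e))[c' c'T /bdry_rect[r'p no']] op.
have ne : c != c' by apply/eqP => E; apply: no'; rewrite -E.
have [E _] := cells_meet HT cT c'T ne.
have : (bdry (rect_set c) `&` bdry (rect_set c')) p.
  by rewrite -E; split=> //; exact: (interior_subset (open_rect_interior op)).
by case=> /bdry_rect[].
Qed.

Lemma edge_eq e (e' : edges T) p : p \notin vertices T -> seg_set (val e) p ->
  seg_set (val e') p -> e = e'.
Proof.
move=> pv ep e'p; apply/val_inj/eqP/negP => /negP ne; case/negP: pv.
by have := edges_meet HT (valP e) (valP e') ne; apply; split.
Qed.

Lemma relint_not_vertex e p : across (horiz (val e)) p = pos (val e) ->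
  lo (val e) < along (horiz (val e)) p < hi (val e) -> p \notin vertices T.
Proof.
move=> p1 p2; apply/negP => pv.
have ep : seg_set (val e) p by apply/seg_setP; split=> //; apply/andP; split; lra.
by case: (edge_no_vertex Hred (valP e) pv ep) p2 => ->; rewrite ?seg_loE ?seg_hiE along_pt ltxx ?andbF.
Qed.

(** Just beyond [p] on [e] lies a point [q] of the cell. Edges avoid the open cell, so [q] is on its
    boundary, which is a union of edges; as [q] is not a vertex, the edge through it is [e], which
    is therefore contained in the cell. *)
Lemma edge_side e c p s : c \in cells T ->
  across (horiz (val e)) p = pos (val e) ->
  lo (val e) < along (horiz (val e)) p < hi (val e) ->
  hquad (horiz (val e)) c p true s ->
  seg_set (val e) `<=` rect_set c /\
  (if s then cmin (~~ horiz (val e)) c = pos (val e) else cmax (~~ horiz (val e)) c = pos (val e)).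
Proof.
set h := horiz (val e) => cT p1 /andP[p2 p3]; rewrite hquadE p1 => /andP[/andP[i1 i2] i3].
(* Stopping before both the end of [e] and that of the cell keeps [q] off the vertices and off the
   sides of the cell transverse to [e]. *)
pose m := Num.min (cmax h c) (hi (val e)).
have m1 : along h p < m by rewrite lt_min i2.
have [m2 m3] : m <= cmax h c /\ m <= hi (val e) by split; rewrite ge_min lexx ?orbT.
pose q := pt h ((along h p + m) / 2) (pos (val e)).
have qa : across h q = pos (val e) by exact: across_pt.
have ql : along h q = (along h p + m) / 2 by exact: along_pt.
have eq : seg_set (val e) q by apply/seg_setP; split=> //; rewrite -/h ql; apply/andP; split; lra.
have no := edge_avoid cT eq.
have B : if s then cmin (~~ h) c = pos (val e) else cmax (~~ h) c = pos (val e).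
  apply: contrapT => nB; apply: no => h'.
  case: (eqVneq h' h) => [->|hh]; first by rewrite ql; apply/andP; split; lra.
  have -> : h' = ~~ h by move: hh; case: (h'); case: (h).
  rewrite -acrossE qa; case: s i3 nB => /andP[a b] nB; apply/andP; split=> //.
    by rewrite lt_neqAle a andbT; apply/eqP.
  by rewrite lt_neqAle b andbT eq_sym; apply/eqP.
split=> //.
have rq : rect_set c q.
  apply/(rect_set_dir h); rewrite ql qa; split; first by apply/andP; split; lra.
  by case: s i3 {B} => /andP[a b]; apply/andP; split; lra.
have [A EA] := cells_bdry HT cT.
have : bdry (rect_set c) q by apply/bdry_rect.
rewrite EA => /carrierP[e' e'A e'q].
have qv : q \notin vertices T by apply: (relint_not_vertex (e := e)); rewrite -/h ?ql; lra.
have E := edge_eq qv eq e'q.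
move=> r er; have : carrier A r by apply/carrierP; exists e' => //; rewrite -E.
by rewrite -EA => /bdry_rect[].
Qed.

Lemma interior_edge_relint e : interior_edge e -> exists p,
  [/\ across (horiz (val e)) p = pos (val e),
      lo (val e) < along (horiz (val e)) p < hi (val e) & (domain T)° p].
Proof.
set h := horiz (val e).
move=> /asboolP[p [/seg_setP[p1 /andP[p2 p3]] /interior_ball[d d0 H]]].
have lt := edge_lt HT e; rewrite -/h in p1 p2 p3.
(* The given interior point may be an endpoint of [e]; it is moved towards the midpoint by less than
   [d]. *)
have [t [t1 t2]] : exists t, lo (val e) < t < hi (val e) /\ `|along h p - t| < d.
  pose m := Num.min d ((hi (val e) - lo (val e)) / 2) / 2.
  have n1 : Num.min d ((hi (val e) - lo (val e)) / 2) <= d by rewrite ge_min lexx.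
  have n2 : Num.min d ((hi (val e) - lo (val e)) / 2) <= (hi (val e) - lo (val e)) / 2.
    by rewrite ge_min lexx orbT.
  have n3 : 0 < Num.min d ((hi (val e) - lo (val e)) / 2) by rewrite lt_min d0; lra.
  case: (leP (along h p) ((hi (val e) + lo (val e)) / 2)) => lm.
    exists (along h p + m); split; first by apply/andP; split; rewrite /m; lra.
    by rewrite ltr_norml /m; apply/andP; split; lra.
  exists (along h p - m); split; first by apply/andP; split; rewrite /m; lra.
  by rewrite ltr_norml /m; apply/andP; split; lra.
exists (pt h t (pos (val e))); rewrite across_pt along_pt; split=> //.
apply/interior_ball; exists (d - `|along h p - t|); first by rewrite subr_gt0.
move=> q Hq; apply: H => h'.
case: (eqVneq h' h) => [->|hh].
  have := Hq h; rewrite along_pt ltrBrDl; apply: le_lt_trans.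
  by rewrite -[X in `|X|](subrKA t); exact: ler_normD.
have E : h' = ~~ h by move: hh; case: (h'); case: (h).
have := Hq h'; rewrite {1 2}E -!acrossE across_pt => lt'.
rewrite E -!acrossE p1; apply: lt_le_trans lt' _.
by rewrite lerBlDr lerDl.
Qed.

(* Cells on the two sides of an interior edge: cp e on the side where the
   coordinate across e is larger, cm e on the other. *)
Definition side_cells (cp cm : edges T -> cells T) := forall e, interior_edge e ->
  [/\ seg_set (val e) `<=` rect_set (val (cp e)),
      seg_set (val e) `<=` rect_set (val (cm e)),
      cmin (~~ horiz (val e)) (val (cp e)) = pos (val e)
    & cmax (~~ horiz (val e)) (val (cm e)) = pos (val e)].

Lemma side_cells_exist : exists cp cm, side_cells cp cm.
Proof.
(* The domain is nonempty, so there is a cell to serve as default value on boundary edges. *)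
have [[p0 [c0 c0T _]] _ _] := domain_simply_connected HT.
have H e : exists cc : cells T * cells T, interior_edge e ->
  [/\ seg_set (val e) `<=` rect_set (val cc.1),
      seg_set (val e) `<=` rect_set (val cc.2),
      cmin (~~ horiz (val e)) (val cc.1) = pos (val e)
    & cmax (~~ horiz (val e)) (val cc.2) = pos (val e)].
  case: (boolP (interior_edge e)) => ie; last first.
    by exists (FSetSub c0T, FSetSub c0T).
  have [p [p1 p2 ip]] := interior_edge_relint ie.
  have [c1 c1T q1] := hquad_exists (horiz (val e)) true true ip.
  have [c2 c2T q2] := hquad_exists (horiz (val e)) true false ip.
  have [s1 e1] := edge_side c1T p1 p2 q1; have [s2 e2] := edge_side c2T p1 p2 q2.
  by exists (FSetSub c1T, FSetSub c2T).
have [cc Hcc] := boolp.choice H.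
by exists (fun e => (cc e).1), (fun e => (cc e).2).
Qed.

Variables cp cm : edges T -> cells T.
Hypothesis Hside : side_cells cp cm.

Definition endpt s (e : seg R) := if s then seg_lo e else seg_hi e.

Lemma cell_nondeg h (c : cells T) : cmin h (val c) < cmax h (val c).
Proof. by case: h; have [] := cells_nondeg HT (valP c). Qed.

Lemma side_hquad e p s : interior_edge e -> seg_set (val e) p ->
  (if s then along (horiz (val e)) p < hi (val e) else lo (val e) < along (horiz (val e)) p) ->
  hquad (horiz (val e)) (val (cp e)) p s true /\ hquad (horiz (val e)) (val (cm e)) p s false.
Proof.
move=> /Hside[sp sm ep em] /seg_setP[p1 /andP[p2 p3]] ps.
have nd := edge_lt HT e.
have K c : seg_set (val e) `<=` rect_set c ->
    inq s (cmin (horiz (val e)) c) (cmax (horiz (val e)) c) (along (horiz (val e)) p).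
  move=> sc.
  have /sc/rect_setP/(_ (horiz (val e))) := seg_lo_set (ltW nd).
  have /sc/rect_setP/(_ (horiz (val e))) := seg_hi_set (ltW nd).
  rewrite seg_loE seg_hiE !along_pt => /andP[? ?] /andP[? ?].
  by case: s ps => ps; rewrite /inq; apply/andP; split; lra.
have A1 : inq true (cmin (~~ horiz (val e)) (val (cp e))) (cmax (~~ horiz (val e)) (val (cp e)))
  (pos (val e)) by rewrite /inq -ep lexx cell_nondeg.
have A2 : inq false (cmin (~~ horiz (val e)) (val (cm e))) (cmax (~~ horiz (val e)) (val (cm e)))
  (pos (val e)) by rewrite /inq -em lexx cell_nondeg.
by rewrite !hquadE !K // p1 A1 A2.
Qed.

End Sides.

Section Stars.
Variables (R : realType) (T : mesh R).
Hypotheses (HT : is_tmesh T) (Hred : reduced T).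
Variables cp cm : edges T -> cells T.
Hypothesis Hside : side_cells cp cm.
Implicit Types (p q : R * R) (e : edges T) (x y : {set edges T}) (g : vertices T).
Implicit Types (h s : bool) (c : cells T).

Lemma relint_interior e p : interior_edge e -> across (horiz (val e)) p = pos (val e) ->
  lo (val e) < along (horiz (val e)) p < hi (val e) -> (domain T)° p.
Proof.
move=> ie p1 /andP[p2 p3].
have ep : seg_set (val e) p by apply/seg_setP; split=> //; apply/andP; split; lra.
apply: (hquad_interior (h := horiz (val e))) => s1 s2.
have [|q1 q2] := @side_hquad _ _ HT _ _ Hside e p s1 ie ep; first by case: s1.
by case: s2; [exists (val (cp e)) | exists (val (cm e))] => //; exact: valP.
Qed.

Lemma side_uniq e p s1 s2 c : interior_edge e -> seg_set (val e) p ->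
  (if s1 then along (horiz (val e)) p < hi (val e) else lo (val e) < along (horiz (val e)) p) ->
  hquad (horiz (val e)) (val c) p s1 s2 -> c = if s2 then cp e else cm e.
Proof.
move=> ie ep ps qc; have [q1 q2] := side_hquad HT Hside ie ep ps; apply: val_inj.
apply: (hquad_uniq HT _ _ qc); try exact: valP.
by case: s2 qc.
Qed.

Lemma side_ne e : interior_edge e -> cp e <> cm e.
Proof.
move=> ie E; have [_ _ e1 e2] := Hside ie.
by have := cell_nondeg HT (~~ horiz (val e)) (cp e); rewrite e1 E e2 ltxx.
Qed.

(** By [cells_meet], [p] is on an edge contained in both cells. At its midpoint the cells fill
    opposite sides, since distinct cells cannot share a quadrant; hence the edge is interior and
    these are its side cells. *)
Lemma nonvertex_star p c c' : p \notin vertices T -> c <> c' ->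
  rect_set (val c) p -> rect_set (val c') p ->
  exists2 e, interior_edge e /\ seg_set (val e) p &
    (c = cp e /\ c' = cm e) \/ (c = cm e /\ c' = cp e).
Proof.
move=> pv cc cp' c'p.
have ne : val c != val c' by apply/eqP => /val_inj.
have [Eb [A [B EAB]]] := cells_meet HT (valP c) (valP c') ne.
have : (rect_set (val c) `&` rect_set (val c')) p by [].
rewrite EAB => -[/carrierP[e eA ep]|[g _ gp]]; last first.
  by case/negP: pv; rewrite -gp; exact: valP.
have sub : seg_set (val e) `<=` rect_set (val c) `&` rect_set (val c').
  by rewrite EAB => q eq; left; apply/carrierP; exists e.
set h := horiz (val e) in sub *; have nd := edge_lt HT e.
pose m := pt h ((lo (val e) + hi (val e)) / 2) (pos (val e)).
have ma : across h m = pos (val e) by exact: across_pt.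
have ml : along h m = (lo (val e) + hi (val e)) / 2 by exact: along_pt.
have em : seg_set (val e) m by apply/seg_setP; rewrite -/h ma ml; split=> //; apply/andP; split; lra.
have K (d : cells T) : seg_set (val e) `<=` rect_set (val d) ->
    exists s2, forall s1, hquad h (val d) m s1 s2.
  move=> sd; have no := edge_avoid HT (valP d) em.
  have /sd/rect_setP/(_ h) := seg_lo_set (ltW nd).
  have /sd/rect_setP/(_ h) := seg_hi_set (ltW nd).
  rewrite seg_loE seg_hiE !along_pt => /andP[? ?] /andP[? ?].
  have I1 s : inq s (cmin h (val d)) (cmax h (val d)) (along h m).
    by rewrite ml; case: s; rewrite /inq; apply/andP; split; lra.
  have /(rect_set_dir h)[_ /andP[r1 r2]] := sd _ em.
  suff [s2 i2] : exists s2, inq s2 (cmin (~~ h) (val d)) (cmax (~~ h) (val d)) (across h m).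
    by exists s2 => s1; rewrite hquadE I1 i2.
  have := cell_nondeg HT (~~ h) d; case: (ltP (across h m) (cmax (~~ h) (val d))) => b nd'.
    by exists true; rewrite /inq r1.
  by exists false; rewrite /inq r2 andbT; lra.
have [s qs] := K c (fun q eq => (sub q eq).1).
have [s' qs'] := K c' (fun q eq => (sub q eq).2).
have ss : s' = ~~ s.
  case: (eqVneq s s') => [E|]; last by case: s s' {qs qs'} => -[].
  case: cc; apply: val_inj.
  by apply: (hquad_uniq HT (valP c) (valP c') (qs true)); rewrite E.
have ie : interior_edge e.
  apply/asboolP; exists m; split=> //; apply: (hquad_interior (h := h)) => s1 s2.
  case: (eqVneq s2 s) => [->|ns]; first by exists (val c); [exact: valP | exact: qs].
  have -> : s2 = s' by rewrite ss; case: s2 s ns {qs ss} => -[].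
  by exists (val c'); [exact: valP | exact: qs'].
exists e => //.
have lt : along h m < hi (val e) by rewrite ml; lra.
have Ec := side_uniq (s1 := true) ie em lt (qs true).
have Ec' := side_uniq (s1 := true) ie em lt (qs' true).
by rewrite ss in Ec'; case: (s) Ec Ec' => /= -> ->; [left | right].
Qed.

Lemma endpt_set s e : seg_set (val e) (endpt s (val e)).
Proof. by have /ltW lt := edge_lt HT e; case: s; [apply: seg_lo_set | apply: seg_hi_set]. Qed.

Lemma endpt_along s e :
  along (horiz (val e)) (endpt s (val e)) = if s then lo (val e) else hi (val e).
Proof. by case: s; rewrite /endpt ?seg_loE ?seg_hiE along_pt. Qed.

Lemma endpt_vertex s e : endpt s (val e) \in vertices T.
Proof. by case: s; [exact: seg_lo_vertex | exact: seg_hi_vertex]. Qed.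

(** Otherwise the other end of the shorter edge would be a vertex inside the longer one. *)
Lemma endpt_inj s e (e' : edges T) : horiz (val e) = horiz (val e') ->
  endpt s (val e) = endpt s (val e') -> e = e'.
Proof.
move=> hh ee.
have Ep : pos (val e) = pos (val e').
  have := congr1 (across (horiz (val e))) ee; rewrite {2}hh.
  by case: (s); rewrite /endpt ?seg_loE ?seg_hiE !across_pt.
have El : (if s then lo (val e) else hi (val e)) = (if s then lo (val e') else hi (val e')).
  by rewrite -!endpt_along -hh ee.
have l1 := edge_lt HT e; have l2 := edge_lt HT e'.
have K (e1 e2 : edges T) : horiz (val e1) = horiz (val e2) -> pos (val e1) = pos (val e2) ->
    lo (val e2) <= (if s then hi (val e1) else lo (val e1)) <= hi (val e2) ->
    (if s then hi (val e1) else lo (val e1)) = lo (val e2) \/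
    (if s then hi (val e1) else lo (val e1)) = hi (val e2).
  move=> h12 p12 b.
  have [] // := edge_no_vertex Hred (valP e2) (endpt_vertex (~~ s) e1) _.
  - apply/seg_setP; rewrite -h12 endpt_along -p12; split; last by case: (s) b.
    by case: (s); rewrite /= ?seg_loE ?seg_hiE across_pt.
  - move=> /(congr1 (along (horiz (val e1)))); rewrite endpt_along h12 seg_loE along_pt => E.
    by left; move: E; case: (s).
  - move=> /(congr1 (along (horiz (val e1)))); rewrite endpt_along h12 seg_hiE along_pt => E.
    by right; move: E; case: (s).
have K1 := K e e' hh Ep; have K2 := K e' e (esym hh) (esym Ep).
have [El2 Eh2] : lo (val e) = lo (val e') /\ hi (val e) = hi (val e').
  case: s El K1 K2 {K ee} => El K1 K2; split=> //.
    case: (leP (hi (val e)) (hi (val e'))) => b.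
      by case: K1 => [|E|//]; [apply/andP; split; lra | lra].
    by case: K2 => [|E|//]; [apply/andP; split; lra | lra].
  case: (leP (lo (val e)) (lo (val e'))) => b.
    by case: K2 => [|E|E]; [apply/andP; split; lra | lra | lra].
  by case: K1 => [|E|E]; [apply/andP; split; lra | lra | lra].
apply: val_inj; move: hh Ep El2 Eh2.
by case: (val e) => ? ? ? ?; case: (val e') => ? ? ? ? /= -> -> -> ->.
Qed.

End Stars.

(** * Potentials of edge cochains *)

Section Potentials.
Variables (R : realType) (T : mesh R).
Hypotheses (HT : is_tmesh T) (Hred : reduced T).
Variables cp cm : edges T -> cells T.
Hypothesis Hside : side_cells cp cm.
Implicit Types (p q : R * R) (e : edges T) (x y : {set edges T}) (g : vertices T).
Implicit Types (h s : bool) (c : cells T).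

Variables (Z : zmodType) (a : edges T -> Z).

(** By [endpt_inj] the sum has at most one term. An empty sum is 0, as it must be when one cell
    covers both quadrants adjoining the direction [s] of [h]. *)
Definition jump p h s : Z :=
  \sum_(e : edges T | [&& interior_edge e, horiz (val e) == h & endpt s (val e) == p]) a e.

Lemma jumpE e s : interior_edge e -> jump (endpt s (val e)) (horiz (val e)) s = a e.
Proof.
move=> ie; rewrite /jump (big_pred1 e) // => e' /=.
apply/idP/eqP => [/and3P[_ /eqP hh /eqP ee]|->]; last by rewrite ie !eqxx.
exact: (endpt_inj HT Hred hh ee).
Qed.

(** A jump is the value on the side of larger transverse coordinate minus the other. For a potential
    this gives (NE - SE) - (NW - SW) - (NE - NW) + (SE - SW) = 0, whence the signs. *)
Definition circulation p :=
  jump p true true - jump p true false - jump p false true + jump p false false.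

(** [P] tells which quadrants are covered by cells. If one is missing, the others form at most a
    path, along which any jumps can be summed; only the full cycle imposes a condition. *)
Lemma quadrant_potential (P : bool -> bool -> bool) (jE jN jW jS : Z) :
  (P true true -> P true false -> P false true -> P false false -> jE - jW - jN + jS = 0) ->
  exists u : bool -> bool -> Z,
   [/\ P true true -> P true false -> u true true - u true false = jE,
       P false true -> P false false -> u false true - u false false = jW,
       P true true -> P false true -> u true true - u false true = jN
     & P true false -> P false false -> u true false - u false false = jS].
Proof.
pose mk (u11 u10 u01 u00 : Z) s1 s2 :=
  if s1 then if s2 then u11 else u10 else if s2 then u01 else u00.
case P11: (P true true); last first.
  by move=> _; exists (mk 0 jS jW 0); split; rewrite /= ?subr0.
case P10: (P true false); last first.
  by move=> _; exists (mk (jW + jN) 0 jW 0); split; rewrite /= ?subr0 // addrC addKr.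
case P01: (P false true); last first.
  by move=> _; exists (mk (jS + jE) jS 0 0); split; rewrite /= ?subr0 // addrC addKr.
move=> H; exists (mk 0 (- jE) (- jN) (- jN - jW)); split; rewrite /= ?sub0r ?opprK //.
  by move=> _ _; rewrite opprD !opprK addrA addNr add0r.
move=> _ P00; have := H isT isT isT P00 => /(canRL (addrK _)).
by rewrite sub0r => E; rewrite -[RHS]opprK -E !opprD !opprK -addrA [jW + jN]addrC.
Qed.

(** A potential on quadrants descends to cells: if one cell covers two adjacent quadrants, no
    interior edge separates them, for its two side cells would coincide, so the jump between them is
    0. *)
Lemma vertex_potential p : p \in vertices T -> ((domain T)° p -> circulation p = 0) ->
  exists b : cells T -> Z, forall e, interior_edge e -> seg_set (val e) p ->
    b (cp e) - b (cm e) = a e.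
Proof.
move=> pv circ.
pose P s1 s2 := [exists c : cells T, quad (val c) p s1 s2].
have [u [uE uW uN uS]] : exists u : bool -> bool -> Z,
   [/\ P true true -> P true false -> u true true - u true false = jump p true true,
       P false true -> P false false -> u false true - u false false = jump p true false,
       P true true -> P false true -> u true true - u false true = jump p false true
     & P true false -> P false false -> u true false - u false false = jump p false false].
  apply: quadrant_potential => p11 p10 p01 p00; apply: circ.
  apply: (hquad_interior (h := true)) => s1 s2.
  have /existsP[c qc] : P s1 s2 by case: s1; case: s2.
  by exists (val c); [exact: valP |].
pose hu h s1 s2 := if h then u s1 s2 else u s2 s1.
have Hu h s c c' : hquad h (val c) p s true -> hquad h (val c') p s false ->
    hu h s true - hu h s false = jump p h s.
  by move=> q q'; rewrite /hu; case: h q q'; case: s => q q';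
    [apply: uE | apply: uW | apply: uN | apply: uS]; apply/existsP;
    first [exists c; exact: q | exists c'; exact: q'].
have Hs h s c : hquad h (val c) p s true -> hquad h (val c) p s false ->
    hu h s true = hu h s false.
  move=> q q'; apply/eqP; rewrite -subr_eq0 (Hu h s c c) //; apply/eqP.
  rewrite /jump big1 // => e /and3P[ie /eqP he /eqP ep]; exfalso.
  have ee := endpt_set HT s e.
  have es : if s then along (horiz (val e)) (endpt s (val e)) < hi (val e)
            else lo (val e) < along (horiz (val e)) (endpt s (val e)).
    by rewrite endpt_along; case: (s); exact: edge_lt HT e.
  rewrite -ep -he in q q'; apply: (side_ne HT Hside ie).
  by rewrite -(side_uniq HT Hside ie ee es q) -(side_uniq HT Hside ie ee es q').
(* Being a product, a cell that covers two opposite quadrants also covers the one between them, so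
   adjacent quadrants suffice. *)
have Hq c s1 s2 s1' s2' : quad (val c) p s1 s2 -> quad (val c) p s1' s2' -> u s1 s2 = u s1' s2'.
  move=> q q'.
  have q1 : quad (val c) p s1 s2' by move: q q'; rewrite /quad => /andP[-> _] /andP[_ ->].
  have -> : u s1 s2 = u s1 s2'.
    case: s2 s2' q q1 {q'} => -[] // q q1; last symmetry.
      exact: (Hs true s1 c).
    exact: (Hs true s1 c).
  case: s1 s1' q' q1 {q} => -[] // q' q1; last symmetry.
    exact: (Hs false s2' c).
  exact: (Hs false s2' c).
pose b c := if [pick s : bool * bool | quad (val c) p s.1 s.2] is Some s then u s.1 s.2 else 0.
have Hb c s1 s2 : quad (val c) p s1 s2 -> b c = u s1 s2.
  move=> q; rewrite /b; case: pickP => [s qs|/(_ (s1, s2))]; last by rewrite q.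
  exact: Hq qs q.
have Hbh h c s1 s2 : hquad h (val c) p s1 s2 -> b c = hu h s1 s2.
  by case: h; exact: Hb.
exists b => e ie ep.
have [s es] : exists s, p = endpt s (val e).
  by have [] := edge_no_vertex Hred (valP e) pv ep => ->; [exists true | exists false].
have es' : if s then along (horiz (val e)) p < hi (val e) else lo (val e) < along (horiz (val e)) p.
  by rewrite es endpt_along; case: (s); exact: edge_lt HT e.
have [q1 q2] := side_hquad HT Hside ie ep es'.
by rewrite (Hbh _ _ _ _ q1) (Hbh _ _ _ _ q2) (Hu _ _ _ _ q1 q2) es jumpE.
Qed.

Lemma point_potential p : ((p \in vertices T) -> (domain T)° p -> circulation p = 0) ->
  exists b : cells T -> Z, forall e, interior_edge e -> seg_set (val e) p ->
    b (cp e) - b (cm e) = a e.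
Proof.
move=> circ; case: (boolP (p \in vertices T)) => [pv|pv].
  exact: (vertex_potential pv (circ pv)).
case: (pselect (exists2 e : edges T, interior_edge e & seg_set (val e) p)) => [[e ie ep]|ne].
  exists (fun c => if c == cp e then a e else 0) => e' ie' ep'.
  rewrite (edge_eq HT pv ep' ep) eqxx ifN ?subr0 //.
  by apply/eqP => /esym; exact: (side_ne HT Hside).
by exists (fun=> 0) => e ie ep; case: ne; exists e.
Qed.

Lemma near_small p : \forall q \near p, exists2 d, small_at T p d &
  forall h, `|along h p - along h q| < d.
Proof.
have [d d0 sd] := small_atP T p.
have N : (fun q => exists2 d, small_at T p d & forall h, `|along h p - along h q| < d)° p.
  by apply/interior_ball; exists d => // q Bq; exists d.
exact: N.
Qed.

(* Potentials are compared only at points q that are not vertices, or at q = p: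
   at a vertex where two cells meet only at a corner the potential is not
   unique up to a constant, but such vertices are isolated. *)
Lemma edge_cochain_exact :
  (forall p, p \in vertices T -> (domain T)° p -> circulation p = 0) ->
  exists f : cells T -> Z, forall e, interior_edge e -> f (cp e) - f (cm e) = a e.
Proof.
move=> circ.
have [b Hb] := boolp.choice (fun p => point_potential (circ p)).
have [p0 [c0 c0T _]] : domain T !=set0 by have [] := domain_simply_connected HT.
have Hcc p : exists c, domain T p -> rect_set (val c) p.
  case: (pselect (domain T p)) => [[c cT cp']|n]; last by exists (FSetSub c0T).
  by exists (FSetSub cT).
have [cc Hc] := boolp.choice Hcc.
(* [cc] chooses a cell through each point; by [key], every cell through [q] gives the same value
   once [q] is close to [p]. *)
pose D p q := b q (cc q) - b p (cc q).
have key p q c c' d : small_at T p d -> (forall h, `|along h p - along h q| < d) ->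
    rect_set (val c) q -> rect_set (val c') q -> b q c - b p c = b q c' - b p c'.
  move=> sd nr cq c'q; case: (pselect (c = c')) => [->//|ne].
  case: (boolP (q \in vertices T)) => qv.
    by rewrite (small_vertex sd qv nr) !subrr.
  have [e [ie eq] E] := nonvertex_star HT Hside qv ne cq c'q.
  have ep := small_seg sd (valP e) nr eq.
  apply: subr_exchange; case: E => -[-> ->]; last by rewrite !Hb.
  by apply: oppr_inj; rewrite !opprB !Hb.
have Dcoc : cocycle (domain T) D.
  move=> p Op; apply: filterS (near_small p) => q [d sd nd] Oq.
  apply: filterS (near_small q) => r [d' sd' nd'] Or; rewrite /D.
  (* Since the cell chosen at [r] contains [q], all three differences can be read on it. *)
  have crq : rect_set (val (cc r)) q by apply: (small_rect sd' (valP _) nd'); exact: Hc.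
  rewrite (key p q (cc q) (cc r) d sd nd) //; last exact: Hc.
  by rewrite [RHS]addrC addrA subrK.
have star : forall w, domain T w -> \forall q \near w, domain T q ->
    forall t, 0 <= t <= 1 -> domain T (segt w q t).
  move=> w Op; apply: filterS (near_small w) => q [d sd nd] [c cT cq] t t01.
  by exists c => //; apply: box_segt => //; exact: (small_rect sd cT nd).
have [F HF] := cocycle_exact Dcoc (domain_simply_connected HT) star.
pose corner c : R * R := (smin (val c), tmin (val c)).
have corner_in c : rect_set (val c) (corner c).
  have := cell_nondeg HT true c; have := cell_nondeg HT false c.
  by rewrite /rect_set /= !lexx => /ltW -> /ltW ->.
(* Along a cell [c], [F] varies exactly as [b p c] does, so [b p c - F p] is the same at all points
   [p] of [c]; the corner is an arbitrary one. *)
exists (fun c => b (corner c) c - F (corner c)).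
have const c p : rect_set (val c) p -> b (corner c) c - F (corner c) = b p c - F p.
  move=> cp'; pose s := segt (corner c) p.
  have : b (s 0) c - F (s 0) = b (s 1) c - F (s 1).
    apply: (@locally_constant_itv R Z (fun t => b (s t) c - F (s t))) => // t t01.
    have cs u : 0 <= u <= 1 -> rect_set (val c) (s u) by move=> u01; exact: box_segt (corner_in c) cp' u01.
    have Os u : 0 <= u <= 1 -> domain T (s u) by move=> /cs; exists (val c); [exact: valP|].
    have N1 : \forall u \near t, domain T (s u) -> F (s u) - F (s t) = D (s t) (s u).
      exact: (segt_continuous (HF _ (Os t t01))).
    have N2 : \forall u \near t, exists2 d, small_at T (s t) d &
        forall h, `|along h (s t) - along h (s u)| < d.
      exact: (segt_continuous (near_small (s t))).
    apply: filterS2 N1 N2 => u H1 [d sd nd] u01.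
    symmetry; apply: subr_exchange; rewrite (H1 (Os u u01)) /D.
    by apply: (key _ _ _ _ d) => //; [exact: cs | exact: (Hc _ (Os u u01))].
  by rewrite /s segt0 segt1.
move=> e ie; have [sp sm _ _] := Hside ie.
have ep := endpt_set HT true e.
rewrite (const (cp e) _ (sp _ ep)) (const (cm e) _ (sm _ ep)).
by rewrite opprB addrA subrK Hb.
Qed.

End Potentials.

(** * Sums of ideals of powers of linear forms *)

Section UnivariateSpan.
Variable F : numFieldType.

Lemma dvdp_prod_coprime (I : eqType) (s : seq I) (p : I -> {poly F}) (f : {poly F}) :
  uniq s -> {in s &, forall i j, i != j -> coprimep (p i) (p j)} ->
  {in s, forall i, p i %| f}%R -> (\prod_(i <- s) p i %| f)%R.
Proof.
elim: s => [|i s IHs] /=; first by move=> _ _ _; rewrite big_nil dvd1p.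
move=> /andP[i_s us] cop dv.
rewrite big_cons Gauss_dvdp; last first.
  rewrite big_seq; elim/big_rec: _ => [|j q js cq]; first by rewrite coprimep1.
  rewrite coprimepMr cq andbT; apply: cop; rewrite ?inE ?eqxx ?js ?orbT //.
  by apply: contraNneq i_s => ->.
rewrite dv ?inE ?eqxx //=; apply: IHs => // [j k js ks|j js]; last by apply: dv; rewrite inE js orbT.
by apply: cop; rewrite inE ?js ?ks orbT.
Qed.

Variables (n : nat) (I : finType) (a : I -> F) (e : I -> nat).
Hypotheses (inj_a : injective a) (wt : (n.+1 <= \sum_i (n.+1 - e i))%N).

(** The powers of ['X - a_i] with exponents from [e_i] to [n], padded with zeros so that a product
    type indexes them. *)
Let rowp (ij : I * 'I_n.+1) : {poly F} :=
  if (e ij.1 + ij.2 <= n)%N then ('X - (a ij.1)%:P) ^+ (e ij.1 + ij.2) else 0.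

Let M : 'M[F]_(#|{: I * 'I_n.+1}|, n.+1) := \matrix_(k, l) (rowp (enum_val k))`_l.

(* The functional p |-> sum_k u_k p_k, extended coefficientwise. *)
Let Lam (u : 'rV[F]_n.+1) (P : {poly {poly F}}) : {poly F} :=
  \sum_(k < n.+1) (u 0 k)%:P * P`_k.

(* If the functional u kills the (X - a_i)^k, e_i <= k <= n, then the polynomial
   f(y) = u((X - y)^n) vanishes at a_i to the order n + 1 - e_i for all i. As
   its degree is at most n it is zero, and so are its coefficients, which are
   those of u up to nonzero factors. *)
Lemma apolar_injective (u : 'rV[F]_n.+1) : u *m M^T = 0 -> u = 0.
Proof.
move=> uM.
have LamD P Q : Lam u (P + Q) = Lam u P + Lam u Q.
  by rewrite /Lam -big_split /=; apply: eq_bigr => k _; rewrite coefD mulrDr.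
have Lam0 : Lam u 0 = 0 by rewrite /Lam big1 // => k _; rewrite coef0 mulr0.
have Lam_sum (J : Type) (s : seq J) (Q : pred J) (G : J -> {poly {poly F}}) :
    Lam u (\sum_(j <- s | Q j) G j) = \sum_(j <- s | Q j) Lam u (G j).
  exact: (big_morph _ LamD Lam0).
have LamM P (q : {poly F}) : Lam u (P * q%:P) = Lam u P * q.
  by rewrite /Lam big_distrl /=; apply: eq_bigr => k _; rewrite coefMC mulrA.
have LamC (p : {poly F}) : Lam u (map_poly polyC p) = (\sum_(k < n.+1) u 0 k * p`_k)%:P.
  by rewrite /Lam rmorph_sum; apply: eq_bigr => k _; rewrite coef_map /= polyCM.
pose f := Lam u (('X - 'Y) ^+ n).
have fE : f = \poly_(k < n.+1) (u 0 (inord (n - k)) * ((-1) ^+ k * 'C(n, k)%:R)).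
  rewrite /f exprDn Lam_sum poly_def; apply: eq_bigr => k _.
  have -> : 'X ^+ (n - k) * (- 'Y) ^+ k *+ 'C(n, k) =
      'X^(n - k) * ((((-1) ^+ k * 'C(n, k)%:R)%:P * 'X^k : {poly F})%:P) :> {poly {poly F}}.
    rewrite -mulrnAr; congr (_ * _).
    have -> : ((-1) ^+ k * 'C(n, k)%:R)%:P * 'X^k = (- 'X) ^+ k *+ 'C(n, k) :> {poly F}.
      by rewrite [(- 'X) ^+ k]exprNn polyCM polyC_exp polyCN polyC1 polyC_natr mulr_natr mulrnAl.
    by rewrite polyCMn polyC_exp polyCN.
  rewrite LamM /Lam (bigD1 (inord (n - k))) //= big1 ?addr0.
    by rewrite coefXn inordK ?ltnS ?leq_subr // eqxx mulr1 mulrA -polyCM mul_polyC.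
  move=> j jk; rewrite coefXn; case: eqP => [E|]; last by rewrite mulr0.
  by case/eqP: jk; apply: val_inj; rewrite /= inordK ?ltnS ?leq_subr.
(* Expand X - y as (X - a_i) + (a_i - y). The terms with k >= n + 1 - e_i are divisible; in the
   others X - a_i has exponent n - k >= e_i, so [u] kills them. *)
have dvd i : (('X - (a i)%:P) ^+ (n.+1 - e i) %| f)%R.
  have -> : f = \sum_(k < n.+1) (\sum_(l < n.+1) u 0 l * (('X - (a i)%:P) ^+ (n - k))`_l)%:P
                   * (((a i)%:P - 'X) ^+ k *+ 'C(n, k)).
    rewrite /f -[X in X ^+ n](subrKA (a i)%:P%:P) exprDn Lam_sum; apply: eq_bigr => k _.
    rewrite -LamC -LamM -mulrnAr; congr (Lam u (_ * _)).
      by rewrite rmorphXn /= map_polyXsubC.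
    by rewrite polyCMn polyC_exp polyCB.
  apply: (big_ind (fun q => (('X - (a i)%:P) ^+ (n.+1 - e i) %| q)%R)) => [|q1 q2|k _];
    [exact: dvdp0 | exact: dvdp_add |]; case: (leqP (n.+1 - e i) k) => ki.
    apply: dvdp_mull; rewrite -mulr_natr; apply: dvdp_mulr.
    by rewrite -(opprB 'X) exprNn; apply/dvdp_mull/dvdp_exp2l.
  have eik : (e i <= n - k)%N by lia.
  have lt : (n - k - e i < n.+1)%N by lia.
  have /matrixP/(_ 0 (enum_rank (i, Ordinal lt))) := uM; rewrite !mxE.
  under eq_bigr => l _ do rewrite !mxE enum_rankK /rowp /= subnKC // leq_subr.
  by move=> ->; rewrite mul0r dvdp0.
have f0 : f = 0.
  apply: contraTeq wt => nf; rewrite -ltnNge.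
  have dv : (\prod_(i <- enum I) ('X - (a i)%:P) ^+ (n.+1 - e i) %| f)%R.
    apply: dvdp_prod_coprime => [|i j _ _ ij|i _]; [exact: enum_uniq | | exact: dvd].
    apply/coprimep_expl/coprimep_expr/coprimep_XsubC2.
    by rewrite subr_eq0; apply: contraNneq ij => /inj_a ->.
  have := dvdp_leq nf dv; rewrite big_enum /= size_prod; last first.
    by move=> i _; rewrite expf_neq0 // polyXsubC_eq0.
  have sf : (size f <= n.+1)%N by rewrite fE size_poly.
  under eq_bigr => i _ do rewrite size_exp_XsubC -addn1.
  by rewrite big_split /= sum1_card -addSn addnK => le; exact: leq_trans le sf.
apply/matrixP => i k; rewrite ord1 [RHS]mxE.
have := congr1 (fun p : {poly F} => p`_(n - k)) f0.
rewrite fE coef0 coef_poly ltnS leq_subr subKn -1?ltnS //.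
have -> : inord k = k by apply: val_inj; rewrite /= inordK.
move=> /eqP; rewrite !mulf_eq0 signr_eq0 pnatr_eq0 /= => /orP[/eqP //|].
by rewrite eqn0Ngt bin_gt0 leq_subr.
Qed.

(** Dual form of [apolar_injective]: since no nonzero functional kills the rows of [M], they span.
    The combination is then regrouped by [i]. *)
Lemma apolar_span (p : {poly F}) : (size p <= n.+1)%N ->
  exists q : I -> {poly F}, (forall i, size (q i) <= n.+1 - e i)%N /\
    p = \sum_i ('X - (a i)%:P) ^+ e i * q i.
Proof.
move=> sp.
have rf : row_free M^T by apply: inj_row_free => u; exact: apolar_injective.
have : row_full M by rewrite -col_leq_rank -mxrank_tr (eqP rf).
move=> /(submx_full (poly_rV p))/submxP[w pw].
pose W i (j : 'I_n.+1) := w 0 (enum_rank (i, j)).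
pose q i := \sum_(j < n.+1 | (e i + j <= n)%N) (W i j)%:P * ('X - (a i)%:P) ^+ j.
exists q; split.
  move=> i; apply: leq_trans (size_sum _ _ _) _; apply/bigmax_leqP => j ej.
  apply: leq_trans (size_polyMleq _ _) _.
  by rewrite size_polyC size_exp_XsubC; case: (_ != 0) => /=; lia.
rewrite -[LHS](poly_rV_K sp) pw mulmx_sum_row linear_sum /=.
have rowM k : rVpoly (row k M) = rowp (enum_val k).
  have -> : row k M = poly_rV (rowp (enum_val k)) by apply/rowP => l; rewrite !mxE.
  by rewrite poly_rV_K // /rowp; case: ifP => ?; rewrite ?size_poly0 // size_exp_XsubC.
under eq_bigr => k _ do rewrite linearZ /= rowM.
under [RHS]eq_bigr => i _ do rewrite /q mulr_sumr big_mkcond /=.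
rewrite pair_big /= [RHS](reindex _ (onW_bij _ (enum_val_bij (I * 'I_n.+1)%type))) /=.
apply: eq_bigr => k _; rewrite /rowp /W -surjective_pairing enum_valK.
by case: ifP => _; rewrite ?scaler0 // -mul_polyC exprD mulrCA.
Qed.

End UnivariateSpan.

(** * Bidegrees and spanning in one of the variables *)

Section Bidegree.
Variable R : realType.
Implicit Types (p q g : {poly {poly R}}) (a b A B : int) (h : bool).

Lemma bidegP a b p : bideg a b p <->
  forall i, p`_i != 0 -> (i%:Z <= a) /\ ((size p`_i)%:Z <= b + 1).
Proof.
split=> [H i pi|H i j pij].
  have := H i (size p`_i).-1; rewrite -/(lead_coef _) lead_coef_eq0 => /(_ pi)/andP[-> ?].
  by split=> //; have : (0 < size (p`_i)%R)%N; [rewrite size_poly_gt0 | lia].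
have pi : p`_i != 0 by apply: contraNneq pij => ->; rewrite coef0.
have [-> s] := H i pi.
by have : (j < size (p`_i)%R)%N; [apply: contraNT pij; rewrite -leqNgt => ?; rewrite nth_default | lia].
Qed.

Lemma bideg_swap a b p : bideg b a (swapXY p) <-> bideg a b p.
Proof.
split=> H i j.
  by rewrite -coef_swapXY => /H; rewrite andbC.
by rewrite coef_swapXY => /H; rewrite andbC.
Qed.

(* A bounds the degree along the direction h and B the degree across it. *)
Definition dbideg h A B := if h then bideg A B : set {poly {poly R}} else bideg B A.

Lemma dbideg_neg h A B : dbideg (~~ h) A B = dbideg h B A. Proof. by case: h. Qed.

Lemma dbideg0 h A B : dbideg h A B 0.
Proof. by case: h => i j; rewrite !coef0 eqxx. Qed.

Lemma dbidegD h A B p q : dbideg h A B p -> dbideg h A B q -> dbideg h A B (p + q).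
Proof.
have K a b p' q' : bideg a b p' -> bideg a b q' -> bideg a b (p' + q').
  move=> hp hq i j; rewrite !coefD => ne.
  case: (eqVneq p'`_i`_j 0) => [e0|/hp //].
  by apply: hq; move: ne; rewrite e0 add0r.
by case: h; exact: K.
Qed.

Lemma dbidegZ h A B (c : R) p : dbideg h A B p -> dbideg h A B (c%:P%:P * p).
Proof.
have K a b p' : bideg a b p' -> bideg a b (c%:P%:P * p').
  move=> hp i j; rewrite !coefCM => ne; apply: hp.
  by apply: contraNneq ne => ->; rewrite mulr0.
by case: h; exact: K.
Qed.

Lemma dbidegN h A B p : dbideg h A B p -> dbideg h A B (- p).
Proof. by move=> /(@dbidegZ h A B (-1)); rewrite !polyCN !polyC1 mulN1r. Qed.

Lemma dbideg_leq h A A' B B' p : A <= A' -> B <= B' -> dbideg h A B p -> dbideg h A' B' p.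
Proof.
move=> AA BB; case: h => H i j /H /andP[? ?]; apply/andP; split; lia.
Qed.

Lemma ell_swap l : ell (~~ l.1, l.2) = swapXY (ell l) :> {poly {poly R}}.
Proof.
by case: l => -[] c; rewrite /ell /= rmorphB /= ?swapXY_X ?swapXY_Y swapXY_polyC map_polyC.
Qed.

(** On coefficients this is multiplication by a monic polynomial of degree [k] in the variable
    across [h]; vertical lines reduce to horizontal ones by swapping variables. *)
Lemma dbideg_ell h c k A B g :
  dbideg h A B (ell (h, c) ^+ k * g) <-> dbideg h A (B - k%:Z) g.
Proof.
have K a b g' : bideg a b (ell (true, c) ^+ k * g') <-> bideg a (b - k%:Z) g'.
  have E i : (ell (true, c) ^+ k * g')`_i = ('X - c%:P) ^+ k * g'`_i.
    by rewrite /ell /= -polyCB -polyC_exp coefCM.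
  split=> /bidegP H; apply/bidegP => i.
    move=> gi; have := H i; rewrite E mulf_eq0 expf_eq0 polyXsubC_eq0 andbF /= => /(_ gi)[-> ].
    rewrite size_monicM ?monic_exp ?monicXsubC // size_exp_XsubC => sz; split=> //.
    by move: sz; rewrite addSn /= PoszD; lia.
  rewrite E mulf_eq0 expf_eq0 polyXsubC_eq0 andbF /= => gi; have [-> ] := H i gi.
  rewrite size_monicM ?monic_exp ?monicXsubC // size_exp_XsubC => sz; split=> //.
  by move: sz; rewrite addSn /= PoszD; lia.
case: h; first exact: K.
rewrite /dbideg -[X in bideg B A X](swapXYK) rmorphM rmorphXn /= -(ell_swap (false, c)) /=.
split=> [/bideg_swap/K/bideg_swap //|H].
by apply/bideg_swap/K/bideg_swap.
Qed.

Lemma bideg_monomials n1 n2 p : bideg (n1%:Z - 1) (n2%:Z - 1) p ->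
  p = \sum_(i < n1) \sum_(j < n2) (p`_i`_j)%:P%:P * ('X ^+ i * 'Y ^+ j).
Proof.
move=> H.
have E i : (i < n1)%N -> p`_i = \sum_(j < n2) (p`_i`_j)%:P * 'X^j.
  move=> _; under eq_bigr => j _ do rewrite mul_polyC.
  rewrite -(poly_def n2 (fun j => p`_i`_j)); apply/polyP => j; rewrite coef_poly; case: ltnP => // jn.
  by apply/eqP/negP => /negP /H; lia.
have -> : p = \sum_(i < n1) (p`_i)%:P * 'X^i.
  under eq_bigr => i _ do rewrite mul_polyC.
  rewrite -(poly_def n1 (fun i => p`_i)); apply/polyP => i; rewrite coef_poly; case: ltnP => // i_n.
  apply/polyP => j; rewrite coef0; apply/eqP/negP => /negP /H; lia.
apply: eq_bigr => i _; rewrite {1}E // rmorph_sum mulr_suml; apply: eq_bigr => j _ /=.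
have -> : (\sum_(i0 < n1) (p`_i0)%:P * 'X^i0)`_i = p`_i.
  under eq_bigr => i0 _ do rewrite mul_polyC.
  by rewrite -(poly_def n1 (fun i => p`_i)) coef_poly ltn_ord.
by rewrite polyCM polyC_exp -mulrA ['Y ^+ _ * _]mulrC.
Qed.

Lemma dbideg_span h n b (I : finType) (s : I -> R) (e : I -> nat) p :
  injective s -> (n.+1 <= \sum_i (n.+1 - e i))%N -> dbideg h n%:Z b p ->
  exists2 q : I -> {poly {poly R}}, (forall i, dbideg h (n%:Z - (e i)%:Z) b (q i)) &
    p = \sum_i ell (~~ h, s i) ^+ e i * q i.
Proof.
move=> injs wt.
have K p' : bideg b n%:Z p' -> exists2 q : I -> {poly {poly R}},
    (forall i, bideg b (n%:Z - (e i)%:Z) (q i)) & p' = \sum_i ell (true, s i) ^+ e i * q i.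
  move=> /bidegP H.
  have sp j : (size (p'`_j)%R <= n.+1)%N.
    by case: (eqVneq p'`_j 0) => [->|/H[]]; [rewrite size_poly0 | lia].
  have [q Hq] := boolp.choice (fun j => apolar_span injs wt (sp j)).
  (* [q j] may represent the zero polynomial nontrivially; replacing it by 0 there keeps the bound
     [b] on the other degree. *)
  pose Q i : {poly {poly R}} := \poly_(j < size p') (if p'`_j == 0 then 0 else q j i).
  exists Q => [i|].
    apply/bidegP => j; rewrite coef_poly; case: ifP => _; last by rewrite eqxx.
    case: (eqVneq p'`_j 0) => [|pj]; first by rewrite eqxx.
    rewrite -size_poly_gt0 => q0; have [-> _] := H j pj; have [/(_ i) qi _] := Hq j.
    by split=> //; move: q0 qi; clear; move: (size _) => k; lia.
  apply/polyP => j; rewrite coef_sum.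
  have E i : (ell (true, s i) ^+ e i * Q i)`_j =
      ('X - (s i)%:P) ^+ e i * (if p'`_j == 0 then 0 else q j i).
    rewrite /ell /= -polyCB -polyC_exp coefCM coef_poly; case: ltnP => // js.
    by rewrite nth_default // eqxx.
  under eq_bigr => i _ do rewrite E.
  case: (eqVneq p'`_j 0) => [->|pj]; last by have [_] := Hq j.
  by rewrite big1 // => i _; rewrite mulr0.
case: h; last exact: K.
rewrite /dbideg -bideg_swap => /K[q Hq E].
exists (fun i => swapXY (q i)) => [i|]; first exact/bideg_swap.
rewrite -[p]swapXYK E rmorph_sum; apply: eq_bigr => i _.
by rewrite rmorphM rmorphXn /= -(ell_swap (true, s i)).
Qed.

End Bidegree.

Section Truncation.
Variables (R : realType) (m m' : nat).
Implicit Types (p q g : {poly {poly R}}) (h : bool).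
Local Notation V := 'M[R]_(m.+1, m'.+1).

Definition trunc p : V := \matrix_(i, j) p`_i`_j.

Lemma trunc_linear (c : R) p q : trunc (c%:P%:P * p + q) = c *: trunc p + trunc q.
Proof. by apply/matrixP => i j; rewrite !mxE !coefD !coefCM. Qed.

Lemma truncD p q : trunc (p + q) = trunc p + trunc q.
Proof. by apply/matrixP => i j; rewrite !mxE !coefD. Qed.

Lemma truncN p : trunc (- p) = - trunc p.
Proof. by apply/matrixP => i j; rewrite !mxE !coefN. Qed.

Lemma truncZ (c : R) p : trunc (c%:P%:P * p) = c *: trunc p.
Proof. by apply/matrixP => i j; rewrite !mxE !coefCM. Qed.

Lemma trunc_sum (I : Type) (s : seq I) (P : pred I) (f : I -> {poly {poly R}}) :
  trunc (\sum_(i <- s | P i) f i) = \sum_(i <- s | P i) trunc (f i).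
Proof.
by apply: (big_morph trunc truncD); apply/matrixP => i j; rewrite !mxE !coef0.
Qed.

Lemma coef_bipoly (A : V) (i j : nat) : (bipoly A)`_i`_j =
  if insub i is Some i' then if insub j is Some j' then A i' j' else 0 else 0.
Proof.
have E k : ((bipoly A)`_k : {poly R}) =
    \sum_(i' < m.+1 | i' == k :> nat) \sum_(j' < m'.+1) A i' j' *: 'X^j'.
  rewrite /bipoly coef_sum [RHS]big_mkcond; apply: eq_bigr => i' _.
  rewrite coef_sum; case: eqP => [<-|ne]; last first.
    rewrite big1 // => j' _; rewrite coefCM mulrC -polyC_exp coefMC coefXn.
    by rewrite eq_sym; case: eqP ne => // _ _; rewrite !mul0r.
  apply: eq_bigr => j' _; rewrite coefCM -polyC_exp coefMC coefXn eqxx mul1r mul_polyC //.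
have Ej (i' : 'I_m.+1) : (\sum_(j' < m'.+1) A i' j' *: 'X^j' : {poly R})`_j =
    if insub j is Some j' then A i' j' else 0.
  case: insubP => [j' _ <-|].
    rewrite coef_sum (bigD1 j') //= coefZ coefXn eqxx mulr1 big1 ?addr0 // => k kj.
    rewrite coefZ coefXn; case: eqP => [E'|_]; last by rewrite mulr0.
    by move: kj; rewrite -val_eqE /= E' eqxx.
  rewrite -leqNgt => jm; rewrite coef_sum big1 // => k _; rewrite coefZ coefXn.
  by case: eqP => [E'|]; [have := ltn_ord k; rewrite -E'; lia | rewrite mulr0].
rewrite E; case: insubP => [i' _ <-|ni].
  by rewrite (big_pred1 i') // => k; rewrite /= -val_eqE.
by rewrite big1 ?coef0 // => k /eqP ki; move: ni; rewrite -ki ltn_ord.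
Qed.

Lemma bipolyK : cancel (@bipoly R m m') trunc.
Proof. by move=> A; apply/matrixP => i j; rewrite mxE coef_bipoly !valK. Qed.

Lemma bideg_bipoly (A : V) : bideg m%:Z m'%:Z (bipoly A).
Proof.
move=> i j; rewrite coef_bipoly; case: insubP => [i' im _|]; last by rewrite eqxx.
by case: insubP => [j' jm _ _|]; [lia | rewrite eqxx].
Qed.

Lemma truncK p : bideg m%:Z m'%:Z p -> bipoly (trunc p) = p.
Proof.
move=> H; apply/polyP => i; apply/polyP => j; rewrite coef_bipoly.
case: insubP => [i' _ <-|ni].
  case: insubP => [j' _ <-|nj]; first by rewrite mxE.
  by apply/esym/eqP/negP => /negP /H; lia.
by apply/esym/eqP/negP => /negP /H; lia.
Qed.

Lemma bipoly_linear (c : R) (A B : V) : bipoly (c *: A + B) = c%:P%:P * bipoly A + bipoly B.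
Proof.
apply/polyP => i; apply/polyP => j; rewrite !coefD !coefCM !coef_bipoly.
case: (insub i) => [i'|]; last by rewrite mulr0 addr0.
by case: (insub j) => [j'|]; rewrite ?mulr0 ?addr0 // !mxE.
Qed.

Lemma bipolyD (A B : V) : bipoly (A + B) = bipoly A + bipoly B.
Proof. by rewrite -[A in LHS]scale1r bipoly_linear polyC1 mul1r. Qed.

Lemma bipoly0 : bipoly (0 : V) = 0.
Proof. by apply: (addrI (bipoly (0 : V))); rewrite addr0 -bipolyD addr0. Qed.

Lemma bipolyB (A B : V) : bipoly (A - B) = bipoly A - bipoly B.
Proof. by rewrite addrC -scaleN1r bipoly_linear !polyCN !polyC1 mulN1r addrC. Qed.

End Truncation.

(** * Dimension counts *)

Section LinearAlgebra.
Variable K : fieldType.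

Lemma hom_of_linear (aT rT : vectType K) (f : aT -> rT) :
  linear f -> {F : 'Hom(aT, rT) | F =1 f}.
Proof.
move=> lf.
pose F : {linear aT -> rT} := HB.pack f (GRing.isLinear.Build K aT rT *:%R f lf).
by exists (linfun F) => x; rewrite lfunE.
Qed.

Lemma span_of_mem (V : vectType K) (P : set V) v : P v -> v \in span_of P.
Proof. by move=> Pv; have [sP _] := span_ofP P; exact: sP. Qed.

Lemma span_of_sub (V : vectType K) (P : set V) (W : {vspace V}) :
  (forall v, P v -> v \in W) -> (span_of P <= W)%VS.
Proof. by move=> PW; have [_] := span_ofP P; apply. Qed.

Section Product.
Variables (I : finType) (V : vectType K).

Definition single (i : I) (v : V) : {ffun I -> V} := [ffun j => if j == i then v else 0].

Lemma single_linear i : linear (single i).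
Proof.
move=> c u v; apply/ffunP => j; rewrite !ffunE.
by case: ifP => _; rewrite ?scaler0 ?addr0.
Qed.

HB.instance Definition _ i :=
  GRing.isLinear.Build K V {ffun I -> V} *:%R (single i) (single_linear i).

Lemma ffun_sum_single (f : {ffun I -> V}) : f = \sum_i single i (f i).
Proof.
apply/ffunP => j; rewrite sum_ffunE (bigD1 j) //= ffunE eqxx big1 ?addr0 // => i ij.
by rewrite ffunE eq_sym (negbTE ij).
Qed.

Definition prodv (U : I -> {vspace V}) : {vspace {ffun I -> V}} :=
  (\sum_i (linfun (single i) @: U i))%VS.

Lemma memv_prod (U : I -> {vspace V}) (f : {ffun I -> V}) : reflect (forall i, f i \in U i) (f \in prodv U).
Proof.
apply: (iffP idP) => [/memv_sumP[g Hg ->] i|H].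
  rewrite sum_ffunE memv_suml // => j _.
  have /memv_imgP[v Uv ->] := Hg j isT.
  by rewrite lfunE ffunE; case: eqP => [->|]; rewrite ?mem0v.
rewrite [f]ffun_sum_single memv_sumr // => i _.
by rewrite -(lfunE (single i)); apply: memv_img.
Qed.

Lemma dim_prodv (U : I -> {vspace V}) : \dim (prodv U) = (\sum_i \dim (U i))%N.
Proof.
have : directv (\sum_i (linfun (single i) @: U i))%VS.
  apply/directv_sum_independent => u Hu u0 i _.
  have /memv_imgP[v Uv E] := Hu i isT.
  have := congr1 (fun f : {ffun I -> V} => f i) u0.
  rewrite sum_ffunE (bigD1 i) //= big1 => [|j ji]; last first.
    have /memv_imgP[w _ ->] := Hu j isT.
    by rewrite lfunE ffunE eq_sym (negbTE ji).
  rewrite addr0 E lfunE /= ffunE eqxx ffunE => ->.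
  by rewrite linear0.
move/directvP => /= ->; apply: eq_bigr => i _; apply: limg_dim_eq.
apply/eqP; rewrite -subv0; apply/subvP => v; rewrite memv_cap memv_ker lfunE /= => /andP[_ /eqP].
by move=> /ffunP/(_ i); rewrite !ffunE eqxx memv0 => ->.
Qed.

Lemma subv_prod (U : I -> {vspace V}) (W : {vspace {ffun I -> V}}) :
  (forall i v, v \in U i -> single i v \in W) -> (prodv U <= W)%VS.
Proof.
move=> H; apply/subv_sumP => i _; apply/subvP => u /memv_imgP[v Uv ->].
by rewrite lfunE; exact: H.
Qed.

End Product.

(** Meant for [f] the jumps, [S] the splines, [Z] the cycles and [I] the edge ideals: [S] has at
    most the kernel of [f] plus [limg f :&: I], whose dimension is controlled through [limg f + I],
    which contains [Z + I]. *)
Lemma dim_preimage_bound (aT rT : vectType K) (f : 'Hom(aT, rT)) (S : {vspace aT})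
    (Z I : {vspace rT}) :
  (forall s, s \in S -> f s \in I) -> (Z <= limg f)%VS ->
  (\dim S + \dim (Z + I) <= \dim {: aT} + \dim I)%N.
Proof.
move=> SI Zf.
have e1 := limg_ker_dim f S.
have e2 := limg_ker_dim f fullv.
have e3 := dimv_sum_cap (limg f) I.
have l1 : (\dim (S :&: lker f) <= \dim (fullv :&: lker f))%N.
  by apply/dimvS/capvS => //; exact: subvf.
have l2 : (\dim (f @: S) <= \dim (limg f :&: I))%N.
  apply: dimvS; apply/subvP => u /memv_imgP[s Ss ->].
  by rewrite memv_cap memv_img ?memvf //= SI.
have l3 : (\dim (Z + I) <= \dim (limg f + I))%N by apply/dimvS/addvS.
by lia.
Qed.

(** Meant for [f] the boundary map, [A] the chains, [I] the edge ideals. The sum of the cycles and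
    [I] has all cycles in its kernel and all of [f @: I] in its image. *)
Lemma dim_cycles_bound (aT rT : vectType K) (f : 'Hom(aT, rT)) (A I : {vspace aT})
    (G : {vspace rT}) :
  (I <= A)%VS -> (forall a, a \in A -> f a \in G) ->
  (\dim A + \dim (f @: I) <= \dim ((A :&: lker f) + I) + \dim G)%N.
Proof.
move=> IA AG.
have e1 := limg_ker_dim f A.
have e2 := limg_ker_dim f ((A :&: lker f) + I)%VS.
have l1 : (\dim (f @: A) <= \dim G)%N.
  by apply: dimvS; apply/subvP => u /memv_imgP[a Aa ->]; exact: AG.
have l2 : (\dim (A :&: lker f) <= \dim (((A :&: lker f) + I) :&: lker f))%N.
  by apply: dimvS; rewrite subv_cap addvSl capvSr.
have l3 : (\dim (f @: I) <= \dim (f @: ((A :&: lker f) + I)))%N.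
  by apply: dimvS; apply/limgS/addvSr.
by lia.
Qed.

(** Modulo [B], the image of [M] is that of a complement of [M :&: N] in [M]. *)
Lemma dim_quotient_bound (aT rT : vectType K) (f : 'Hom(aT, rT)) (M N : {vspace aT})
    (G B : {vspace rT}) :
  (G <= B + f @: M)%VS -> (f @: (M :&: N) <= B)%VS ->
  (\dim G + \dim (M :&: N) <= \dim B + \dim M)%N.
Proof.
move=> GB fB; have e1 := dimv_cap_compl M N.
have l1 : (\dim G <= \dim (B + f @: (M :\: N)))%N.
  apply: dimvS; apply: subv_trans GB _.
  rewrite -{1}(addv_diff_cap M N) limgD subv_add addvSl /= subv_add addvSr /=.
  exact: subv_trans fB (addvSl _ _).
have l3 : (\dim (B + f @: (M :\: N)) <= \dim B + \dim (f @: (M :\: N)))%N := dimv_add_leqif _ _.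
have l4 : (\dim (f @: (M :\: N)) <= \dim (M :\: N))%N by have := limg_ker_dim f (M :\: N); lia.
by lia.
Qed.

End LinearAlgebra.

(** * The boundary map and the correction spaces *)

Section Boundary.
Variables (R : realType) (T : mesh R) (r : edges T -> int) (m m' : nat).
Hypotheses (HT : is_tmesh T) (Hred : reduced T).
Hypotheses (Hr : smoothness r) (Hconst : constant_along_MS r).
Local Notation V := 'M[R]_(m.+1, m'.+1).
Implicit Types (p q : R * R) (e : edges T) (x y : {set edges T}) (g : vertices T).
Implicit Types (h s : bool).

Lemma smoothE x e : x \in MS T -> e \in x -> smooth r x = r e.
Proof.
move=> xM ex; rewrite /smooth; case: pickP => [e' e'x|/(_ e)]; last by rewrite ex.
exact: Hconst e'x ex.
Qed.

Lemma smooth_ge x : -1 <= smooth r x.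
Proof. by rewrite /smooth; case: pickP => // e _; exact: Hr.1. Qed.

Lemma edge_ellXE x e : x \in MS T -> e \in x -> edge_ellX r e = msX r x.
Proof.
by move=> xM ex; rewrite /edge_ellX /msX (segment_line (MS_segment xM) ex) (smoothE xM ex).
Qed.

Definition ms_ideal x : {vspace V} :=
  span_of [set A : V | exists q : {poly {poly R}}, bipoly A = msX r x * q].

Lemma edge_idealE x e : x \in MS T -> e \in x -> edge_ideal r m m' e = ms_ideal x.
Proof. by move=> xM ex; rewrite /edge_ideal (edge_ellXE xM ex). Qed.

Definition boundary_fun (a : {ffun edges T -> V}) : {ffun vertices T -> V} :=
  [ffun g => if interior_vertex g then circulation a (val g) else 0].

Lemma jump_linear p h s (c : R) (a b : {ffun edges T -> V}) :
  jump (c *: a + b) p h s = c *: jump a p h s + jump b p h s.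
Proof.
rewrite /jump scaler_sumr -big_split /=.
by apply: eq_bigr => e _; rewrite !ffunE.
Qed.

Lemma boundary_linear : linear boundary_fun.
Proof.
move=> c a b; apply/ffunP => g; rewrite !ffunE; case: ifP => _; last by rewrite scaler0 addr0.
rewrite /circulation !jump_linear !scalerDr !scalerN !opprD.
by rewrite (addrACA _ (jump b _ true true)) (addrACA (_ + _) (_ - _) (- _))
  (addrACA (_ + _) (_ + _) (c *: _)).
Qed.

Definition boundary : 'Hom({ffun edges T -> V}, {ffun vertices T -> V}) :=
  sval (hom_of_linear boundary_linear).

Lemma boundaryE a : boundary a = boundary_fun a.
Proof. exact: (svalP (hom_of_linear boundary_linear)). Qed.

(** Zero unless [p] is an interior vertex, so that a polynomial carried to the boundary of the
    domain disappears. *)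
Definition at_point p (v : V) : {ffun vertices T -> V} :=
  [ffun g => if interior_vertex g && (val g == p) then v else 0].

Lemma at_point_linear p : linear (at_point p).
Proof.
move=> c u v; apply/ffunP => g; rewrite !ffunE.
by case: ifP => _; rewrite ?scaler0 ?addr0.
Qed.

HB.instance Definition _ p :=
  GRing.isLinear.Build R V {ffun vertices T -> V} *:%R (at_point p) (at_point_linear p).

Lemma at_point_single g v : interior_vertex g -> at_point (val g) v = single g v.
Proof.
move=> ig; apply/ffunP => g'; rewrite !ffunE val_eqE.
by case: eqP => [->|]; rewrite ?ig ?andbF.
Qed.

Lemma boundary_single e v : interior_edge e -> boundary (single e v) =
  if horiz (val e) then at_point (seg_lo (val e)) v - at_point (seg_hi (val e)) v
  else at_point (seg_hi (val e)) v - at_point (seg_lo (val e)) v.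
Proof.
move=> ie; rewrite boundaryE; apply/ffunP => g.
have J p h s : jump (single e v) p h s =
    if (horiz (val e) == h) && (endpt s (val e) == p) then v else 0.
  rewrite /jump big_mkcond (bigD1 e) //= ffunE eqxx ie /= big1 ?addr0 // => e' ne.
  by case: ifP => // _; rewrite ffunE (negbTE ne).
rewrite ffunE /circulation !J /endpt /=.
case: (horiz (val e)); rewrite !ffunE /= ?subr0 ?sub0r ?addr0 ?add0r ![val g == _]eq_sym;
  case: (interior_vertex g); rewrite /= ?subrr //.
by rewrite addrC.
Qed.

Definition edge_family (U : edges T -> {vspace V}) : {vspace {ffun edges T -> V}} :=
  prodv (fun e => if interior_edge e then U e else 0%VS).

Definition vertex_family (U : vertices T -> {vspace V}) : {vspace {ffun vertices T -> V}} :=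
  prodv (fun g => if interior_vertex g then U g else 0%VS).

Local Notation edge_ideals := (edge_family (edge_ideal r m m')).
Local Notation vertex_ideals := (vertex_family (vertex_ideal r m m')).

Lemma edge_boundary e v : interior_edge e -> v \in edge_ideal r m m' e ->
  at_point (seg_lo (val e)) v - at_point (seg_hi (val e)) v \in (boundary @: edge_ideals)%VS.
Proof.
move=> ie ve; have : boundary (single e v) \in (boundary @: edge_ideals)%VS.
  apply: memv_img; apply/memv_prod => e'; rewrite ffunE; case: eqP => [->|_]; last exact: mem0v.
  by rewrite ie.
by rewrite boundary_single //; case: ifP => // _; rewrite -opprB rpredN.
Qed.

(** All edges of [x] share one ideal, so [v] can be carried from each edge to the next;
    [carrier_chain] provides the steps. *)
Lemma boundary_walk x p q v : x \in MS T -> carrier x p -> carrier x q ->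
  p \in vertices T -> q \in vertices T -> v \in ms_ideal x ->
  at_point p v - at_point q v \in (boundary @: edge_ideals)%VS.
Proof.
move=> xM /carrierP[e1 e1x e1p] /carrierP[e2 e2x e2q] pv qv vx.
have [_ _ cx] := MS_segment xM.
have B e : e \in x ->
    at_point (seg_lo (val e)) v - at_point (seg_hi (val e)) v \in (boundary @: edge_ideals)%VS.
  by move=> ex; apply: edge_boundary; [exact: MS_interior ex | rewrite (edge_idealE xM)].
have trans (u1 u2 u3 : {ffun vertices T -> V}) : u1 - u2 \in (boundary @: edge_ideals)%VS ->
    u2 - u3 \in (boundary @: edge_ideals)%VS -> u1 - u3 \in (boundary @: edge_ideals)%VS.
  by move=> b1 b2; rewrite -(subrKA u2) rpredD.
have sym (u1 u2 : {ffun vertices T -> V}) : u1 - u2 \in (boundary @: edge_ideals)%VS ->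
    u2 - u1 \in (boundary @: edge_ideals)%VS by rewrite -opprB rpredN.
have refl (u1 : {ffun vertices T -> V}) : u1 - u1 \in (boundary @: edge_ideals)%VS.
  by rewrite subrr mem0v.
have E e w : e \in x -> (w = seg_lo (val e) \/ w = seg_hi (val e)) ->
    at_point (seg_lo (val e)) v - at_point w v \in (boundary @: edge_ideals)%VS.
  by move=> ex [] ->; [exact: refl | exact: B].
pose P e := at_point p v - at_point (seg_lo (val e)) v \in (boundary @: edge_ideals)%VS.
have P2 : P e2.
  apply: (@carrier_chain _ _ HT Hred x P cx _ e1 e2 e1x e2x).
    move=> e e' w ex e'x Pe we we'; apply: (trans _ _ _ Pe).
    by apply: (trans _ _ _ (E _ _ ex we)); apply: sym; exact: E.
  by apply: sym; apply: E => //; exact: (edge_no_vertex Hred (valP e1) pv).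
by apply: (trans _ _ _ P2); apply: E => //; exact: (edge_no_vertex Hred (valP e2) qv).
Qed.

Lemma MIS_MS x : x \in MIS T -> x \in MS T.
Proof. by rewrite inE => /andP[]. Qed.

Lemma vertex_domain p : p \in vertices T -> domain T p.
Proof.
move=> /vertexP[e eT H]; have lt := edges_nondeg HT eT.
have : seg_set e p by case: H => ->; [exact/seg_lo_set/ltW | exact/seg_hi_set/ltW].
by move=> /(edges_sub HT eT)[c cT /bdry_rect[cp _]]; exists c.
Qed.

Lemma MIS_vertex x g : x \in MIS T -> carrier x (val g) -> interior_vertex g.
Proof.
rewrite inE => /andP[xM /asboolP x0] xg; apply/asboolP; apply: contrapT => ni.
have : (carrier x `&` bdry (domain T)) (val g).
  by split=> //; apply/bdry_domain; split=> //; exact/vertex_domain/valP.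
by rewrite x0.
Qed.

Lemma boundary_nonMIS x p v : x \in MS T -> x \notin MIS T -> carrier x p ->
  p \in vertices T -> v \in ms_ideal x -> at_point p v \in (boundary @: edge_ideals)%VS.
Proof.
move=> xM; rewrite inE xM /= => /asboolPn /eqP/set0P[q [xq bq]] xp pv vx.
have [cp [cm Hside]] := side_cells_exist HT Hred.
have [_ nq] := (bdry_domain T q).1 bq.
(* The relative interior of an interior edge lies in the interior of the domain, so [q] is an
   endpoint. *)
have qv : q \in vertices T.
  have /carrierP[e ex /seg_setP[q1 q2]] := xq.
  move: q2; rewrite !le_eqVlt => /andP[/orP[/eqP q2 _|l1]].
    by rewrite -(pt_coord (horiz (val e)) q) q1 -q2 -seg_loE seg_lo_vertex.
  case/orP=> [/eqP q2|l2].
    by rewrite -(pt_coord (horiz (val e)) q) q1 q2 -seg_hiE seg_hi_vertex.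
  case: nq; apply: (relint_interior HT Hside (MS_interior xM ex) q1).
  by rewrite l1.
have -> : at_point p v = at_point p v - at_point q v.
  suff -> : at_point q v = 0 by rewrite subr0.
  apply/ffunP => g; rewrite !ffunE; case: ifP => // /andP[/asboolP ig /eqP gq].
  by case: nq; rewrite -gq.
exact: (boundary_walk xM xp xq pv qv vx).
Qed.

End Boundary.

Lemma subr_sub_sub (Z : zmodType) (a b c : Z) : b - c = (a - c) - (a - b).
Proof. by rewrite opprB [RHS]addrC subrKA. Qed.

(** * From the correction spaces to the cokernel *)

Section Correction.
Variables (R : realType) (T : mesh R) (r : edges T -> int) (m m' : nat).
Hypotheses (HT : is_tmesh T) (Hred : reduced T).
Hypotheses (Hr : smoothness r) (Hconst : constant_along_MS r).
Local Notation V := 'M[R]_(m.+1, m'.+1).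
Implicit Types (p q : {poly {poly R}}) (e : edges T) (x y : {set edges T}) (g : vertices T).
Implicit Types (h s : bool) (A : {set {set edges T}}).

Local Notation edge_ideals := (edge_family (edge_ideal r m m')).
Local Notation vertex_ideals := (vertex_family (vertex_ideal r m m')).
Local Notation bd := (boundary T m m').
Local Notation ideal_of := (ms_ideal r m m').
Local Notation at_point := (@at_point R T m m').

Definition degree_along h : nat := if h then m else m'.
Local Notation mm := degree_along.

Lemma bideg_mm h q : bideg m%:Z m'%:Z q <-> dbideg h (mm h)%:Z (mm (~~ h))%:Z q.
Proof. by case: h. Qed.

Lemma smooth_absz x : (absz (smooth r x + 1))%:Z = smooth r x + 1.
Proof. by rewrite gez0_abs //; have := smooth_ge Hr x; lia. Qed.

Lemma msX_dbideg x B1 B2 q :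
  dbideg (hor x) B1 B2 (msX r x * q) <-> dbideg (hor x) B1 (B2 - smooth r x - 1) q.
Proof.
rewrite /msX /ellX [line x]surjective_pairing dbideg_ell smooth_absz.
by rewrite -/(hor x) opprD addrA.
Qed.

Lemma corr_spaceE x q : corr_space r m m' x q <->
  dbideg (hor x) (mm (hor x))%:Z ((mm (~~ hor x))%:Z - smooth r x - 1) q.
Proof. by rewrite /corr_space /dbideg; case: (hor x). Qed.

Lemma corr_space_msX x q : corr_space r m m' x q <-> bideg m%:Z m'%:Z (msX r x * q).
Proof. by rewrite corr_spaceE (bideg_mm (hor x)) msX_dbideg. Qed.

Lemma corr_space_bideg x q : corr_space r m m' x q -> bideg m%:Z m'%:Z q.
Proof.
move/corr_spaceE; rewrite (bideg_mm (hor x)); apply: dbideg_leq => //.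
by have := smooth_ge Hr x; lia.
Qed.

Lemma single_corr_sum A x q : x \in A -> corr_space r m m' x q ->
  single x (trunc m m' q) \in corr_sum r m m' A.
Proof.
move=> xA xq; apply: span_of_mem => y; rewrite ffunE; case: eqP => [->|_].
  by rewrite xA truncK //; exact: corr_space_bideg xq.
case: ifP => // _; rewrite bipoly0; apply/corr_spaceE; exact: dbideg0.
Qed.

Lemma corr_sum_sub A (W : {vspace {ffun {set edges T} -> V}}) :
  (forall x q, x \in A -> corr_space r m m' x q -> single x (trunc m m' q) \in W) ->
  (corr_sum r m m' A <= W)%VS.
Proof.
move=> H; apply: span_of_sub => u Hu.
rewrite (ffun_sum_single u) memv_suml // => x _.
have := Hu x; case: ifP => [xA|_ ->]; last by rewrite linear0 mem0v.
by move=> /(H x _ xA); rewrite bipolyK.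
Qed.

Lemma ms_ideal_mem x q : bideg m%:Z m'%:Z (msX r x * q) -> trunc m m' (msX r x * q) \in ideal_of x.
Proof. by move=> H; apply: span_of_mem; exists q; rewrite truncK. Qed.

(* The element [g] v for some vertex g on x; up to boundaries the choice of g
   does not matter. *)
Definition place x (v : V) : {ffun vertices T -> V} :=
  if x \in MIS T then
    if [pick g : vertices T | `[< carrier x (val g) >]] is Some g
    then at_point (val g) v else 0
  else 0.

Lemma place_linear x : linear (place x).
Proof.
move=> c u v; rewrite /place; case: ifP => _; last by rewrite scaler0 addr0.
by case: pickP => [g _|_]; [exact: linearP | rewrite scaler0 addr0].
Qed.

HB.instance Definition _ x :=
  GRing.isLinear.Build R V {ffun vertices T -> V} *:%R (place x) (place_linear x).

Lemma place_walk x g v : x \in MS T -> carrier x (val g) -> v \in ideal_of x ->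
  at_point (val g) v - place x v \in (bd @: edge_ideals)%VS.
Proof.
move=> xM xg vx; rewrite /place; case: (boolP (x \in MIS T)) => xI; last first.
  by rewrite subr0; exact: (boundary_nonMIS HT Hred Hconst xM xI xg (valP g) vx).
case: pickP => [g' /asboolP xg'|/(_ g)]; last by rewrite asboolT.
exact: (boundary_walk HT Hred Hconst xM xg xg' (valP g) (valP g') vx).
Qed.

Definition correction_fun (u : {ffun {set edges T} -> V}) : {ffun vertices T -> V} :=
  \sum_x place x (trunc m m' (msX r x * bipoly (u x))).

Lemma correction_linear : linear correction_fun.
Proof.
move=> c u v; rewrite /correction_fun scaler_sumr -big_split; apply: eq_bigr => x _ /=.
by rewrite -linearP /= !ffunE bipoly_linear mulrDr mulrCA trunc_linear.
Qed.

Definition correction : 'Hom({ffun {set edges T} -> V}, {ffun vertices T -> V}) :=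
  sval (hom_of_linear correction_linear).

Lemma correctionE u : correction u = correction_fun u.
Proof. exact: (svalP (hom_of_linear correction_linear)). Qed.

Lemma trunc0 : trunc m m' (0 : {poly {poly R}}) = 0.
Proof. by apply/matrixP => i j; rewrite !mxE !coef0. Qed.

Lemma correction_single x q : bideg m%:Z m'%:Z q ->
  correction (single x (trunc m m' q)) = place x (trunc m m' (msX r x * q)).
Proof.
move=> Bq; rewrite correctionE /correction_fun (bigD1 x) //= big1 ?addr0 => [|y yx].
  by rewrite ffunE eqxx truncK.
by rewrite ffunE (negbTE yx) bipoly0 mulr0 trunc0 linear0.
Qed.

(** The product [A] of both powers with [q] lies in the ideals of both segments through [g]. Up to
    boundaries its two copies are carried to [g], one along each segment, and cancel there; a term
    omitted from the relation matches the value 0 of [place]. *)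
Lemma correction_relation u : vertex_relation r u -> correction u \in (bd @: edge_ideals)%VS.
Proof.
move=> [g ig [q Bq Hu]].
have [vM vh vg] := MS_atP Hred false ig; have [hM hh hg] := MS_atP Hred true ig.
set xv := MS_at false g in vM vh vg Bq Hu *; set xh := MS_at true g in hM hh hg Bq Hu *.
have ne : xv != xh by apply/eqP => E; move: vh; rewrite E hh.
pose A := trunc m m' (msX r xv * (msX r xh * q)).
have Bhq : dbideg (hor xv) (mm (hor xv))%:Z ((mm (~~ hor xv))%:Z - smooth r xv - 1) (msX r xh * q).
  rewrite vh; have [_ H] := msX_dbideg xh (m%:Z - smooth r xv - 1) m'%:Z q.
  by rewrite hh in H; exact: H.
have BA : bideg m%:Z m'%:Z (msX r xv * (msX r xh * q)).
  by apply/(bideg_mm (hor xv))/msX_dbideg.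
have Av : A \in ideal_of xv by exact: ms_ideal_mem.
have Ah : A \in ideal_of xh by rewrite /A mulrCA; apply: ms_ideal_mem; rewrite mulrCA.
have Ev : place xv (trunc m m' (msX r xv * bipoly (u xv))) = place xv A.
  case: (boolP (xv \in MIS T)) => xI; last by rewrite /place (negbTE xI).
  by rewrite Hu xI eqxx.
have Eh : place xh (trunc m m' (msX r xh * bipoly (u xh))) = - place xh A.
  case: (boolP (xh \in MIS T)) => xI; last by rewrite /place (negbTE xI) oppr0.
  by rewrite Hu xI eq_sym (negbTE ne) eqxx mulrN truncN raddfN /A mulrCA.
have E : correction u = place xv A - place xh A.
  rewrite correctionE /correction_fun (bigD1 xv) //= (bigD1 xh) 1?eq_sym //= Ev Eh.
  rewrite big1 ?addr0 // => x /andP[nv nh].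
  by rewrite Hu (negbTE nv) (negbTE nh) if_same mulr0 trunc0 linear0.
have Pv := place_walk vM vg Av; have Ph := place_walk hM hg Ah.
by rewrite E (subr_sub_sub (at_point (val g) A)); exact: rpredB.
Qed.

Lemma correction_relations : (correction @: relations r m m' <= bd @: edge_ideals)%VS.
Proof.
have H : (relations r m m' <= correction @^-1: (bd @: edge_ideals))%VS.
  by apply: span_of_sub => u /correction_relation; rewrite memv_preim.
apply/subvP => w /memv_imgP[u /(subvP H) + ->].
by rewrite -memv_preim.
Qed.

Lemma vertex_ideals_sub :
  (vertex_ideals <= bd @: edge_ideals + correction @: corr_sum r m m' (MIS T))%VS.
Proof.
set W := (_ + _)%VS; apply: subv_prod => g v; case: ifP => [ig|_]; last first.
  by rewrite memv0 => /eqP ->; rewrite linear0 mem0v.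
suff H : (vertex_ideal r m m' g <= linfun (single g) @^-1: W)%VS.
  by move=> /(subvP H); rewrite -memv_preim lfunE.
apply/subv_sumP => e /andP[ie /asboolP eg].
have [x xM ex] := interior_edge_MS HT ie.
have xg : carrier x (val g) by apply/carrierP; exists e.
rewrite (edge_idealE m m' Hconst xM ex); apply: span_of_sub => B [q Bq].
rewrite -memv_preim lfunE /= -(at_point_single _ ig).
have Bm : bideg m%:Z m'%:Z (msX r x * q) by rewrite -Bq; exact: bideg_bipoly.
have BE : B = trunc m m' (msX r x * q) by rewrite -Bq bipolyK.
have Bi : B \in ideal_of x by rewrite BE; exact: ms_ideal_mem.
have bW u : u \in (bd @: edge_ideals)%VS -> u \in W by exact/subvP/addvSl.
rewrite -(subrK (place x B) (at_point _ _)) rpredD //.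
  by apply/bW/place_walk.
case: (boolP (x \in MIS T)) => xI; last by rewrite /place (negbTE xI) mem0v.
have Cq : corr_space r m m' x q by apply/corr_space_msX.
rewrite BE -(correction_single _ (corr_space_bideg Cq)).
by apply: (subvP (addvSr _ _)); apply/memv_img/single_corr_sum.
Qed.

Lemma relation_pair x g q : x \in MIS T -> carrier x (val g) ->
  dbideg (hor x) ((mm (hor x))%:Z - smooth r (MS_at (~~ hor x) g) - 1)
                 ((mm (~~ hor x))%:Z - smooth r x - 1) q ->
  single x (trunc m m' (msX r (MS_at (~~ hor x) g) * q)) -
    (if MS_at (~~ hor x) g \in MIS T
     then single (MS_at (~~ hor x) g) (trunc m m' (msX r x * q)) else 0)
  \in relations r m m'.
Proof.
move=> xI xg.
have ig := MIS_vertex HT xI xg; have xM := MIS_MS xI.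
have [yM yh yg] := MS_atP Hred (~~ hor x) ig.
have Ex := MS_at_eq xM erefl xg.
set y := MS_at (~~ hor x) g in yM yh yg *.
have nxy : x != y by apply/eqP => E; move: yh; rewrite -E; case: (hor x).
move=> Bq.
have Cx : corr_space r m m' x (msX r y * q).
  by apply/corr_spaceE; rewrite -dbideg_neg -yh; apply/msX_dbideg; rewrite yh dbideg_neg; exact: Bq.
have Cy : corr_space r m m' y (msX r x * q).
  by apply/corr_spaceE; rewrite yh negbK dbideg_neg; apply/msX_dbideg; exact: Bq.
have Bx := truncK (corr_space_bideg Cx); have By := truncK (corr_space_bideg Cy).
set u := _ - _.
have uE z : bipoly (u z) = if z \notin MIS T then 0 else if z == x then msX r y * q
    else if z == y then - (msX r x * q) else 0.
  have E1 : u z = (if z == x then trunc m m' (msX r y * q) else 0) -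
      (if (y \in MIS T) && (z == y) then trunc m m' (msX r x * q) else 0).
    rewrite /u; case: (y \in MIS T); rewrite !ffunE //.
  rewrite E1 bipolyB; case: (boolP (z \in MIS T)) => zI /=.
    case: (eqVneq z x) => [->|zx].
      by rewrite (negbTE nxy) andbF bipoly0 subr0 Bx.
    rewrite bipoly0 sub0r; case: (eqVneq z y) => [zy|_]; last by rewrite andbF bipoly0 oppr0.
    by rewrite -zy zI /= By.
  rewrite ifN; last by apply: contraNneq zI => ->.
  by rewrite ifN ?bipoly0 ?subrr //; apply: contraNN zI => /andP[yI /eqP ->].
have Ey : MS_at (~~ hor x) g = y by [].
have Bq' : bideg (m%:Z - smooth r (MS_at false g) - 1) (m'%:Z - smooth r (MS_at true g) - 1) q.
  by move: Bq Ex Ey; rewrite /dbideg; case: (hor x) => /= Bq -> ->.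
clearbody y; move: Ex Ey; case: (hor x) => /= Ex Ey.
  (* [vertex_relation] puts the minus sign on the horizontal segment, so [q] changes sign when [x]
     is horizontal. *)
  apply: span_of_mem; exists g => //=; exists (- q); first exact: (@dbidegN _ true).
  move=> z; rewrite Ex Ey uE; case: ifP => _ //; case: (eqVneq z x) => [->|zx].
    by rewrite (negbTE nxy) mulrN opprK.
  by case: ifP => _; rewrite ?mulrN.
apply: span_of_mem; exists g => //=; exists q; first exact: Bq'.
by move=> z; rewrite Ex Ey uE.
Qed.

End Correction.

(** * Weights and the exceptional space of an MIS *)

Section Weights.
Variables (R : realType) (T : mesh R) (r : edges T -> int) (m m' : nat).
Hypotheses (HT : is_tmesh T) (Hred : reduced T).
Hypotheses (Hr : smoothness r) (Hconst : constant_along_MS r).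
Local Notation V := 'M[R]_(m.+1, m'.+1).
Local Notation mm := (degree_along m m').
Implicit Types (p q : {poly {poly R}}) (e : edges T) (x y : {set edges T}) (g : vertices T).
Implicit Types (h s : bool) (A : {set {set edges T}}).

Lemma pospart_nat (z : int) : pospart z = (absz (pospart z))%:Z.
Proof. by rewrite gez0_abs // /pospart le_max lexx orbT. Qed.

Definition exponent g h : nat := absz (smooth r (MS_at (~~ h) g) + 1).

Lemma muE h g : mu r m m' h g = ((mm h).+1 - exponent g h)%N%:Z.
Proof.
rewrite /mu /exponent /pospart /degree_along.
case: h => /=.
  have := smooth_ge Hr (MS_at false g); lia.
have := smooth_ge Hr (MS_at true g); lia.
Qed.

Lemma thresholdE x : threshold m m' x = (mm (hor x)).+1%:Z.
Proof. by rewrite /threshold /degree_along; case: (hor x); lia. Qed.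

Definition isolated A x g := `[< carrier x (val g) >] && [forall y in A, ~~ `[< carrier y (val g) >]].

Lemma isolatedP A x g : reflect (carrier x (val g) /\ forall y, y \in A -> ~ carrier y (val g))
  (isolated A x g).
Proof.
apply: (iffP andP) => [[/asboolP xg /forall_inP H]|[xg H]].
  by split=> // y /H /asboolPn.
by split; [exact/asboolP | apply/forall_inP => y /H /asboolPn].
Qed.

Lemma betaE x : beta r m m' x = pospart ((mm (~~ hor x))%:Z - smooth r x).
Proof. by rewrite /beta /degree_along; case: (hor x). Qed.

(* The vertices on x that are isolated from A and one more point, whose exponent
   is chosen to make up for the missing weight, satisfy the hypothesis of
   dbideg_span; the extra point accounts for E. *)
Lemma weight_span x A (W : {vspace {ffun {set edges T} -> V}}) : x \in MIS T ->
  (forall g q, carrier x (val g) -> (forall y, y \in A -> ~ carrier y (val g)) ->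
     dbideg (hor x) ((mm (hor x))%:Z - smooth r (MS_at (~~ hor x) g) - 1)
                    ((mm (~~ hor x))%:Z - smooth r x - 1) q ->
     single x (trunc m m' (msX r (MS_at (~~ hor x) g) * q)) \in W) ->
  exists2 E : {vspace {ffun {set edges T} -> V}},
    (\dim E)%:Z <= pospart (threshold m m' x - weight r m m' A x) * beta r m m' x &
    forall q, corr_space r m m' x q -> single x (trunc m m' q) \in (W + E)%VS.
Proof.
move=> xI HW; have xM := MIS_MS xI; have sx := MS_segment xM.
set h := hor x in HW *; set n := mm h.
set b := (mm (~~ h))%:Z - smooth r x - 1 in HW *.
pose P := [pred g | isolated A x g].
pose J : finType := {g : vertices T | g \in P}.
have JP (j : J) : carrier x (val (val j)) /\ forall y, y \in A -> ~ carrier y (val (val j)).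
  by apply/isolatedP; exact: (valP j).
(* The fictitious point lies beyond all vertices, hence differs from those on [x]. *)
pose s0 := 1 + \sum_(g : vertices T) `|along h (val g)|.
have s0P g : along h (val g) <> s0.
  have : along h (val g) <= `|along h (val g)| by exact: ler_norm.
  rewrite /s0 (bigD1 g) //= => le E.
  have : 0 <= \sum_(i | i != g) `|along h (val i)| by apply: sumr_ge0.
  lra.
pose w := (\sum_(g | g \in P) (n.+1 - exponent g h))%N.
have wE : weight r m m' A x = w%:Z.
  rewrite /weight /w -natz natr_sum; apply: eq_bigr => g _.
  by rewrite natz; exact: muE.
(* The missing weight, 0 if there is none. As [d0 <= n.+1], the exponent [n.+1 - d0] makes the extra
   point contribute exactly [d0]. *)
pose d0 := (n.+1 - w)%N.
pose I : finType := (unit + J)%type.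
pose s (i : I) := match i with inl _ => s0 | inr j => along h (val (val j)) end.
pose e (i : I) := match i with inl _ => (n.+1 - d0)%N | inr j => exponent (val j) h end.
have injs : injective s.
  move=> [[]|j] [[]|j'] //=.
  - by move/esym/s0P.
  - by move/s0P.
  - move=> E; congr inr; apply/val_inj/val_inj/(coord_inj E).
    by rewrite !(carrier_line sx) //; [exact: (JP j').1 | exact: (JP j).1].
have wt : (n.+1 <= \sum_i (n.+1 - e i))%N.
  rewrite big_sumType /= big_const card_unit /= addn0.
  by rewrite -(big_sub P (fun g => n.+1 - exponent g h)%N) -/w /d0; lia.
pose nb := absz (beta r m m' x).
have nbE : beta r m m' x = nb%:Z by rewrite /nb betaE -pospart_nat.
have bnb : b <= nb%:Z - 1 by rewrite -nbE betaE /b -/h /pospart; lia.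
(* The cofactor at the extra point has degree less than [d0] along [x] and less than [nb] across it;
   [n1] and [n2] are these numbers in the order of the variables s, t. *)
pose n1 := if h then d0 else nb. pose n2 := if h then nb else d0.
pose IJ : finType := ('I_n1 * 'I_n2)%type.
pose G (ij : IJ) := single x (trunc m m'
  (ell (~~ h, s0) ^+ (n.+1 - d0) * ('X ^+ ij.1 * 'Y ^+ ij.2))).
exists <<[seq G ij | ij <- enum IJ]>>%VS.
  have -> : pospart (threshold m m' x - weight r m m' A x) * beta r m m' x = (n1 * n2)%N%:Z.
    rewrite thresholdE wE nbE -/h -/n.
    have -> : pospart (n.+1%:Z - w%:Z) = d0%:Z by rewrite /pospart /d0; lia.
    by rewrite /n1 /n2 -PoszM; case: (h) => //; rewrite mulnC.
  rewrite lez_nat; apply: leq_trans (dim_span _) _.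
  by rewrite size_map -cardE card_prod !card_ord.
move=> q /corr_spaceE Bq.
have [Q HQ ->] := dbideg_span injs wt Bq.
rewrite trunc_sum linear_sum /= big_sumType /= addrC; apply: memv_add; last first.
  rewrite (big_pred1 tt) => [|[]//].
  have BQ : bideg (n1%:Z - 1) (n2%:Z - 1) (Q (inl tt)).
    have -> : bideg (n1%:Z - 1) (n2%:Z - 1) = dbideg h (d0%:Z - 1) (nb%:Z - 1).
      by rewrite /n1 /n2; case: (h).
    by apply: dbideg_leq (HQ (inl tt)) => //=; rewrite /d0; lia.
  rewrite (bideg_monomials BQ) mulr_sumr trunc_sum linear_sum memv_suml // => i _.
  rewrite mulr_sumr trunc_sum linear_sum memv_suml // => j _.
  rewrite mulrCA truncZ linearZ /= memvZ //; apply: memv_span.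
  by apply/mapP; exists (i, j); rewrite ?mem_enum.
apply: memv_suml => j _.
have [xg Ag] := JP j.
have ig := MIS_vertex HT xI xg.
have [yM yh yg] := MS_atP Hred (~~ h) ig.
have -> : ell (~~ h, along h (val (val j))) ^+ exponent (val j) h = msX r (MS_at (~~ h) (val j)).
  rewrite /msX /ellX /exponent; congr (ell _ ^+ _).
  rewrite [line _]surjective_pairing -/(hor _) yh -(carrier_line (MS_segment yM) yg) yh.
  by rewrite acrossE negbK.
apply: HW => //; apply: dbideg_leq (HQ (inr j)) => //.
by rewrite /= /exponent smooth_absz //; lia.
Qed.

End Weights.

(** * Deletion and the bound *)

Section Deletion.
Variables (R : realType) (T : mesh R) (r : edges T -> int) (m m' : nat).
Hypotheses (HT : is_tmesh T) (Hred : reduced T).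
Hypotheses (Hr : smoothness r) (Hconst : constant_along_MS r).
Local Notation V := 'M[R]_(m.+1, m'.+1).
Local Notation mm := (degree_along m m').
Local Notation CN := (CNDC r m m').
Local Notation rel := (relations r m m').
Local Notation corr := (corr_sum r m m').
Implicit Types (q : {poly {poly R}}) (x y : {set edges T}) (g : vertices T).
Implicit Types (A : {set {set edges T}}).

Lemma corr_space_cross x g q : x \in MIS T -> carrier x (val g) ->
  dbideg (hor x) ((mm (hor x))%:Z - smooth r (MS_at (~~ hor x) g) - 1)
                 ((mm (~~ hor x))%:Z - smooth r x - 1) q ->
  corr_space r m m' (MS_at (~~ hor x) g) (msX r x * q).
Proof.
move=> xI xg Bq; have ig := MIS_vertex HT xI xg.
have [yM yh yg] := MS_atP Hred (~~ hor x) ig.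
apply/corr_spaceE; rewrite yh negbK dbideg_neg.
by apply/msX_dbideg.
Qed.

Lemma corr_space_self x g q : x \in MIS T -> carrier x (val g) ->
  dbideg (hor x) ((mm (hor x))%:Z - smooth r (MS_at (~~ hor x) g) - 1)
                 ((mm (~~ hor x))%:Z - smooth r x - 1) q ->
  corr_space r m m' x (msX r (MS_at (~~ hor x) g) * q).
Proof.
move=> xI xg; have ig := MIS_vertex HT xI xg.
have [] := MS_atP Hred (~~ hor x) ig; set y := MS_at _ g => _ yh _ Bq.
apply/corr_spaceE; rewrite -dbideg_neg -yh; apply/(msX_dbideg Hr).
by rewrite yh dbideg_neg.
Qed.

Lemma MS_at_cross x g : x \in MIS T -> carrier x (val g) -> MS_at (~~ hor x) g != x /\
  carrier (MS_at (~~ hor x) g) (val g).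
Proof.
move=> xI xg; have ig := MIS_vertex HT xI xg.
have [yM yh yg] := MS_atP Hred (~~ hor x) ig; split=> //.
by apply/eqP => E; move: yh; rewrite E; case: (hor x).
Qed.

Lemma deletion_stateS k : deletion_state r m m' k.+1 =
  (deletion_state r m m' k :\: deleted r m m' k)%SET.
Proof. by []. Qed.

(** At a vertex counted by the absolute weight, the crossing segment is not an MIS or was deleted in
    an earlier pass. Its term is then absent or in [rel] by induction, so the vertex relation puts
    the term of [x] in [rel]. As the weight reaches the threshold, the exceptional space of
    [weight_span] is 0. *)
Lemma deleted_relations k x q : x \in MIS T -> x \notin deletion_state r m m' k ->
  corr_space r m m' x q -> single x (trunc m m' q) \in rel.
Proof.
elim: k x q => [|k IHk] x q xI; first by rewrite /deletion_state /= xI.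
rewrite deletion_stateS inE negb_and negbK => /orP[xd|]; last exact: IHk.
set A := deletion_state r m m' k in IHk xd.
have /andP[xA th] : (x \in A) && (threshold m m' x <= abs_weight r m m' A x).
  by move: xd; rewrite /deleted /diagonalizable_MIS inE.
have H g q' : carrier x (val g) -> (forall y, y \in (A :\ x)%SET -> ~ carrier y (val g)) ->
    dbideg (hor x) ((mm (hor x))%:Z - smooth r (MS_at (~~ hor x) g) - 1)
                   ((mm (~~ hor x))%:Z - smooth r x - 1) q' ->
    single x (trunc m m' (msX r (MS_at (~~ hor x) g) * q')) \in rel.
  move=> xg noA Bq; have := relation_pair HT Hred Hr xI xg Bq.
  case: ifP => [yI|_]; last by rewrite subr0.
  have [yx yg] := MS_at_cross xI xg.
  have yA : MS_at (~~ hor x) g \notin A.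
    by apply/negP => yA; apply: (noA _ _ yg); rewrite !inE yx.
  have := IHk _ _ yI yA (corr_space_cross xI xg Bq) => yr.
  by move=> /rpredD/(_ yr); rewrite subrK.
have [E dE HE] := weight_span HT Hred Hr xI H.
move=> /HE; suff -> : E = 0%VS by rewrite addv0.
apply/eqP; rewrite -dimv_eq0 -leqn0 -lez_nat; apply: le_trans dE _.
have -> : pospart (threshold m m' x - weight r m m' (A :\ x) x) = 0.
  by move: th; rewrite /abs_weight /pospart; lia.
by rewrite mul0r.
Qed.

Lemma corr_sum_MIS_sub : (corr (MIS T) <= corr CN + rel)%VS.
Proof.
apply: corr_sum_sub => x q xI xq; case: (boolP (x \in CN)) => xC.
  by apply: (subvP (addvSl _ _)); exact: (single_corr_sum Hr).
by apply: (subvP (addvSr _ _)); exact: deleted_relations xC xq.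
Qed.

Lemma deletion_state_sub k x : x \in deletion_state r m m' k -> x \in MIS T.
Proof.
elim: k => [//|k IHk]; rewrite deletion_stateS inE => /andP[_]; exact: IHk.
Qed.

Lemma deletedP k x : x \in MIS T -> x \notin deletion_state r m m' k ->
  exists l, x \in deleted r m m' l.
Proof.
move=> xI; elim: k => [|k IHk]; first by rewrite /deletion_state /= xI.
by rewrite deletion_stateS inE negb_and negbK => /orP[xd|//]; exists k.
Qed.

Section Order.
Variable iota : seq {set edges T}.
Hypotheses (Hiota : total_order_MIS iota) (Hfollow : follows_reversed_deletion r m m' iota).

Definition segment_bound x : int :=
  pospart (threshold m m' x - rel_weight r m m' iota x) * beta r m m' x.

Lemma corr_sum_CNDC_sub : exists2 E : {set edges T} -> {vspace {ffun {set edges T} -> V}},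
  (forall x, x \in CN -> (\dim (E x))%:Z <= segment_bound x) &
  (corr CN <= corr CN :&: rel + \sum_(x in CN) E x)%VS.
Proof.
pose earlier x : {set {set edges T}} := [set y in MIS T | (index y iota < index x iota)%N]%SET.
pose later x : {set {set edges T}} := [set y in CN | (index x iota < index y iota)%N]%SET.
have [E HE] : exists E : {set edges T} -> {vspace {ffun {set edges T} -> V}}, forall x, x \in CN ->
    (\dim (E x))%:Z <= segment_bound x /\
    forall q, corr_space r m m' x q ->
      single x (trunc m m' q) \in (corr CN :&: rel + corr (later x) + E x)%VS.
  suff H x : exists Ex : {vspace {ffun {set edges T} -> V}}, x \in CN ->
      (\dim Ex)%:Z <= segment_bound x /\
      forall q, corr_space r m m' x q ->
        single x (trunc m m' q) \in (corr CN :&: rel + corr (later x) + Ex)%VS.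
    by have [E HE] := boolp.choice H; exists E.
  case: (boolP (x \in CN)) => xC; last by exists 0%VS.
  have xI := deletion_state_sub xC.
  have H g q : carrier x (val g) -> (forall y, y \in earlier x -> ~ carrier y (val g)) ->
      dbideg (hor x) ((mm (hor x))%:Z - smooth r (MS_at (~~ hor x) g) - 1)
                     ((mm (~~ hor x))%:Z - smooth r x - 1) q ->
      single x (trunc m m' (msX r (MS_at (~~ hor x) g) * q)) \in
        (corr CN :&: rel + corr (later x))%VS.
    move=> xg noA Bq; have RP := relation_pair HT Hred Hr xI xg Bq.
    have [yx yg] := MS_at_cross xI xg.
    have Cx := corr_space_self xI xg Bq.
    have xCs := single_corr_sum Hr xC Cx.
    move: RP; case: ifP => [yI|_] RP; last first.
      by rewrite subr0 in RP; apply: (subvP (addvSl _ _)); rewrite memv_cap xCs.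
    have lt : (index x iota < index (MS_at (~~ hor x) g) iota)%N.
      rewrite ltn_neqAle leqNgt; apply/andP; split.
        apply: contraNneq yx => E; apply/eqP/esym.
        by apply: (index_inj x _ _ E); rewrite Hiota.2.
      by apply/negP => lt; apply: (noA _ _ yg); rewrite inE yI.
    have yC : MS_at (~~ hor x) g \in CN.
      apply: contraT => /(deletedP yI)[k yd].
      by have := Hfollow.2 _ _ _ yd xC; rewrite /precedes ltnNge (ltnW lt).
    have Cy := corr_space_cross xI xg Bq.
    (* The difference of the two terms is a relation inside M(C); the crossing term, added back,
       belongs to [corr (later x)]. *)
    rewrite -(subrK (single (MS_at (~~ hor x) g) (trunc m m' (msX r x * q))) (single x _)).
    apply: memv_add.
      rewrite memv_cap RP andbT; apply: rpredB; first exact: xCs.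
      exact: (single_corr_sum Hr yC Cy).
    by apply: (single_corr_sum Hr) => //; rewrite inE yC.
  have [Ex dE Hq] := weight_span HT Hred Hr xI H.
  by exists Ex => _; split.
exists E => [x xC|]; first by have [] := HE x xC.
set W := (_ + _)%VS.
(* Induction on the number of entries of [iota] from [x] on, so that [later x] is settled before
   [x]; [n = 0] cannot occur, because [x] itself is listed. *)
suff H n x q : (size iota - index x iota <= n)%N -> x \in CN -> corr_space r m m' x q ->
    single x (trunc m m' q) \in W.
  by apply: corr_sum_sub => x q; exact: (H (size iota)%N x q (leq_subr _ _)).
elim: n x q => [|n IHn] x q le xC xq.
  have lt : (index x iota < size iota)%N by rewrite index_mem Hiota.2; exact: deletion_state_sub xC.
  by move: le; rewrite leqn0 subn_eq0 leqNgt lt.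
have [_ /(_ q xq)] := HE x xC; apply/subvP; rewrite !subv_add -andbA; apply/and3P; split.
- exact: addvSl.
- apply: corr_sum_sub => y q'; rewrite inE => /andP[yC lt] yq; apply: IHn => //.
  by move: le; rewrite !leq_subLR => le; apply: leq_trans le _; rewrite addnS -addSn leq_add2r.
- by apply: subv_trans (addvSr _ _); rewrite (bigD1 x xC) addvSl.
Qed.

Lemma bound_sum : bound r m m' iota = \sum_(x in CN) segment_bound x.
Proof.
rewrite /bound [RHS](bigID (fun x => hor x)) /=; congr (_ + _).
  by apply: eq_bigr => x /andP[_ hx]; rewrite /segment_bound /threshold hx.
by apply: eq_bigr => x /andP[_ hx]; rewrite /segment_bound /threshold (negbTE hx).
Qed.

Lemma dim_H_bound : 0 <= dim_H r m m' CN <= bound r m m' iota.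
Proof.
have [E dE sub] := corr_sum_CNDC_sub.
rewrite /dim_H /dim_quot subr_ge0 lez_nat dimvS ?capvSl //= bound_sum.
rewrite lerBlDl; apply: (@le_trans _ _ (\dim (corr CN :&: rel) + \sum_(x in CN) \dim (E x))%N%:Z).
  rewrite lez_nat; apply: leq_trans (dimvS sub) _.
  apply: leq_trans (dimv_add_leqif _ _) _; rewrite leq_add2l; exact: dimv_leq_sum.
rewrite PoszD lerD2l -natz natr_sum; apply: ler_sum => x xC.
by rewrite natz; exact: dE.
Qed.

End Order.

Local Notation edge_ideals := (edge_family (edge_ideal r m m')).
Local Notation vertex_ideals := (vertex_family (vertex_ideal r m m')).
Local Notation bd := (boundary T m m').

Lemma dim_vertex_ideals :
  (\dim vertex_ideals + \dim (corr CN :&: rel) <= \dim (bd @: edge_ideals) + \dim (corr CN))%N.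
Proof.
apply: (@dim_quotient_bound _ _ _ (correction r m m')).
  apply: subv_trans (vertex_ideals_sub m m' HT Hred Hr Hconst) _.
  rewrite subv_add addvSl /=; apply: subv_trans (limgS _ corr_sum_MIS_sub) _.
  rewrite limgD subv_add addvSr /=.
  exact: subv_trans (correction_relations m m' HT Hred Hr Hconst) (addvSl _ _).
exact: subv_trans (limgS _ (capvSr _ _)) (correction_relations m m' HT Hred Hr Hconst).
Qed.

(** * Jumps of splines and the dimension of the spline space *)

Section Sides.
Variables cp cm : edges T -> cells T.
Hypothesis Hside : side_cells cp cm.

Definition jumps_fun (f : {ffun cells T -> V}) : {ffun edges T -> V} :=
  [ffun e => if interior_edge e then f (cp e) - f (cm e) else 0].

Lemma jumps_linear : linear jumps_fun.
Proof.
move=> c a b; apply/ffunP => e; rewrite !ffunE; case: ifP => _; last by rewrite scaler0 addr0.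
by rewrite scalerBr opprD addrACA.
Qed.

Definition jumps : 'Hom({ffun cells T -> V}, {ffun edges T -> V}) :=
  sval (hom_of_linear jumps_linear).

Lemma jumpsE f : jumps f = jumps_fun f.
Proof. exact: (svalP (hom_of_linear jumps_linear)). Qed.

Local Notation chains := (edge_family (fun _ : edges T => fullv : {vspace V})).

Lemma jumps_spline f : f \in spline_space r m m' -> jumps f \in edge_ideals.
Proof.
rewrite memv_preim; apply/subvP; apply: span_of_sub => u Su.
rewrite -memv_preim jumpsE; apply/memv_prod => e; rewrite ffunE; case: ifP => ie; last exact: mem0v.
have [sp sm _ _] := Hside ie.
have [||q Hq] := Su e (cp e) (cm e) ie; first by apply/eqP; exact: (side_ne HT Hside).
  by move=> p ep; split; [exact: sp | exact: sm].
by apply: span_of_mem; exists q; rewrite bipolyB.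
Qed.

Lemma cycles_sub : (chains :&: lker bd <= limg jumps)%VS.
Proof.
apply/subvP => a; rewrite memv_cap memv_ker => /andP[/memv_prod ca /eqP ba].
have circ p : p \in vertices T -> (domain T)° p -> circulation a p = 0.
  move=> pv ip; have := congr1 (fun z : {ffun vertices T -> V} => z (FSetSub pv)) ba.
  by rewrite boundaryE !ffunE ifT //; exact/asboolP.
have [f Hf] := edge_cochain_exact HT Hred Hside circ.
have -> : a = jumps (finfun f).
  apply/ffunP => e; rewrite jumpsE !ffunE; have := ca e; case: ifP => [ie _|_].
    by rewrite Hf.
  by rewrite memv0 => /eqP.
by rewrite memv_img // memvf.
Qed.

(** When [b1], [b2] and [b3] are added, the dimension of cycles plus edge ideals and that of the
    boundaries of the edge ideals cancel; what remains is [chi] and [dim_H]. *)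
Lemma dim_spline_bound : dim_spline r m m' <= chi r m m' + dim_H r m m' CN.
Proof.
have b1 := dim_preimage_bound jumps_spline cycles_sub.
pose G0 := (vertex_family (fun _ : vertices T => fullv : {vspace V})).
have b2 : (\dim chains + \dim (bd @: edge_ideals) <=
    \dim ((chains :&: lker bd) + edge_ideals) + \dim G0)%N.
  apply: dim_cycles_bound.
    apply/subvP => a /memv_prod H; apply/memv_prod => e; have := H e.
    by case: ifP => // _ _; exact: memvf.
  move=> a _; apply/memv_prod => g; case: ifP => ig; first exact: memvf.
  by rewrite boundaryE ffunE ig mem0v.
have b3 := dim_vertex_ideals.
have dfam (I : finType) (P : pred I) (U : I -> {vspace V}) :
    (\dim (prodv (fun i => if P i then U i else 0%VS)))%:Z = \sum_(i | P i) (\dim (U i))%:Z.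
  rewrite dim_prodv -natz natr_sum [RHS]big_mkcond; apply: eq_bigr => i _.
  by case: ifP => _; rewrite ?natz ?dimv0.
have d1 : (\dim {: {ffun cells T -> V}})%:Z = \sum_(c : cells T) (\dim {: V})%:Z.
  rewrite -(dfam _ xpredT (fun _ => fullv)); congr (Posz (\dim _)).
  by apply/eqP; rewrite eqEsubv subvf andbT; apply/subvP => f _; apply/memv_prod => i; exact: memvf.
have -> : chi r m m' = (\dim {: {ffun cells T -> V}})%:Z
    - ((\dim chains)%:Z - (\dim edge_ideals)%:Z) + ((\dim G0)%:Z - (\dim vertex_ideals)%:Z).
  rewrite /chi d1 !dfam -!sumrB; congr (_ - _ + _).
rewrite /dim_spline /dim_H /dim_quot.
move: b1 b2 b3; rewrite -/G0.
move: (\dim (chains :&: lker bd + edge_ideals)) (\dim G0) (\dim chains)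
  (\dim (bd @: edge_ideals)) (\dim edge_ideals) (\dim vertex_ideals) => d1' d2 d3 d4 d5 d6.
move: (\dim _) (\dim _) (\dim _) (\dim _) => d7 d8 d9 d10. lia.
Qed.

End Sides.

End Deletion.

Theorem theorem3p23 (R : realType) (T : mesh R) (r : edges T -> int)
    (m m' : nat) (iota : seq {set edges T}) :
  is_tmesh T -> reduced T -> smoothness r -> constant_along_MS r ->
  total_order_MIS iota -> follows_reversed_deletion r m m' iota ->
  (0 <= dim_H r m m' (CNDC r m m') <= bound r m m' iota) /\
  dim_spline r m m' <= chi r m m' + bound r m m' iota.
Proof.
move=> HT Hred Hr Hconst Hiota Hfollow.
have bH := dim_H_bound HT Hred Hr Hiota Hfollow; split=> //.
have [cp [cm Hside]] := side_cells_exist HT Hred.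
apply: le_trans (dim_spline_bound m m' HT Hred Hr Hconst Hside) _.
by rewrite lerD2l; case/andP: bH.
Qed.
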